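(* (Inner bound, rate distortion.) Let $D_1,D_2\ge0$. A triple $(R_0,R_X,R_Y)$ is achievable with distortions $D_1,D_2$ whenever \begin{align*} R_0 &> I(X;U|Y),\quad R_X > I(V;X|T,W),\quad R_Y > I(U,Y;W|V,T),\\ R_X+R_Y &> I(X,Y;V,T,W)+I(U;W|V,X,T,Y), \end{align*} for some random variables $T,U,V,W$ with finite alphabets $\mathcal T,\mathcal U,\mathcal V,\mathcal W$ jointly distributed with $(X,Y)$ such that $T-U-X-Y$ and $V-(X,T)-(U,Y)-W$ are Markov chains and there exist functions $g_1,g_2$ of $(V,T,W)$ (with values in $\mathcal F_1,\mathcal F_2$) with $\mathbb E\, d_i(f_i(X,Y),g_i(V,T,W))\le D_i$ for $i=1,2$. Moreover, one may restrict to $|\mathcal T|\le|\mathcal X|+4$, $|\mathcal V|\le(|\mathcal X|+4)|\mathcal X|+1$, $|\mathcal W|\le|\mathcal U|\cdot|\mathcal Y|+1$.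
   Context: Setup: $\mathcal X,\mathcal Y,\mathcal F_1,\mathcal F_2$ finite sets, $(X_i,Y_i)_{i\ge1}$ i.i.d. copies of $(X,Y)\sim p(x,y)$, functions $f_i:\mathcal X\times\mathcal Y\to\mathcal F_i$ and distortion measures $d_i:\mathcal F_i\times\mathcal F_i\to\mathbb R_{\ge0}$, $i=1,2$. An $(n,R_0,R_X,R_Y)$ code consists of encoders $\varphi_0:\mathcal X^n\to\{1,\dots,2^{nR_0}\}$ (transmitter-$X$ to transmitter-$Y$), $\varphi_X:\mathcal X^n\to\{1,\dots,2^{nR_X}\}$, $\varphi_Y:\mathcal Y^n\times\{1,\dots,2^{nR_0}\}\to\{1,\dots,2^{nR_Y}\}$ and decoders $\psi_i:\{1,\dots,2^{nR_X}\}\times\{1,\dots,2^{nR_Y}\}\to\mathcal F_i^n$, $i=1,2$. Writing $\hat F_i=\psi_i(\varphi_X(\mathbf X),\varphi_Y(\varphi_0(\mathbf X),\mathbf Y))$, its average distortions are $\frac1n\sum_{j=1}^n\mathbb E\,d_i(f_i(X_j,Y_j),(\hat F_i)_j)$. A triple is achievable with distortions $D_1,D_2$ if for every $\varepsilon>0$ and all large $n$ there is an $(n,R_0,R_X,R_Y)$ code whose average distortions are at most $D_1$ and $D_2$ respectively.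
   Formalization: Achievability is taken to mean average distortions at most D_1+ε and D_2+ε (the stated definition leaves ε unused and bounds by D_1, D_2 exactly, which fails e.g. for zero distortion at rates below log of the alphabet size). *)

(* Defs.v *)
From mathcomp Require Import all_boot.
From Stdlib Require Import Reals.
Set Implicit Arguments.
Unset Strict Implicit.
Unset Printing Implicit Defensive.
Open Scope R_scope.

Definition rsum (T : finType) (f : T -> R) : R :=
  foldr (fun x acc => f x + acc) 0 (enum T).

Definition rprod (T : finType) (f : T -> R) : R :=
  foldr (fun x acc => f x * acc) 1 (enum T).

Definition log2 (x : R) : R := ln x / ln 2.

Definition is_pmf (T : finType) (P : T -> R) : Prop :=
  (forall w, 0 <= P w) /\ rsum P = 1.

Section Info.
Variables (Om : finType) (P : Om -> R).

Definition pr (E : pred Om) : R := rsum (fun w => if E w then P w else 0).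

Definition condMI (al be ga : finType) (A : Om -> al) (B : Om -> be) (C : Om -> ga) : R :=
  rsum (fun abc : al * be * ga =>
    let: (a, b, c) := abc in
    let pabc := pr (fun w => [&& A w == a, B w == b & C w == c]) in
    let pac := pr (fun w => (A w == a) && (C w == c)) in
    let pbc := pr (fun w => (B w == b) && (C w == c)) in
    let pc := pr (fun w => C w == c) in
    if Rlt_dec 0 pabc then pabc * log2 (pabc * pc / (pac * pbc)) else 0).

Definition MI (al be : finType) (A : Om -> al) (B : Om -> be) : R :=
  condMI A B (fun _ => tt).

Definition markov3 (al be ga : finType) (A : Om -> al) (B : Om -> be) (C : Om -> ga) : Prop :=
  forall a b c,
    pr (fun w => [&& A w == a, B w == b & C w == c]) * pr (fun w => B w == b)
    = pr (fun w => (A w == a) && (B w == b)) * pr (fun w => (B w == b) && (C w == c)).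

Definition markov4 (al be ga de : finType)
  (A : Om -> al) (B : Om -> be) (C : Om -> ga) (D : Om -> de) : Prop :=
  markov3 A B C /\ markov3 (fun w => (A w, B w)) C D.

Definition expect (h : Om -> R) : R := rsum (fun w => P w * h w).
End Info.

Definition msgs (n : nat) (r : R) : nat := Z.to_nat (Int_part (Rpower 2 (INR n * r))).

(* average distortion (1/n) sum_j E d(f(X_j,Y_j), (Fhat)_j) of a reconstruction
   Fhat : X^n -> Y^n -> F^n, for (X_j,Y_j) i.i.d. ~ p *)
Definition avg_dist (X Y F : finType) (p : X -> Y -> R) (f : X -> Y -> F)
  (d : F -> F -> R) (n : nat)
  (Fhat : n.-tuple X -> n.-tuple Y -> n.-tuple F) : R :=
  / INR n *
  rsum (fun xs : n.-tuple X => rsum (fun ys : n.-tuple Y =>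
    rprod (fun j : 'I_n => p (tnth xs j) (tnth ys j)) *
    rsum (fun j : 'I_n =>
      d (f (tnth xs j) (tnth ys j)) (tnth (Fhat xs ys) j)))).

Definition achievable (X Y F1 F2 : finType) (p : X -> Y -> R)
  (f1 : X -> Y -> F1) (f2 : X -> Y -> F2)
  (d1 : F1 -> F1 -> R) (d2 : F2 -> F2 -> R)
  (D1 D2 R0 RX RY : R) : Prop :=
  forall eps, 0 < eps ->
  exists N : nat, forall n : nat, (N <= n)%nat ->
  exists (phi0 : n.-tuple X -> 'I_(msgs n R0))
         (phiX : n.-tuple X -> 'I_(msgs n RX))
         (phiY : n.-tuple Y -> 'I_(msgs n R0) -> 'I_(msgs n RY))
         (psi1 : 'I_(msgs n RX) -> 'I_(msgs n RY) -> n.-tuple F1)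
         (psi2 : 'I_(msgs n RX) -> 'I_(msgs n RY) -> n.-tuple F2),
    avg_dist p f1 d1 (fun xs ys => psi1 (phiX xs) (phiY ys (phi0 xs))) <= D1 + eps /\
    avg_dist p f2 d2 (fun xs ys => psi2 (phiX xs) (phiY ys (phi0 xs))) <= D2 + eps.

Definition inner_cond (X Y F1 F2 : finType) (p : X -> Y -> R)
  (f1 : X -> Y -> F1) (f2 : X -> Y -> F2)
  (d1 : F1 -> F1 -> R) (d2 : F2 -> F2 -> R)
  (D1 D2 R0 RX RY : R)
  (T U V W : finType) (q : X * Y * T * U * V * W -> R)
  (g1 : V -> T -> W -> F1) (g2 : V -> T -> W -> F2) : Prop :=
  let rX := fun o : X * Y * T * U * V * W => o.1.1.1.1.1 in
  let rY := fun o : X * Y * T * U * V * W => o.1.1.1.1.2 in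
  let rT := fun o : X * Y * T * U * V * W => o.1.1.1.2 in
  let rU := fun o : X * Y * T * U * V * W => o.1.1.2 in
  let rV := fun o : X * Y * T * U * V * W => o.1.2 in
  let rW := fun o : X * Y * T * U * V * W => o.2 in
  is_pmf q /\
  (forall x y, pr q (fun o => (rX o == x) && (rY o == y)) = p x y) /\
  markov4 q rT rU rX rY /\
  markov4 q rV (fun o => (rX o, rT o)) (fun o => (rU o, rY o)) rW /\
  expect q (fun o => d1 (f1 (rX o) (rY o)) (g1 (rV o) (rT o) (rW o))) <= D1 /\
  expect q (fun o => d2 (f2 (rX o) (rY o)) (g2 (rV o) (rT o) (rW o))) <= D2 /\
  R0 > condMI q rX rU rY /\
  RX > condMI q rV rX (fun o => (rT o, rW o)) /\
  RY > condMI q (fun o => (rU o, rY o)) rW (fun o => (rV o, rT o)) /\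
  RX + RY > MI q (fun o => (rX o, rY o)) (fun o => (rV o, rT o, rW o))
            + condMI q rU rW (fun o => (rV o, rX o, rT o, rY o)).

(* Main.v *)
(* Achievability, by random binning.  Draw (x, y, t, u, v, w) i.i.d. from the
   single-letter law and bin t, (t, u), (t, v) and (t, w) at random; every bin index has
   a shared part and, except for t, a message part.  As long as the shared parts are below
   the rates H(T|X), H(U|XT), H(V|XT) and H(W|TUY), they are nearly uniform and nearly
   independent of what the corresponding encoder observes (leftover hashing).  Hence they
   can be drawn first, uniformly, and each encoder can then sample its sequence
   conditionally on them: this changes the joint law by little in total variation, and no
   Markov lemma is needed.  Shared and message parts together exceed the Slepian-Wolf
   rates at transmitter Y, for (t, u), and at the decoder, for (t, v, w), so both decode
   correctly.  Excess distortion is part of the error event, so that a single average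
   selects one deterministic code for both distortion constraints.

   Cardinalities, by reweighting T and V.  All the quantities are linear in the weights of
   T once the law of X is kept.  Replacing the three constraints on (RX, RY) by the two
   coordinates of the corner points (A, C - A) and (C - B, B) of each T = t leaves |X| + 5
   linear functionals, and minimising one of them leaves |X| + 4 atoms.  V is reduced
   separately for every t, to |X| + 5 <= (|X| + 4)|X| + 1 atoms, which may be relabelled
   in common.  As |U| is free, padding U with an independent copy of the alphabet of W
   bounds |W|. *)
Require Import Defs.
From mathcomp Require Import all_boot.
From Stdlib Require Import Reals Lra Lia ZArith.

(** The scheme has six collision events: at transmitter Y a wrong t, or the right t with a wrong u;
    at the decoder a wrong t, or the right t with v, w or both wrong. The region has only four
    inequalities. The chain T - U - X - Y gives I(X;U|Y) = I(X;T,U|Y), so delivering t along with u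
    costs no extra rate, and the two surplus events are covered by I(X;T|Y) >= 0 and I(X;T) >= 0. A
    t without message part suffices because u, v and w are hashed together with t: under a wrong t
    all these bins collide only by chance. Informations are handled as pointwise densities, linear
    in logarithms of marginals. Once the Markov chains have removed the marginals that keep u but
    forget t, reweighting T and V leaves every density unchanged, and a rate becomes a linear
    functional of the weights. Normalisation needs no functional of its own, being implied by the
    law of X. The corner points save one atom: three separate rate functionals would leave |X| + 5
    atoms for T. *)

Lemma Int_part_nat_bounds (x : R) : (0 <= x ->
  INR (Z.to_nat (Int_part x)) <= x /\ x < INR (Z.to_nat (Int_part x)) + 1)%R.
Proof.
intros x0; destruct (base_Int_part x) as [h1 h2].
assert (h : (0 <= Int_part x)%Z).
{ assert (-1 < Int_part x)%Z; [apply lt_IZR; lra | lia]. }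
rewrite INR_IZR_INZ Z2Nat.id; [lra | exact h].
Qed.

Lemma up_nat_bounds (x : R) : (0 <= x ->
  x < INR (Z.to_nat (up x)) /\ INR (Z.to_nat (up x)) <= x + 1)%R.
Proof.
intros x0; destruct (archimed x) as [h1 h2].
assert (h : (0 <= up x)%Z) by (apply le_IZR; lra).
rewrite INR_IZR_INZ Z2Nat.id; [lra | exact h].
Qed.

(* [all_boot] is imported again because Stdlib rebinds the delimiter of [nat_scope]. *)
From mathcomp Require Import all_boot all_order all_algebra.
From mathcomp Require Import Rstruct boolp.
From mathcomp Require Import ring lra.
Set Implicit Arguments.
Unset Strict Implicit.
Unset Printing Implicit Defensive.
Import Order.TTheory GRing.Theory Num.Theory.
Local Open Scope ring_scope.

(** * Random functions *)

Section RandomFunction.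
Variables (R : realFieldType) (A B : finType) (K : A -> B -> R).

(** The values [phi a] are independent, with laws [K a]. Hash functions, samplers, i.i.d. sequences
    and memoryless kernels are all instances. *)
Definition rfun_weight (phi : {ffun A -> B}) : R := \prod_a K a (phi a).

Hypothesis K1 : forall a, \sum_b K a b = 1.

Lemma rfun_weight_ge0 phi : (forall a b, 0 <= K a b) -> 0 <= rfun_weight phi.
Proof. by move=> K0; apply: prodr_ge0. Qed.

Lemma rfun_weight_prod (G : A -> B -> R) :
  \sum_phi rfun_weight phi * \prod_a G a (phi a) = \prod_a \sum_b K a b * G a b.
Proof. by rewrite bigA_distr_bigA; apply: eq_bigr => phi _; rewrite -big_split. Qed.

Lemma rfun_weight_sum1 : \sum_phi rfun_weight phi = 1.
Proof.
pose G (_ : A) (_ : B) : R := 1.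
transitivity (\sum_phi rfun_weight phi * \prod_a G a (phi a)).
  by apply: eq_bigr => phi _; rewrite big1 ?mulr1.
rewrite rfun_weight_prod big1 // => a _.
by rewrite -[RHS](K1 a); apply: eq_bigr => b _; rewrite mulr1.
Qed.

Lemma rfun_weight_eval2 a a' (h h' : B -> R) : a != a' ->
  \sum_phi rfun_weight phi * (h (phi a) * h' (phi a')) =
  (\sum_b K a b * h b) * (\sum_b K a' b * h' b).
Proof.
move=> aa'.
pose G i b := if i == a then h b else if i == a' then h' b else 1.
have prodG F : (forall i, i != a -> i != a' -> F i = 1) ->
    \prod_i F i = F a * F a' :> R.
  move=> F1; rewrite (bigD1 a) //= (bigD1 a') 1?eq_sym //= big1 ?mulr1 //.
  by move=> i /andP[]; apply: F1.
transitivity (\sum_phi rfun_weight phi * \prod_i G i (phi i)).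
  apply: eq_bigr => phi _; congr (_ * _); rewrite prodG /G ?eqxx; last first.
    by move=> i /negPf-> /negPf->.
  by rewrite eq_sym (negPf aa').
rewrite rfun_weight_prod prodG /G ?eqxx; last first.
  move=> i /negPf-> /negPf->; rewrite -[RHS](K1 i).
  by apply: eq_bigr => b _; rewrite mulr1.
by rewrite eq_sym (negPf aa').
Qed.

Lemma rfun_weight_eval a (h : B -> R) :
  \sum_phi rfun_weight phi * h (phi a) = \sum_b K a b * h b.
Proof.
pose G i b := if i == a then h b else 1.
have prodG F : (forall i, i != a -> F i = 1) -> \prod_i F i = F a :> R.
  by move=> F1; rewrite (bigD1 a) //= big1 ?mulr1.
transitivity (\sum_phi rfun_weight phi * \prod_i G i (phi i)).
  apply: eq_bigr => phi _; congr (_ * _); rewrite prodG /G ?eqxx //.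
  by move=> i /negPf->.
rewrite rfun_weight_prod prodG /G ?eqxx // => i /negPf->.
by rewrite -[RHS](K1 i); apply: eq_bigr => b _; rewrite mulr1.
Qed.

(** Independence and centring kill the cross terms. The identity serves both the deviation of a bin
    mass under a random hash and Chebyshev's inequality for i.i.d. sums. *)
Lemma rfun_weight_variance (Z : A -> B -> R) :
  (forall a, \sum_b K a b * Z a b = 0) ->
  \sum_phi rfun_weight phi * (\sum_a Z a (phi a)) ^+ 2 =
  \sum_a \sum_b K a b * Z a b ^+ 2.
Proof.
move=> Z0.
transitivity (\sum_a \sum_a' \sum_phi
    rfun_weight phi * (Z a (phi a) * Z a' (phi a'))).
  under [RHS]eq_bigr do rewrite exchange_big.
  rewrite exchange_big; apply: eq_bigr => phi _.
  rewrite expr2 big_distrl big_distrr; apply: eq_bigr => a _ /=.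
  by rewrite !big_distrr.
apply: eq_bigr => a _; rewrite (bigD1 a) //= [X in _ + X]big1 ?addr0; last first.
  by move=> a' aa'; rewrite rfun_weight_eval2 1?eq_sym // Z0 mul0r.
by rewrite -(rfun_weight_eval a (fun b => Z a b ^+ 2)).
Qed.

End RandomFunction.

Section Averaging.
Variable R : realFieldType.

Lemma average_le (I : finType) (w e : I -> R) (c : R) :
  (forall i, 0 <= w i) -> \sum_i w i = 1 -> (forall i, e i <= c) ->
  \sum_i w i * e i <= c.
Proof.
move=> w0 w1 ec; apply: (@le_trans _ _ (\sum_i w i * c)).
  by apply: ler_sum => i _; apply: ler_wpM2l.
by rewrite -mulr_suml w1 mul1r.
Qed.

Lemma exists_le_average (I : finType) (w e : I -> R) (c : R) :
  (forall i, 0 <= w i) -> \sum_i w i = 1 -> \sum_i w i * e i <= c ->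
  exists i, e i <= c.
Proof.
move=> w0 w1 wec; apply/existsP; apply: contraT.
rewrite negb_exists => /forallP e_gt.
have [i wi] : exists i, 0 < w i.
  apply/existsP; apply: contraT; rewrite negb_exists => /forallP wn.
  have : \sum_i w i = 0.
    by apply: big1 => i _; apply/eqP; rewrite eq_le w0 andbT leNgt.
  by rewrite w1 => /eqP; rewrite oner_eq0.
suff : c < \sum_i w i * e i by rewrite ltNge wec.
have -> : c = \sum_i w i * c by rewrite -mulr_suml w1 mul1r.
rewrite [ltLHS](bigD1 i) // [ltRHS](bigD1 i) //=.
apply: ltr_leD; first by rewrite ltr_pM2l // ltNge.
by apply: ler_sum => j _; apply: ler_wpM2l => //; rewrite ltW // ltNge.
Qed.

End Averaging.

(** * Leftover hashing *)

Section Hashing.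
Variable R : realFieldType.

Definition unif (Z : finType) : R := #|Z|%:R^-1.

Definition hash_weight (A Z : finType) : {ffun A -> Z} -> R :=
  rfun_weight (fun _ _ => unif Z).

Lemma unif_ge0 (Z : finType) : 0 <= unif Z.
Proof. by rewrite invr_ge0 ler0n. Qed.

Lemma unif_sum1 (Z : finType) : (0 < #|Z|)%N -> \sum_(z : Z) unif Z = 1.
Proof.
move=> Z0; rewrite sumr_const -[LHS]mulr_natr mulVf // pnatr_eq0 -lt0n //.
Qed.

Lemma unif_eq_sum (Z : finType) (z : Z) : \sum_z' unif Z * (z' == z)%:R = unif Z.
Proof.
rewrite (bigD1 z) //= eqxx mulr1 big1 ?addr0 // => z' /negPf->.
by rewrite mulr0.
Qed.

Lemma hash_weight_ge0 (A Z : finType) (B : {ffun A -> Z}) : 0 <= hash_weight B.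
Proof. by apply: rfun_weight_ge0 => *; exact: unif_ge0. Qed.

Lemma hash_weight_sum1 (A Z : finType) : (0 < #|Z|)%N ->
  \sum_(B : {ffun A -> Z}) hash_weight B = 1.
Proof. by move=> Z0; apply: rfun_weight_sum1 => _; exact: unif_sum1. Qed.

Lemma hash_collision (A Z : finType) (a a' : A) : (0 < #|Z|)%N -> a != a' ->
  \sum_(B : {ffun A -> Z}) hash_weight B * (B a == B a')%:R = unif Z.
Proof.
move=> Z0 aa'.
transitivity (\sum_z \sum_(B : {ffun A -> Z})
    hash_weight B * ((B a == z)%:R * (B a' == z)%:R)).
  rewrite exchange_big; apply: eq_bigr => B _; rewrite -big_distrr /=.
  congr (_ * _); rewrite (bigD1 (B a')) //= eqxx mulr1 big1 ?addr0 //.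
  by move=> z /negPf; rewrite eq_sym => ->; rewrite mulr0.
under eq_bigr => z _.
  rewrite (rfun_weight_eval2 (fun _ => unif_sum1 Z0)
    (fun y => (y == z)%:R) (fun y => (y == z)%:R) aa') !unif_eq_sum.
  over.
by rewrite -mulr_suml unif_sum1 // mul1r.
Qed.

Lemma unif_pair_fst (K M : finType) (g : K -> R) : (0 < #|M|)%N ->
  \sum_(b : K * M) unif (K * M)%type * g b.1 = unif K * \sum_f g f.
Proof.
move=> M0; rewrite -(pair_bigA _ (fun f _ => unif _ * g f)) /= mulr_sumr.
apply: eq_bigr => f _; rewrite sumr_const -[LHS]mulr_natr /unif card_prod natrM.
by rewrite invfM mulrAC divfK // pnatr_eq0 -lt0n.
Qed.

(** A substitute for Cauchy-Schwarz that needs no square root; the free scale [a] will carry the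
    parameter [theta] of the hash loss. *)
Lemma ler_norm_amgm (z a : R) : 0 < a -> `|z| <= (a + z ^+ 2 / a) / 2.
Proof.
move=> a0; have : 0 <= (`|z| - a) ^+ 2 / a by rewrite divr_ge0 ?sqr_ge0 // ltW.
have -> : (`|z| - a) ^+ 2 / a = z ^+ 2 / a - 2 * `|z| + a.
  by rewrite -[z ^+ 2]real_normK ?num_real //; field; rewrite gt_eqF.
lra.
Qed.

(** Atoms heavier than [tau] are given up, at twice their mass. For the others the deviation of a
    bin is centred, with variance at most [tau * unif K * (1 - unif K)], because the squares of the
    light masses sum to at most [tau]. The factor [#|K| - 1], finer than [#|K|], makes the variance
    term vanish for a single bin. The second component of a bin is averaged out. *)
Lemma leftover_hash (A K M : finType) (k : A -> R) (tau theta : R) :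
  (forall a, 0 <= k a) -> \sum_a k a = 1 -> (0 < #|K|)%N -> (0 < #|M|)%N ->
  0 <= tau -> 0 < theta ->
  \sum_(B : {ffun A -> K * M}) hash_weight B *
     \sum_f `|\sum_a k a * ((B a).1 == f)%:R - unif K|
  <= 2 * (\sum_(a | tau < k a) k a)
     + (theta + (#|K|%:R - 1) * tau / theta) / 2.
Proof.
move=> k0 k1 K0 M0 tau0 theta0.
have KM0 : (0 < #|{: K * M}|)%N by rewrite card_prod muln_gt0 K0.
have uK : unif K * #|K|%:R = 1 by rewrite mulVf // pnatr_eq0 -lt0n.
have uK0 : 0 < unif K by rewrite invr_gt0 ltr0n.
pose y f (b : K * M) : R := (b.1 == f)%:R - unif K.
pose S a := k a <= tau.
pose z f (B : {ffun A -> K * M}) := \sum_(a | S a) k a * y f (B a).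
have split_f f (B : {ffun A -> K * M}) : \sum_a k a * ((B a).1 == f)%:R - unif K
    = z f B + \sum_(a | ~~ S a) k a * y f (B a).
  have {1}-> : unif K = \sum_a k a * unif K by rewrite -mulr_suml k1 mul1r.
  rewrite -sumrB; rewrite (bigID S) /= /z; congr (_ + _);
    by apply: eq_bigr => a _; rewrite /y mulrBr.
have sum_y b : \sum_f `|y f b| <= 2.
  have -> : 2 = \sum_f ((b.1 == f)%:R + unif K).
    rewrite big_split /= unif_sum1 // (bigD1 b.1) //= eqxx big1 ?addr0 //.
    by move=> f /negPf; rewrite eq_sym => ->.
  apply: ler_sum => f _; apply: le_trans (ler_normB _ _) _.
  by rewrite ger0_norm ?ler0n // ger0_norm // ltW.
have tail (B : {ffun A -> K * M}) : \sum_f `|\sum_(a | ~~ S a) k a * y f (B a)|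
    <= 2 * \sum_(a | tau < k a) k a.
  apply: (@le_trans _ _ (\sum_f \sum_(a | ~~ S a) k a * `|y f (B a)|)).
    apply: ler_sum => f _; apply: le_trans (ler_norm_sum _ _ _) _.
    by apply: ler_sum => a _; rewrite normrM ger0_norm.
  rewrite exchange_big mulr_sumr /S.
  under eq_bigl => a do rewrite -ltNge.
  apply: ler_sum => a _; rewrite -mulr_sumr mulrC.
  by apply: ler_wpM2r.
have sum_y2 f : \sum_b unif (K * M)%type * y f b ^+ 2 = unif K * (1 - unif K).
  rewrite (@unif_pair_fst K M (fun x => ((x == f)%:R - unif K) ^+ 2)) //.
  congr (_ * _); rewrite (bigD1 f) //= eqxx.
  under eq_bigr => x /negPf-> do rewrite sub0r sqrrN.
  have := @sumr_const R K (pred_of_simpl predT) (unif K ^+ 2).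
  rewrite -[RHS]mulr_natr -[#|_|]/#|K| expr2 -mulrA uK mulr1 (bigD1 f) //= => h.
  have -> : \sum_(i | i != f) unif K ^+ 2 = unif K - unif K ^+ 2.
    by rewrite -[X in X - _]h expr2 addrAC subrr add0r.
  by rewrite /=; ring.
have Ez2 f : \sum_B hash_weight B * z f B ^+ 2 <= tau * (unif K * (1 - unif K)).
  pose Z a b := (if S a then k a else 0) * y f b.
  have -> : \sum_B hash_weight B * z f B ^+ 2
      = \sum_a \sum_b unif (K * M)%type * Z a b ^+ 2.
    rewrite -(@rfun_weight_variance _ _ _ (fun _ _ => unif (K * M)%type)).
    - apply: eq_bigr => B _; congr (_ * _ ^+ 2); rewrite /z /Z big_mkcond /=.
      by apply: eq_bigr => a _; case: ifP => // _; rewrite mul0r.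
    - by move=> _; exact: unif_sum1.
    move=> a; rewrite /Z.
    under eq_bigr => b _ do rewrite mulrCA.
    rewrite -mulr_sumr.
    rewrite (@unif_pair_fst K M (fun x => (x == f)%:R - unif K)) // sumrB.
    rewrite unif_sum1 // (bigD1 f) //= eqxx big1 ?addr0 ?subrr ?mulr0 //.
    by move=> x /negPf->.
  apply: (@le_trans _ _ (\sum_a k a * tau * (unif K * (1 - unif K)))); last first.
    by rewrite -!mulr_suml k1 mul1r.
  apply: ler_sum => a _; rewrite /Z.
  under eq_bigr => b _ do rewrite exprMn mulrCA.
  rewrite -mulr_sumr sum_y2; apply: ler_wpM2r.
    rewrite mulr_ge0 ?subr_ge0 ?unif_ge0 // /unif invf_le1 ?ltr0n //.
    by rewrite ler1n.
  rewrite expr2; case: ifP => [Sa|_]; first exact: ler_wpM2l.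
  by rewrite mul0r mulr_ge0.
(* With the scale [theta * unif K] the linear terms sum to [theta] over the bins. *)
apply: (@le_trans _ _ (\sum_B hash_weight B * \sum_f
    ((theta * unif K + z f B ^+ 2 / (theta * unif K)) / 2
      + `|\sum_(a | ~~ S a) k a * y f (B a)|))).
  apply: ler_sum => B _; apply: ler_wpM2l; first exact: hash_weight_ge0.
  apply: ler_sum => f _; rewrite split_f; apply: le_trans (ler_normD _ _) _.
  by apply: lerD => //; apply: ler_norm_amgm; rewrite mulr_gt0.
rewrite addrC.
under eq_bigr => B _ do rewrite big_split mulrDr /=.
rewrite big_split /=; apply: lerD; last first.
  apply: average_le => //; first exact: hash_weight_ge0.
  exact: hash_weight_sum1.
have sum_f (B : {ffun A -> K * M}) :
    \sum_f (theta * unif K + z f B ^+ 2 / (theta * unif K)) / 2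
    = theta / 2 + (\sum_f z f B ^+ 2 / (theta * unif K)) / 2.
  rewrite -mulr_suml big_split /= mulrDl; congr (_ / _ + _).
  by rewrite sumr_const -[LHS]mulr_natr -mulrA uK mulr1.
under eq_bigr => B _ do rewrite sum_f mulrDr mulrA [X in _ + X]mulrA.
rewrite big_split /= -!mulr_suml hash_weight_sum1 // mul1r mulrDl.
apply: lerD => //; apply: ler_wpM2r; first by lra.
under eq_bigr => B _ do rewrite mulr_sumr.
rewrite exchange_big /=.
apply: (@le_trans _ _ (\sum_(f : K) tau * (unif K * (1 - unif K)) / (theta * unif K))).
  apply: ler_sum => f _; under eq_bigr => B _ do rewrite mulrA.
  rewrite -mulr_suml; apply: ler_wpM2r => //.
  by rewrite invr_ge0 mulr_ge0 // ltW.
rewrite sumr_const -[leLHS]mulr_natr le_eqVlt; apply/orP; left; apply/eqP.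
have -> : unif K = #|K|%:R^-1 by [].
by field; rewrite gt_eqF //= pnatr_eq0 -lt0n.
Qed.

End Hashing.

(** * Averages against finite weights *)

Section Average.
Variable R : realFieldType.
Implicit Types I J : finType.

(** The weights need not sum to one: the cardinality argument averages over the restriction of a law
    to [T = t]. *)
Definition avg I (w F : I -> R) : R := \sum_i w i * F i.

Definition pmf I (w : I -> R) : Prop := (forall i, 0 <= w i) /\ \sum_i w i = 1.

Lemma eq_avg I (w F G : I -> R) : F =1 G -> avg w F = avg w G.
Proof. by move=> FG; apply: eq_bigr => i _; rewrite FG. Qed.

Lemma ler_avg I (w F G : I -> R) : (forall i, 0 <= w i) ->
  (forall i, F i <= G i) -> avg w F <= avg w G.
Proof. by move=> w0 FG; apply: ler_sum => i _; apply: ler_wpM2l. Qed.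

Lemma avgD I (w F G : I -> R) : avg w (fun i => F i + G i) = avg w F + avg w G.
Proof. by rewrite -big_split; apply: eq_bigr => i _; rewrite mulrDr. Qed.

Lemma avgZ I (w F : I -> R) c : avg w (fun i => c * F i) = c * avg w F.
Proof. by rewrite mulr_sumr; apply: eq_bigr => i _; rewrite mulrCA. Qed.

Lemma avg_cst I (w : I -> R) c : pmf w -> avg w (fun _ => c) = c.
Proof. by case=> _ w1; rewrite /avg -mulr_suml w1 mul1r. Qed.

Lemma avg_ge0 I (w F : I -> R) : (forall i, 0 <= w i) -> (forall i, 0 <= F i) ->
  0 <= avg w F.
Proof. by move=> w0 F0; apply: sumr_ge0 => i _; apply: mulr_ge0. Qed.

Lemma avg_le_cst I (w F : I -> R) c : pmf w -> (forall i, F i <= c) ->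
  avg w F <= c.
Proof. by case=> w0 w1; apply: average_le. Qed.

Lemma avg_in01 I (w F : I -> R) : pmf w -> (forall i, 0 <= F i <= 1) ->
  0 <= avg w F <= 1.
Proof.
move=> wp F01; rewrite avg_ge0 ?avg_le_cst //; try by move=> i; case/andP: (F01 i).
by case: wp.
Qed.

Lemma avg_exch I J (w : I -> R) (w' : J -> R) (F : I -> J -> R) :
  avg w (fun i => avg w' (F i)) = avg w' (fun j => avg w (F^~ j)).
Proof.
rewrite /avg; under eq_bigr do rewrite mulr_sumr.
rewrite exchange_big; apply: eq_bigr => j _; rewrite mulr_sumr.
by apply: eq_bigr => i _; rewrite mulrCA.
Qed.

(** A sum equal to one is not empty. The laws themselves thus provide the default symbols of the
    decoders and the base points of the marginals. *)
Lemma pmf_inh I (w : I -> R) : pmf w -> I.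
Proof.
move=> [_ w1]; have [i _|I0] := pickP (fun _ : I => true); first exact: i.
move: w1; rewrite big1 => [/eqP|i]; first by rewrite eq_sym oner_eq0.
by have := I0 i.
Qed.

Lemma pmf_hash (A Z : finType) : (0 < #|Z|)%N ->
  pmf (@hash_weight R A Z).
Proof. by move=> Z0; split; [exact: hash_weight_ge0|exact: hash_weight_sum1]. Qed.

(** Union bound for a decoder that picks any candidate: since the true [a] passes the test, an error
    requires another candidate that passes it too. *)
Lemma pick_error (A : finType) (P : pred A) (a0 a : A) : P a ->
  (odflt a0 [pick x | P x] != a)%:R <= \sum_(x | x != a) (P x)%:R :> R.
Proof.
move=> Pa; case: pickP => [x Px|/(_ a)]; last by rewrite Pa.
rewrite /=; case: eqP => [_|/eqP xa]; first by apply: sumr_ge0 => i _; rewrite ler0n.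
rewrite (bigD1 x) //= Px lerDl.
by apply: sumr_ge0 => i _; rewrite ler0n.
Qed.

End Average.

(** * Sampling conditionally on a shared bin index *)

Section Sampler.
Variables (R : realFieldType) (A K C : finType).
Variables (k : C -> A -> R) (b : C -> A -> K).
Hypotheses (kp : forall c, pmf (k c)) (K0 : (0 < #|K|)%N).

Definition binp c f : R := avg (k c) (fun a => (b c a == f)%:R).

(** A bin of mass zero receives the unconditional law, so that every index has a probability
    kernel. *)
Definition cond_kernel f c a : R :=
  if binp c f == 0 then k c a else k c a * (b c a == f)%:R / binp c f.

Lemma cond_kernel_pmf f c : pmf (cond_kernel f c).
Proof.
have [k0 k1] := kp c.
have bin0 : 0 <= binp c f by apply: avg_ge0 => // a; rewrite ler0n.
rewrite /cond_kernel; case: eqP => [_|/eqP bn0]; first by split.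
split=> [a|]; first by rewrite divr_ge0 // mulr_ge0.
by rewrite -mulr_suml mulfV.
Qed.

(** Common randomness: the index [d.1] is known to all terminals, and [d.2] tabulates one sample for
    every observation [c]. Fixing [d] therefore turns the encoder into a deterministic function of
    its observation. *)
Definition sampler_weight : K * {ffun C -> A} -> R :=
  fun d => unif R K * rfun_weight (cond_kernel d.1) d.2.

Lemma sampler_pmf : pmf sampler_weight.
Proof.
split=> [d|]; first rewrite mulr_ge0 ?unif_ge0 ?rfun_weight_ge0 //.
  by move=> c; case: (cond_kernel_pmf d.1 c).
rewrite -(pair_bigA _ (fun f phi => unif R K * rfun_weight (cond_kernel f) phi)) /=.
rewrite -[RHS](unif_sum1 R K0); apply: eq_bigr => f _.
rewrite -mulr_sumr rfun_weight_sum1 ?mulr1 // => c.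
by case: (cond_kernel_pmf f c).
Qed.

Definition bin_bias c : R := \sum_f `|binp c f - unif R K|.

(* Drawing the bin index uniformly and then the symbol conditionally on it costs
   at most the distance of the true bin index from uniform. *)
Lemma sampler_le c (h : K -> A -> R) : (forall f a, 0 <= h f a <= 1) ->
  avg sampler_weight (fun d => h d.1 (d.2 c)) <=
  avg (k c) (fun a => h (b c a) a) + bin_bias c.
Proof.
move=> h01; have [k0 k1] := kp c.
pose H f := avg (cond_kernel f c) (h f).
have H01 f : 0 <= H f <= 1 by apply: avg_in01 => //; exact: cond_kernel_pmf.
have -> : avg sampler_weight (fun d => h d.1 (d.2 c)) = \sum_f unif R K * H f.
  rewrite /avg -(pair_bigA _ (fun f (phi : {ffun C -> A}) =>
    unif R K * rfun_weight (cond_kernel f) phi * h f (phi c))) /=.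
  apply: eq_bigr => f _; rewrite /H /avg -(rfun_weight_eval _ c (h f)).
    by rewrite mulr_sumr; apply: eq_bigr => phi _; rewrite mulrA.
  by move=> c'; case: (cond_kernel_pmf f c').
have bin_ge0 f : 0 <= binp c f by apply: avg_ge0 => // a; rewrite ler0n.
(* A bin of mass zero contributes zero to both sides, so the default law of [cond_kernel] is
   harmless. *)
have PH f : binp c f * H f = \sum_a k c a * (b c a == f)%:R * h f a.
  rewrite /H /avg /cond_kernel; case: eqP => [p0|/eqP pn0]; last first.
    rewrite mulr_sumr; apply: eq_bigr => a _; rewrite mulrA; congr (_ * _).
    by rewrite mulrC divfK.
  rewrite p0 mul0r; apply/esym/big1 => a _.
  have /eqP := p0; rewrite psumr_eq0 => [/allP/(_ a)|a' _].
    by rewrite mem_index_enum => /(_ isT)/eqP->; rewrite mul0r.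
  by rewrite mulr_ge0 ?ler0n.
have -> : avg (k c) (fun a => h (b c a) a) = \sum_f binp c f * H f.
  under eq_bigr do rewrite PH.
  rewrite exchange_big; apply: eq_bigr => a _ /=.
  rewrite (bigD1 (b c a)) //= eqxx mulr1 big1 ?addr0 // => f /negPf.
  by rewrite eq_sym => ->; rewrite mulr0 mul0r.
rewrite -big_split; apply: ler_sum => f _ /=.
have /andP[H0 H1] := H01 f.
have := ler_norm (unif R K - binp c f); rewrite distrC => h1.
have h2 : (unif R K - binp c f) * H f <= `|binp c f - unif R K|.
  apply: (@le_trans _ _ (`|binp c f - unif R K| * H f)); first exact: ler_wpM2r.
  by rewrite ler_piMr.
by rewrite mulrBl in h2; rewrite -lerBlDl.
Qed.

End Sampler.

(** * One-shot coding *)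

Lemma avgDc (R : realFieldType) (I : finType) (w F : I -> R) c : pmf w ->
  avg w (fun i => F i + c) = avg w F + c.
Proof. by move=> wp; rewrite avgD avg_cst. Qed.

Lemma sum_pairE (R : nmodType) (A B : finType) (F : A * B -> R) :
  \sum_z F z = \sum_a \sum_b F (a, b).
Proof. by rewrite pair_bigA; apply: eq_bigr => -[]. Qed.

Lemma sum_ind_eq (R : nzRingType) (A : finType) (F : A -> R) (a : A) :
  \sum_x (x == a)%:R * F x = F a.
Proof.
rewrite (bigD1 a) //= eqxx mul1r big1 ?addr0 // => x /negPf->.
by rewrite mul0r.
Qed.

Lemma ind_or3 (R : realFieldType) (a b c : bool) :
  [|| a, b | c]%:R <= a%:R + b%:R + c%:R :> R.
Proof. by case: a; case: b; case: c; rewrite /=; lra. Qed.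

Lemma avg_ge_cst (R : realFieldType) (I : finType) (w F : I -> R) c :
  pmf w -> (forall i, c <= F i) -> c <= avg w F.
Proof.
move=> wp cF; rewrite -(avg_cst c wp); apply: ler_avg => //.
by case: wp.
Qed.

Lemma avgZr (R : realFieldType) (I : finType) (w F : I -> R) c :
  avg w (fun i => F i * c) = avg w F * c.
Proof. by rewrite [RHS]mulrC -avgZ; apply: eq_avg => i; rewrite mulrC. Qed.

Lemma avg_exists (R : realFieldType) (I : finType) (w F : I -> R) c :
  pmf w -> avg w F <= c -> exists i, F i <= c.
Proof. by case; apply: exists_le_average. Qed.

Lemma hash_collE (R : realFieldType) (A Z : finType) (a a' : A) : (0 < #|Z|)%N ->
  avg (@hash_weight R A Z) (fun B => (B a == B a')%:R) =
  if a == a' then 1 else unif R Z.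
Proof.
move=> Z0; case: eqP => [<-|/eqP aa']; last exact: hash_collision.
by under eq_avg do rewrite eqxx; rewrite avg_cst //; exact: pmf_hash.
Qed.

Definition hash_loss (R : realFieldType) (K : finType) (tau theta : R) : R :=
  (theta + (#|K|%:R - 1) * tau / theta) / 2.

Lemma bias_hash (R : realFieldType) (A K M : finType) (k : A -> R) (tau theta : R) :
  pmf k -> (0 < #|K|)%N -> (0 < #|M|)%N -> 0 <= tau -> 0 < theta ->
  avg (@hash_weight R A (K * M)%type)
    (fun B => \sum_f `|avg k (fun a => ((B a).1 == f)%:R) - unif R K|)
  <= 2 * avg k (fun a => (tau < k a)%R%:R) + hash_loss K tau theta.
Proof.
move=> [k0 k1] K0 M0 tau0 theta0.
apply: le_trans (leftover_hash k0 k1 K0 M0 tau0 theta0) _.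
rewrite lerD2r ler_pM2l ?ltr0n // /avg big_mkcond /=; apply: ler_sum => a _.
by case: ifP; rewrite ?mulr1 ?mulr0.
Qed.

(** This is [bias_hash] for the point mass at [c] times [k]. It is needed because u, v and w are
    hashed as pairs with t, while t is fixed when they are drawn. *)
Lemma bias_hash_tag (R : realFieldType) (D A K M : finType) (c : D) (k : A -> R)
    (tau theta : R) :
  pmf k -> (0 < #|K|)%N -> (0 < #|M|)%N -> 0 <= tau -> 0 < theta ->
  avg (@hash_weight R (D * A)%type (K * M)%type)
    (fun B => \sum_f `|avg k (fun a => ((B (c, a)).1 == f)%:R) - unif R K|)
  <= 2 * avg k (fun a => (tau < k a)%R%:R) + hash_loss K tau theta.
Proof.
move=> [k0 k1] K0 M0 tau0 theta0.
pose k' (z : D * A) := (z.1 == c)%:R * k z.2.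
have k'E G : avg k' G = avg k (fun a => G (c, a)).
  rewrite /avg; transitivity (\sum_d \sum_a k' (d, a) * G (d, a)).
    by rewrite pair_bigA; apply: eq_bigr => -[].
  rewrite (bigD1 c) //= [X in _ + X]big1 ?addr0 => [|d /negPf dc].
    by apply: eq_bigr => a _; rewrite /k' /= eqxx mul1r.
  by apply: big1 => a _; rewrite /k' /= dc !mul0r.
have kp' : pmf k'.
  split=> [z|]; first by rewrite mulr_ge0 ?ler0n.
  transitivity (avg k' (fun _ => 1)); first by apply: eq_bigr => z _; rewrite mulr1.
  by rewrite k'E avg_cst.
under eq_avg => B do under eq_bigr => f _ do
  rewrite -(k'E (fun z => ((B z).1 == f)%:R)).
apply: le_trans (bias_hash kp' K0 M0 tau0 theta0) _.
rewrite lerD2r ler_pM2l ?ltr0n // k'E; apply: ler_avg => // a.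
by rewrite /k' /= eqxx mul1r.
Qed.

Section OneShot.
Variable R : realFieldType.
Variables X Y T U V W KT KU KV KW M0 MX MY : finType.
Variables (p : X * Y -> R) (kT : X -> T -> R) (kU : X * T -> U -> R).
Variables (kV : X * T -> V -> R) (kW : T * U * Y -> W -> R).
Hypotheses (pp : pmf p) (kTp : forall c, pmf (kT c)) (kUp : forall c, pmf (kU c)).
Hypotheses (kVp : forall c, pmf (kV c)) (kWp : forall c, pmf (kW c)).
Hypotheses (KT0 : (0 < #|KT|)%N) (KU0 : (0 < #|KU|)%N).
Hypotheses (KV0 : (0 < #|KV|)%N) (KW0 : (0 < #|KW|)%N).
Hypotheses (M00 : (0 < #|M0|)%N) (MX0 : (0 < #|MX|)%N) (MY0 : (0 < #|MY|)%N).

Implicit Type F : X -> Y -> T -> U -> V -> W -> R.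

(** The ideal law, without bins, with which the code is compared. The context of [kW] contains t
    because the bins of w are tagged by t, so that a sampler for w must see it. *)
Definition expA F : R :=
  avg p (fun z => avg (kT z.1) (fun t => avg (kU (z.1, t)) (fun u =>
  avg (kV (z.1, t)) (fun v => avg (kW (t, u, z.2)) (fun w => F z.1 z.2 t u v w))))).

Lemma expA_le F G : (forall x y t u v w, F x y t u v w <= G x y t u v w) ->
  expA F <= expA G.
Proof.
move=> FG; apply: ler_avg => [|z]; first by case: pp.
apply: ler_avg => [|t]; first by case: (kTp z.1).
apply: ler_avg => [|u]; first by case: (kUp (z.1, t)).
apply: ler_avg => [|v]; first by case: (kVp (z.1, t)).
by apply: ler_avg => [|w]; first by case: (kWp (t, u, z.2)).
Qed.

Lemma expAD F G : expA (fun x y t u v w => F x y t u v w + G x y t u v w) =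
  expA F + expA G.
Proof.
rewrite -avgD; apply: eq_avg => z; rewrite -avgD; apply: eq_avg => t.
rewrite -avgD; apply: eq_avg => u; rewrite -avgD; apply: eq_avg => v.
by rewrite -avgD.
Qed.

Lemma expAZ F c : expA (fun x y t u v w => c * F x y t u v w) = c * expA F.
Proof.
rewrite -avgZ; apply: eq_avg => z; rewrite -avgZ; apply: eq_avg => t.
rewrite -avgZ; apply: eq_avg => u; rewrite -avgZ; apply: eq_avg => v.
by rewrite -avgZ.
Qed.

Lemma expA_cst c : expA (fun _ _ _ _ _ _ => c) = c.
Proof.
rewrite -[RHS](avg_cst c pp); apply: eq_avg => z.
rewrite -[RHS](avg_cst c (kTp z.1)); apply: eq_avg => t.
rewrite -[RHS](avg_cst c (kUp (z.1, t))); apply: eq_avg => u.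
rewrite -[RHS](avg_cst c (kVp (z.1, t))); apply: eq_avg => v.
by rewrite avg_cst.
Qed.

Lemma expA_exch (I : finType) (w : I -> R) (F : I -> X -> Y -> T -> U -> V -> W -> R) :
  avg w (fun i => expA (F i)) =
  expA (fun x y t u v w' => avg w (fun i => F i x y t u v w')).
Proof.
rewrite avg_exch; apply: eq_avg => z; rewrite avg_exch; apply: eq_avg => t.
rewrite avg_exch; apply: eq_avg => u; rewrite avg_exch; apply: eq_avg => v.
exact: avg_exch.
Qed.

Section FixedHash.
Variables (BT : {ffun T -> KT * unit}) (BU : {ffun T * U -> KU * M0}).
Variables (BV : {ffun T * V -> KV * MX}) (BW : {ffun T * W -> KW * MY}).
Variables (typY : Y -> T * U -> bool) (typD : T * V * W -> bool).
Variables (good : X -> Y -> T * V * W -> bool) (d0 : T * U) (d1 : T * V * W).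

Definition decY y m fT fU := odflt d0 [pick a : T * U |
  [&& typY y a, BT a.1 == (fT, tt) & BU a == (fU, m)]].

Definition decD fT fV fW mX mY := odflt d1 [pick a : T * V * W |
  [&& typD a, BT a.1.1 == (fT, tt), BV a.1 == (fV, mX)
    & BW (a.1.1, a.2) == (fW, mY)]].

Definition binT (x : X) t := (BT t).1.
Definition binU (c : X * T) u := (BU (c.2, u)).1.
Definition binV (c : X * T) v := (BV (c.2, v)).1.
Definition binW (c : T * U * Y) w := (BW (c.1.1, w)).1.

Definition bad_event x y t u v w fT fU fV fW :=
  [|| decY y (BU (t, u)).2 fT fU != (t, u),
      decD fT fV fW (BV (t, v)).2 (BW (t, w)).2 != (t, v, w)
    | ~~ good x y (t, v, w)].

(** The samplers are peeled off in the order t, u, v, w. Each is queried at a single context,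
    determined by the symbols drawn before it, so [sampler_le] trades it for a draw from its kernel
    at the price of one bin bias. An outcome of each sampler that does no worse than the average
    gives the deterministic code. *)
Lemma one_shot_fixed_hash :
  exists (phi0 : X -> M0) (phiX : X -> MX) (phiY : Y -> M0 -> MY)
         (psi : MX -> MY -> T * V * W),
  avg p (fun z => (~~ good z.1 z.2 (psi (phiX z.1) (phiY z.2 (phi0 z.1))))%:R) <=
  expA (fun x y t u v w =>
    (bad_event x y t u v w (binT x t) (binU (x, t) u) (binV (x, t) v)
       (binW (t, u, y) w))%:R
    + bin_bias kW binW (t, u, y) + bin_bias kV binV (x, t)
    + bin_bias kU binU (x, t) + bin_bias kT binT x).
Proof.
pose wT := sampler_weight kT binT; pose wU := sampler_weight kU binU.
pose wV := sampler_weight kV binV; pose wW := sampler_weight kW binW.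
have wTp : pmf wT by apply: sampler_pmf.
have wUp : pmf wU by apply: sampler_pmf.
have wVp : pmf wV by apply: sampler_pmf.
have wWp : pmf wW by apply: sampler_pmf.
have ind01 (b : bool) : 0 <= (b%:R : R) <= 1 by case: b; rewrite /= ?lexx ?ler01.
pose c0 (dT : KT * {ffun X -> T}) (dU : KU * {ffun X * T -> U}) x :=
  (BU (dT.2 x, dU.2 (x, dT.2 x))).2.
pose cX (dT : KT * {ffun X -> T}) (dV : KV * {ffun X * T -> V}) x :=
  (BV (dT.2 x, dV.2 (x, dT.2 x))).2.
pose cY (dT : KT * {ffun X -> T}) (dU : KU * {ffun X * T -> U})
    (dW : KW * {ffun T * U * Y -> W}) y m :=
  let a := decY y m dT.1 dU.1 in (BW (a.1, dW.2 (a, y))).2.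
pose err dT dU dV dW z : R :=
  (~~ good z.1 z.2 (decD dT.1 dV.1 dW.1 (cX dT dV z.1)
                      (cY dT dU dW z.2 (c0 dT dU z.1))))%:R.
suff : avg wT (fun dT => avg wU (fun dU => avg wV (fun dV => avg wW (fun dW =>
    avg p (err dT dU dV dW))))) <=
  expA (fun x y t u v w =>
    (bad_event x y t u v w (binT x t) (binU (x, t) u) (binV (x, t) v)
       (binW (t, u, y) w))%:R
    + bin_bias kW binW (t, u, y) + bin_bias kV binV (x, t)
    + bin_bias kU binU (x, t) + bin_bias kT binT x).
  move=> /(avg_exists wTp)[dT] /(avg_exists wUp)[dU].
  move=> /(avg_exists wVp)[dV] /(avg_exists wWp)[dW] Herr.
  by exists (c0 dT dU), (cX dT dV), (cY dT dU dW), (decD dT.1 dV.1 dW.1).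
have -> : avg wT (fun dT => avg wU (fun dU => avg wV (fun dV => avg wW (fun dW =>
    avg p (err dT dU dV dW))))) =
  avg p (fun z => avg wT (fun dT => avg wU (fun dU => avg wV (fun dV =>
    avg wW (fun dW => err dT dU dV dW z))))).
  apply/esym; rewrite avg_exch; apply: eq_avg => dT; rewrite avg_exch.
  apply: eq_avg => dU; rewrite avg_exch; apply: eq_avg => dV.
  by rewrite avg_exch.
apply: ler_avg => [|[x y] /=]; first by case: pp.
(* Conditional error probabilities given the symbols drawn so far; they stay in [0, 1], as
   [sampler_le] requires. *)
pose hW t u v fT fU fV fW w : R := (bad_event x y t u v w fT fU fV fW)%:R.
pose hV t u fT fU fV v :=
  avg wW (fun dW => hW t u v fT fU fV dW.1 (dW.2 (t, u, y))).
pose hU t fT fU u := avg wV (fun dV => hV t u fT fU dV.1 (dV.2 (x, t))).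
pose hT fT t := avg wU (fun dU => hU t fT dU.1 (dU.2 (x, t))).
have hW01 t u v fT fU fV fW w : 0 <= hW t u v fT fU fV fW w <= 1 by exact: ind01.
have hV01 t u fT fU fV v : 0 <= hV t u fT fU fV v <= 1 by apply: avg_in01.
have hU01 t fT fU u : 0 <= hU t fT fU u <= 1 by apply: avg_in01.
have hT01 fT t : 0 <= hT fT t <= 1 by apply: avg_in01.
apply: (@le_trans _ _ (avg wT (fun dT => hT dT.1 (dT.2 x)))).
  apply: ler_avg => [|dT]; first by case: wTp.
  apply: ler_avg => [|dU]; first by case: wUp.
  apply: ler_avg => [|dV]; first by case: wVp.
  rewrite /hV; set t := dT.2 x; set u := dU.2 (x, t); set v := dV.2 (x, t).
  (* After a wrong decoding, transmitter Y queries the sampler of w at a wrong context. The bad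
     event already holds then, so the error is simply bounded by one. *)
  case: (eqVneq (decY y (c0 dT dU x) dT.1 dU.1) (t, u)) => [dec_ok|dec_ko].
    apply: ler_avg => [|dW]; first by case: wWp.
    rewrite /err /hW /bad_event /= /cY dec_ok /= eqxx /= -/t.
    rewrite /cX -/t -/v.
    set a := decD _ _ _ _ _; case: (eqVneq a (t, v, dW.2 (t, u, y))) => [->|] //=.
    by move=> _; case: (good _ _ _).
  have -> : avg wW (fun dW => hW t u v dT.1 dU.1 dV.1 dW.1 (dW.2 (t, u, y))) = 1.
    rewrite -[RHS](avg_cst 1 wWp); apply: eq_avg => dW.
    by rewrite /hW /bad_event dec_ko.
  by apply: avg_le_cst => // dW; have /andP[] := ind01 (~~ good x y
    (decD dT.1 dV.1 dW.1 (cX dT dV x) (cY dT dU dW y (c0 dT dU x)))).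
apply: le_trans (sampler_le binT kTp x hT01) _.
rewrite -!avgDc //; apply: ler_avg => [|t]; first by case: (kTp x).
apply: le_trans (lerD (sampler_le binU kUp (x, t) (hU01 t _)) (lexx _)) _.
rewrite -!avgDc //; apply: ler_avg => [|u]; first by case: (kUp (x, t)).
apply: le_trans (lerD (lerD (sampler_le binV kVp (x, t) (hV01 t u _ _))
  (lexx _)) (lexx _)) _.
rewrite -!avgDc //; apply: ler_avg => [|v]; first by case: (kVp (x, t)).
apply: le_trans (lerD (lerD (lerD (sampler_le binW kWp (t, u, y)
  (hW01 t u v _ _ _)) (lexx _)) (lexx _)) (lexx _)) _.
by rewrite -!avgDc.
Qed.

End FixedHash.

(** * Collisions of random bins at the two decoders *)

Variables (typY : Y -> T * U -> bool) (typD : T * V * W -> bool).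
Variables (good : X -> Y -> T * V * W -> bool).
Variables (s1 s2 : Y -> T * U -> R) (s3 s4 s5 s6 : T * V * W -> R).
Variables (g1 g2 g3 g4 g5 g6 : R) (tT tU tV tW hT hU hV hW : R).
Hypotheses (s10 : forall y a, 0 <= s1 y a) (s20 : forall y a, 0 <= s2 y a).
Hypotheses (s30 : forall a, 0 <= s3 a) (s40 : forall a, 0 <= s4 a).
Hypotheses (s50 : forall a, 0 <= s5 a) (s60 : forall a, 0 <= s6 a).
Hypotheses (s11 : forall y, \sum_a s1 y a <= 1).
Hypotheses (s21 : forall y t, \sum_u s2 y (t, u) <= 1).
Hypotheses (s31 : \sum_a s3 a <= 1) (s41 : forall t w, \sum_v s4 (t, v, w) <= 1).
Hypotheses (s51 : forall t v, \sum_w s5 (t, v, w) <= 1).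
Hypotheses (s61 : forall t, \sum_v \sum_w s6 (t, v, w) <= 1).
Hypotheses (g10 : 0 < g1) (g20 : 0 < g2) (g30 : 0 < g3) (g40 : 0 < g4).
Hypotheses (g50 : 0 < g5) (g60 : 0 < g6).
Hypotheses (tT0 : 0 <= tT) (tU0 : 0 <= tU) (tV0 : 0 <= tV) (tW0 : 0 <= tW).
Hypotheses (hT0 : 0 < hT) (hU0 : 0 < hU) (hV0 : 0 < hV) (hW0 : 0 < hW).
Hypothesis typYE : forall y a, typY y a -> g1 <= s1 y a /\ g2 <= s2 y a.
Hypothesis typDE : forall a, typD a ->
  [/\ g3 <= s3 a, g4 <= s4 a, g5 <= s5 a & g6 <= s6 a].

Let HT := @hash_weight R T (KT * unit)%type.
Let HU := @hash_weight R (T * U)%type (KU * M0)%type.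
Let HV := @hash_weight R (T * V)%type (KV * MX)%type.
Let HW := @hash_weight R (T * W)%type (KW * MY)%type.

Let HTp : pmf HT.
Proof. by apply: pmf_hash; rewrite card_prod card_unit muln1. Qed.
Let HUp : pmf HU.
Proof. by apply: pmf_hash; rewrite card_prod muln_gt0 KU0. Qed.
Let HVp : pmf HV.
Proof. by apply: pmf_hash; rewrite card_prod muln_gt0 KV0. Qed.
Let HWp : pmf HW.
Proof. by apply: pmf_hash; rewrite card_prod muln_gt0 KW0. Qed.

Let uT : R := unif R (KT * unit)%type.
Let uU : R := unif R (KU * M0)%type.
Let uV : R := unif R (KV * MX)%type.
Let uW : R := unif R (KW * MY)%type.

Let hfun := {ffun T -> KT * unit} -> {ffun T * U -> KU * M0} ->
  {ffun T * V -> KV * MX} -> {ffun T * W -> KW * MY} -> R.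

Let expH (f : hfun) :=  avg HT (fun BT => avg HU (fun BU => avg HV (fun BV =>
  avg HW (fun BW => f BT BU BV BW)))).

Let expH_le (f g : hfun) :
  (forall BT BU BV BW, f BT BU BV BW <= g BT BU BV BW) -> expH f <= expH g.
Proof.
move=> fg; apply: ler_avg => [|?]; first by case: HTp.
apply: ler_avg => [|?]; first by case: HUp.
apply: ler_avg => [|?]; first by case: HVp.
by apply: ler_avg => [|?]; first by case: HWp.
Qed.

Let expHD (f g : hfun) :
  expH (fun BT BU BV BW => f BT BU BV BW + g BT BU BV BW) = expH f + expH g.
Proof.
rewrite -avgD; apply: eq_avg => ?; rewrite -avgD; apply: eq_avg => ?.
by rewrite -avgD; apply: eq_avg => ?; rewrite -avgD.
Qed.

Let expH_cst c : expH (fun _ _ _ _ => c) = c.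
Proof.
rewrite -[RHS](avg_cst c HTp); apply: eq_avg => ?.
rewrite -[RHS](avg_cst c HUp); apply: eq_avg => ?.
rewrite -[RHS](avg_cst c HVp); apply: eq_avg => ?.
by rewrite avg_cst.
Qed.

Let expH_exch (I : finType) (w : I -> R) (f : I -> hfun) :
  expH (fun BT BU BV BW => avg w (fun i => f i BT BU BV BW)) =
  avg w (fun i => expH (f i)).
Proof.
apply/esym; rewrite avg_exch; apply: eq_avg => ?; rewrite avg_exch.
apply: eq_avg => ?; rewrite avg_exch; apply: eq_avg => ?.
by rewrite avg_exch.
Qed.

Let expH_prod (a : {ffun T -> KT * unit} -> R)
    (b : {ffun T * U -> KU * M0} -> R) (c : {ffun T * V -> KV * MX} -> R)
    (d : {ffun T * W -> KW * MY} -> R) :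
  expH (fun BT BU BV BW => a BT * (b BU * (c BV * d BW))) =
  avg HT a * (avg HU b * (avg HV c * avg HW d)).
Proof.
transitivity (avg HT (fun BT => a BT * (avg HU b * (avg HV c * avg HW d)))).
  apply: eq_avg => BT.
  transitivity (avg HU (fun BU => a BT * (b BU * (avg HV c * avg HW d)))).
    apply: eq_avg => BU.
    transitivity (avg HV (fun BV => a BT * (b BU * (c BV * avg HW d)))).
      by apply: eq_avg => BV; rewrite !avgZ.
    by rewrite !avgZ avgZr.
  by rewrite avgZ avgZr.
by rewrite avgZr.
Qed.

(** A candidate passing [typY] satisfies [1 <= s1 / g1] and [1 <= s2 / g2], and the scores sum to at
    most one, so the thresholds bound the number of candidates. With a wrong t both hashes must
    collide, as [BU] sees the whole pair; with the right t only [BU] must. *)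
Lemma decY_error y t u d0 :
  expH (fun BT BU _ _ =>
    (decY BT BU typY d0 y (BU (t, u)).2 (BT t).1 (BU (t, u)).1 != (t, u))%:R)
  <= (~~ typY y (t, u))%:R + (uT * uU / g1 + uU / g2).
Proof.
pose w (a : T * U) : R := ((a != (t, u)) && typY y a)%:R.
pose col (BT : {ffun T -> KT * unit}) (BU : {ffun T * U -> KU * M0})
    (a : T * U) : R := (BT a.1 == BT t)%:R *
  (BU a == BU (t, u))%:R.
apply: (@le_trans _ _ (expH (fun BT BU _ _ =>
    (~~ typY y (t, u))%:R + avg w (col BT BU)))).
  apply: expH_le => BT BU _ _; case: (boolP (typY y (t, u))) => [ty|_]; last first.
    apply: ler_wpDr; last by rewrite lern1 leq_b1.
    by apply: avg_ge0 => a; rewrite ?mulr_ge0 ?ler0n.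
  rewrite add0r /decY; apply: le_trans (pick_error _ _ _) _.
    by rewrite ty /= -!surjective_pairing eqxx andbT; case: (BT t) => f [].
  rewrite /avg big_mkcond /=; apply: ler_sum => a _; rewrite /w /col.
  case: eqP => //= _; last first.
    rewrite -surjective_pairing; have -> : ((BT t).1, tt) = BT t by case: (BT t) => f [].
    by rewrite -!natrM !mulnb.
  by rewrite mul0r.
rewrite expHD expH_cst lerD2l
  (expH_exch w (fun a BT BU _ _ => col BT BU a)).
apply: (@le_trans _ _ (avg w (fun a =>
    (if a.1 == t then 1 else uT) * (if a == (t, u) then 1 else uU)))).
  apply: ler_avg => [a|a]; first by rewrite ler0n.
  have -> : expH (fun BT BU _ _ => col BT BU a) =
      expH (fun BT BU BV BW => (BT a.1 == BT t)%:R * ((BU a == BU (t, u))%:R * (1 * 1))).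
    apply: eq_avg => BT; apply: eq_avg => BU; apply: eq_avg => BV; apply: eq_avg => BW.
    by rewrite /col !mulr1.
  rewrite expH_prod !hash_collE ?card_prod ?card_unit ?muln1 ?muln_gt0 ?KT0 ?KU0 //.
  by rewrite !avg_cst // !mulr1.
have uT0 : 0 <= uT by exact: unif_ge0.
have uU0 : 0 <= uU by exact: unif_ge0.
apply: (@le_trans _ _ (\sum_a (s1 y a * (uT * uU / g1)
    + (a.1 == t)%:R * s2 y a * (uU / g2)))).
  apply: ler_sum => a _; rewrite /w.
  have r1 : 0 <= s1 y a * (uT * uU / g1).
    by rewrite !mulr_ge0 // invr_ge0 ltW.
  have r2 : 0 <= (a.1 == t)%:R * s2 y a * (uU / g2).
    by rewrite !mulr_ge0 ?ler0n // invr_ge0 ltW.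
  case: eqP => [_|/eqP atu]; first by rewrite mul0r addr_ge0.
  case: (boolP (typY y a)) => [/typYE[l1 l2]|_]; last by rewrite mul0r addr_ge0.
  have {}l1 : 1 <= s1 y a / g1 by rewrite ler_pdivlMr // mul1r.
  have {}l2 : 1 <= s2 y a / g2 by rewrite ler_pdivlMr // mul1r.
  rewrite mul1r; case: eqP r1 r2 => [_|_] r1 r2.
    by rewrite !mul1r; apply: ler_wpDl => //; rewrite mulrCA; apply: ler_peMr.
  rewrite !mul0r addr0 mulrCA; apply: ler_peMr => //; exact: mulr_ge0.
rewrite big_split /= -!mulr_suml; apply: lerD.
  by apply: ler_piMl => //; rewrite !mulr_ge0 // invr_ge0 ltW.
apply: ler_piMl; first by rewrite mulr_ge0 // invr_ge0 ltW.
apply: le_trans (s21 y t).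
rewrite sum_pairE /=.
rewrite (bigD1 t) //= eqxx [X in _ + X]big1 ?addr0.
  by under eq_bigr do rewrite mul1r.
by move=> t' /negPf->; apply: big1 => u' _; rewrite mul0r.
Qed.

(** As for [decY_error], with four patterns: a wrong t needs three collisions whatever v and w are,
    since both of their hashes are tagged by t; under the right t the wrong symbols are v alone
    ([s4]), w alone ([s5]) or both ([s6]). *)
Lemma decD_error t v w0 d1 :
  expH (fun BT _ BV BW =>
    (decD BT BV BW typD d1 (BT t).1 (BV (t, v)).1 (BW (t, w0)).1
       (BV (t, v)).2 (BW (t, w0)).2 != (t, v, w0))%:R)
  <= (~~ typD (t, v, w0))%:R
     + (uT * uV * uW / g3 + uV / g4 + uW / g5 + uV * uW / g6).
Proof.
pose w (a : T * V * W) : R := ((a != (t, v, w0)) && typD a)%:R.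
pose col (BT : {ffun T -> KT * unit}) (BV : {ffun T * V -> KV * MX})
    (BW : {ffun T * W -> KW * MY}) (a : T * V * W) : R :=
  (BT a.1.1 == BT t)%:R * (1 * ((BV a.1 == BV (t, v))%:R
    * (BW (a.1.1, a.2) == BW (t, w0))%:R)).
apply: (@le_trans _ _ (expH (fun BT _ BV BW =>
    (~~ typD (t, v, w0))%:R + avg w (col BT BV BW)))).
  apply: expH_le => BT _ BV BW; case: (boolP (typD (t, v, w0))) => [ty|_]; last first.
    apply: ler_wpDr; last by rewrite lern1 leq_b1.
    by apply: avg_ge0 => a; rewrite ?mulr_ge0 ?ler0n.
  rewrite add0r /decD; apply: le_trans (pick_error _ _ _) _.
    by rewrite ty /= -!surjective_pairing !eqxx !andbT; case: (BT t) => f [].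
  rewrite /avg big_mkcond /=; apply: ler_sum => a _; rewrite /w /col mul1r.
  case: eqP => //= _; last first.
    rewrite -!surjective_pairing.
    have -> : ((BT t).1, tt) = BT t by case: (BT t) => f [].
    by rewrite -!natrM !mulnb.
  by rewrite mul0r.
rewrite expHD expH_cst lerD2l
  (expH_exch w (fun a BT _ BV BW => col BT BV BW a)).
apply: (@le_trans _ _ (avg w (fun a =>
    (if a.1.1 == t then 1 else uT) * ((if a.1 == (t, v) then 1 else uV)
      * (if (a.1.1, a.2) == (t, w0) then 1 else uW))))).
  apply: ler_avg => [a|a]; first by rewrite ler0n.
  rewrite (expH_prod (fun BT => (BT a.1.1 == BT t)%:R) (fun=> 1)
    (fun BV => (BV a.1 == BV (t, v))%:R)
    (fun BW => (BW (a.1.1, a.2) == BW (t, w0))%:R)).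
  rewrite !hash_collE ?card_prod ?card_unit ?muln1 ?muln_gt0 ?KT0 ?KV0 ?KW0 //.
  by rewrite avg_cst // mul1r.
have uT0 : 0 <= uT by exact: unif_ge0.
have uV0 : 0 <= uV by exact: unif_ge0.
have uW0 : 0 <= uW by exact: unif_ge0.
have g3' : 0 <= g3^-1 by rewrite invr_ge0 ltW.
have g4' : 0 <= g4^-1 by rewrite invr_ge0 ltW.
have g5' : 0 <= g5^-1 by rewrite invr_ge0 ltW.
have g6' : 0 <= g6^-1 by rewrite invr_ge0 ltW.
apply: (@le_trans _ _ (\sum_a (s3 a * (uT * uV * uW / g3)
    + (a.1.1 == t)%:R * ((a.2 == w0)%:R * s4 a) * (uV / g4)
    + (a.1.1 == t)%:R * ((a.1.2 == v)%:R * s5 a) * (uW / g5)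
    + (a.1.1 == t)%:R * s6 a * (uV * uW / g6)))).
  apply: ler_sum => -[[t' v'] w'] _; rewrite /w /=.
  set a := (t', v', w').
  have r3 : 0 <= s3 a * (uT * uV * uW / g3) by rewrite !mulr_ge0.
  have r4 : 0 <= s4 a * (uV / g4) by rewrite !mulr_ge0.
  have r5 : 0 <= s5 a * (uW / g5) by rewrite !mulr_ge0.
  have r6 : 0 <= s6 a * (uV * uW / g6) by rewrite !mulr_ge0.
  have rhs0 (b1 b2 b3 : bool) : 0 <= s3 a * (uT * uV * uW / g3)
      + b1%:R * (b2%:R * s4 a) * (uV / g4) + b1%:R * (b3%:R * s5 a) * (uW / g5)
      + b1%:R * s6 a * (uV * uW / g6).
    by rewrite !addr_ge0 ?mulr_ge0 ?ler0n.
  case: (boolP (typD a)) => [/typDE[l3 l4 l5 l6]|_]; last first.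
    by rewrite andbF mul0r; exact: rhs0.
  have {}l3 : 1 <= s3 a / g3 by rewrite ler_pdivlMr // mul1r.
  have {}l4 : 1 <= s4 a / g4 by rewrite ler_pdivlMr // mul1r.
  have {}l5 : 1 <= s5 a / g5 by rewrite ler_pdivlMr // mul1r.
  have {}l6 : 1 <= s6 a / g6 by rewrite ler_pdivlMr // mul1r.
  rewrite andbT /a !xpair_eqE.
  case: (eqVneq t' t) => [_|_] /=; last first.
    rewrite !mul0r !addr0 mul1r mulrA mulrCA; apply: ler_peMr => //.
    by rewrite !mulr_ge0.
  rewrite !mul1r.
  case: (eqVneq v' v) => [_|_]; case: (eqVneq w' w0) => [_|_] /=;
    rewrite ?mul0r ?mul1r ?addr0 ?mulr1.
  - by rewrite !addr_ge0.
  - have : uW <= s5 a * (uW / g5) by rewrite mulrCA; apply: ler_peMr.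
    by move: r3 r6 => /=; lra.
  - have : uV <= s4 a * (uV / g4) by rewrite mulrCA; apply: ler_peMr.
    by move: r3 r6 => /=; lra.
  have : uV * uW <= s6 a * (uV * uW / g6).
    by rewrite mulrCA; apply: ler_peMr => //; apply: mulr_ge0.
  by move: r3 => /=; lra.
rewrite !big_split /= -!mulr_suml; apply: lerD; first apply: lerD; first apply: lerD.
- by apply: ler_piMl => //; rewrite !mulr_ge0.
- apply: ler_piMl; first by rewrite mulr_ge0.
  apply: le_trans (s41 t w0); rewrite !sum_pairE /=.
  under eq_bigr => t' _ do under eq_bigr => v' _ do rewrite -mulr_sumr sum_ind_eq.
  under eq_bigr => t' _ do rewrite -mulr_sumr.
  by rewrite sum_ind_eq.
- apply: ler_piMl; first by rewrite mulr_ge0.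
  apply: le_trans (s51 t v); rewrite !sum_pairE /=.
  under eq_bigr => t' _ do under eq_bigr => v' _ do rewrite -!mulr_sumr.
  under eq_bigr => t' _ do rewrite -mulr_sumr sum_ind_eq.
  by rewrite sum_ind_eq.
apply: ler_piMl; first by rewrite !mulr_ge0.
apply: le_trans (s61 t); rewrite !sum_pairE /=.
under eq_bigr => t' _ do under eq_bigr => v' _ do rewrite -!mulr_sumr.
under eq_bigr => t' _ do rewrite -mulr_sumr.
by rewrite sum_ind_eq.
Qed.

(** The bound for fixed hashes is averaged over the hashes and exchanged with the ideal law: at
    fixed symbols the decoders cost a union bound and each bias costs leftover hashing. Some choice
    of the four hashes does no worse than the average. *)
Theorem one_shot :
  exists (phi0 : X -> M0) (phiX : X -> MX) (phiY : Y -> M0 -> MY)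
         (psi : MX -> MY -> T * V * W),
  avg p (fun z => (~~ good z.1 z.2 (psi (phiX z.1) (phiY z.2 (phi0 z.1))))%:R) <=
  expA (fun x y t u v w => (~~ good x y (t, v, w))%:R)
  + expA (fun x y t u v w => (~~ typY y (t, u))%:R)
  + expA (fun x y t u v w => (~~ typD (t, v, w))%:R)
  + 2 * expA (fun x y t u v w => (tT < kT x t)%R%:R)
  + 2 * expA (fun x y t u v w => (tU < kU (x, t) u)%R%:R)
  + 2 * expA (fun x y t u v w => (tV < kV (x, t) v)%R%:R)
  + 2 * expA (fun x y t u v w => (tW < kW (t, u, y) w)%R%:R)
  + (hash_loss KT tT hT + hash_loss KU tU hU + hash_loss KV tV hV
     + hash_loss KW tW hW)
  + (uT * uU / g1 + uU / g2)
  + (uT * uV * uW / g3 + uV / g4 + uW / g5 + uV * uW / g6).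
Proof.
have [x0 y0] := pmf_inh pp; have t0 := pmf_inh (kTp x0).
have u0 := pmf_inh (kUp (x0, t0)); have v0 := pmf_inh (kVp (x0, t0)).
have w0 := pmf_inh (kWp (t0, u0, y0)).
pose d0 := (t0, u0); pose d1 := (t0, v0, w0).
pose tot (BT : {ffun T -> KT * unit}) (BU : {ffun T * U -> KU * M0})
    (BV : {ffun T * V -> KV * MX}) (BW : {ffun T * W -> KW * MY})
    x y t u v w : R :=
  (bad_event BT BU BV BW typY typD good d0 d1 x y t u v w (binT BT x t)
     (binU BU (x, t) u) (binV BV (x, t) v) (binW BW (t, u, y) w))%:R
  + bin_bias kW (binW BW) (t, u, y) + bin_bias kV (binV BV) (x, t)
  + bin_bias kU (binU BU) (x, t) + bin_bias kT (binT BT) x.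
set bnd := (X in exists _ _ _ _, _ <= X).
suff : expH (fun BT BU BV BW => expA (tot BT BU BV BW)) <= bnd.
  move=> /(avg_exists HTp)[BT] /(avg_exists HUp)[BU].
  move=> /(avg_exists HVp)[BV] /(avg_exists HWp)[BW] le_bnd.
  have [phi0 [phiX [phiY [psi]]]] :=
    one_shot_fixed_hash BT BU BV BW typY typD good d0 d1.
  by move=> /le_trans/(_ le_bnd) ?; exists phi0, phiX, phiY, psi.
have -> : expH (fun BT BU BV BW => expA (tot BT BU BV BW)) =
    expA (fun x y t u v w => expH (fun BT BU BV BW => tot BT BU BV BW x y t u v w)).
  rewrite /expH -expA_exch; apply: eq_avg => BT; rewrite -expA_exch.
  apply: eq_avg => BU; rewrite -expA_exch; apply: eq_avg => BV.
  by rewrite -expA_exch.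
apply: (@le_trans _ _ (expA (fun x y t u v w =>
    (~~ good x y (t, v, w))%:R
  + (~~ typY y (t, u))%:R + (~~ typD (t, v, w))%:R
  + 2 * avg (kT x) (fun t => (tT < kT x t)%R%:R)
  + 2 * avg (kU (x, t)) (fun u => (tU < kU (x, t) u)%R%:R)
  + 2 * avg (kV (x, t)) (fun v => (tV < kV (x, t) v)%R%:R)
  + 2 * avg (kW (t, u, y)) (fun w => (tW < kW (t, u, y) w)%R%:R)
  + (hash_loss KT tT hT + hash_loss KU tU hU + hash_loss KV tV hV
     + hash_loss KW tW hW)
  + (uT * uU / g1 + uU / g2)
  + (uT * uV * uW / g3 + uV / g4 + uW / g5 + uV * uW / g6)))).
  apply: expA_le => x y t u v w; rewrite /tot !expHD.
  have bad_le : expH (fun BT BU BV BW =>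
      (bad_event BT BU BV BW typY typD good d0 d1 x y t u v w (binT BT x t)
      (binU BU (x, t) u) (binV BV (x, t) v) (binW BW (t, u, y) w))%:R) <=
      (~~ typY y (t, u))%:R + (uT * uU / g1 + uU / g2)
      + ((~~ typD (t, v, w))%:R
        + (uT * uV * uW / g3 + uV / g4 + uW / g5 + uV * uW / g6))
      + (~~ good x y (t, v, w))%:R.
    apply: le_trans (lerD (lerD (decY_error y t u d0) (decD_error t v w d1))
      (lexx _)).
    rewrite -[X in _ + X]expH_cst -!expHD; apply: expH_le => BT BU BV BW.
    rewrite /bad_event /binT /binU /binV /binW /=.
    exact: ind_or3.
  have bW : expH (fun _ _ _ BW => bin_bias kW (binW BW) (t, u, y)) <=
      2 * avg (kW (t, u, y)) (fun w => (tW < kW (t, u, y) w)%R%:R)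
      + hash_loss KW tW hW.
    rewrite /expH !avg_cst //; exact: bias_hash_tag.
  have bV : expH (fun _ _ BV _ => bin_bias kV (binV BV) (x, t)) <=
      2 * avg (kV (x, t)) (fun v => (tV < kV (x, t) v)%R%:R)
      + hash_loss KV tV hV.
    rewrite /expH !avg_cst //; under eq_avg do rewrite avg_cst //.
    exact: bias_hash_tag.
  have bU : expH (fun _ BU _ _ => bin_bias kU (binU BU) (x, t)) <=
      2 * avg (kU (x, t)) (fun u => (tU < kU (x, t) u)%R%:R)
      + hash_loss KU tU hU.
    rewrite /expH !avg_cst //; under eq_avg do rewrite !avg_cst //.
    exact: bias_hash_tag.
  have bT : expH (fun BT _ _ _ => bin_bias kT (binT BT) x) <=
      2 * avg (kT x) (fun t => (tT < kT x t)%R%:R) + hash_loss KT tT hT.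
    rewrite /expH; under eq_avg do rewrite !avg_cst //.
    by apply: bias_hash => //; rewrite card_unit.
  by lra.
(* What remains compares a tail probability of one kernel at its context with the same event under
   the full ideal law; the other coordinates average out as constants. *)
rewrite !expAD !expAZ !expA_cst /bnd !lerD //.
- rewrite ler_pM2l ?ltr0n //; apply: ler_avg => [|z]; first by case: pp.
  apply: (@le_trans _ _ (avg (kT z.1) (fun t => (tT < kT z.1 t)%R%:R))).
    by do 4 apply: avg_le_cst => // ?.
  apply: ler_avg => [|t']; first by case: (kTp z.1).
  by do 3 apply: avg_ge_cst => // ?.
- rewrite ler_pM2l ?ltr0n //; apply: ler_avg => [|z]; first by case: pp.
  apply: ler_avg => [|t']; first by case: (kTp z.1).
  apply: (@le_trans _ _ (avg (kU (z.1, t')) (fun u => (tU < kU (z.1, t') u)%R%:R))).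
    by do 3 apply: avg_le_cst => // ?.
  apply: ler_avg => [|u']; first by case: (kUp (z.1, t')).
  by do 2 apply: avg_ge_cst => // ?.
- rewrite ler_pM2l ?ltr0n //; apply: ler_avg => [|z]; first by case: pp.
  apply: ler_avg => [|t']; first by case: (kTp z.1).
  apply: ler_avg => [|u']; first by case: (kUp (z.1, t')).
  apply: (@le_trans _ _ (avg (kV (z.1, t')) (fun v => (tV < kV (z.1, t') v)%R%:R))).
    by do 2 apply: avg_le_cst => // ?.
  apply: ler_avg => [|v']; first by case: (kVp (z.1, t')).
  exact: avg_ge_cst.
rewrite ler_pM2l ?ltr0n //; apply: ler_avg => [|z]; first by case: pp.
apply: ler_avg => [|t']; first by case: (kTp z.1).
apply: ler_avg => [|u']; first by case: (kUp (z.1, t')).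
apply: ler_avg => [|v']; first by case: (kVp (z.1, t')).
exact: avg_le_cst.
Qed.

End OneShot.

(** * Product laws and concentration *)

Definition fmap (I A B : finType) (f : A -> B) (c : {ffun I -> A}) : {ffun I -> B} :=
  [ffun i => f (c i)].

Lemma fmapE (I A B : finType) (f : A -> B) (c : {ffun I -> A}) i :
  fmap f c i = f (c i).
Proof. exact: ffunE. Qed.

Lemma fmap_comp (I A B C : finType) (f : A -> B) (g : B -> C) (c : {ffun I -> A}) :
  fmap g (fmap f c) = fmap (fun a => g (f a)) c.
Proof. by apply/ffunP => i; rewrite !fmapE. Qed.

Section Product.
Variables (R : realFieldType) (I : finType).

Definition ffpair (A B : finType) (z : {ffun I -> A} * {ffun I -> B}) :
  {ffun I -> A * B} := [ffun i => (z.1 i, z.2 i)].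

Lemma ffpair_bij (A B : finType) : bijective (@ffpair A B).
Proof.
exists (fun c => (fmap fst c, fmap snd c)) => [[a b]|c].
  by congr pair; apply/ffunP => i; rewrite fmapE ffunE.
by apply/ffunP => i; rewrite ffunE !fmapE -surjective_pairing.
Qed.

Lemma ffpair_fst (A B : finType) (z : {ffun I -> A} * {ffun I -> B}) :
  fmap fst (ffpair z) = z.1.
Proof. by apply/ffunP => i; rewrite fmapE ffunE. Qed.

Lemma ffpair_snd (A B : finType) (z : {ffun I -> A} * {ffun I -> B}) :
  fmap snd (ffpair z) = z.2.
Proof. by apply/ffunP => i; rewrite fmapE ffunE. Qed.

Lemma avg_ffpair (A B : finType) (q : A * B -> R)
    (F : {ffun I -> A} * {ffun I -> B} -> R) :
  avg (fun z : {ffun I -> A} * {ffun I -> B} => \prod_i q (z.1 i, z.2 i)) F =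
  avg (rfun_weight (fun _ : I => q)) (fun c => F (fmap fst c, fmap snd c)).
Proof.
rewrite /avg [RHS](reindex (@ffpair A B)) /=; last first.
  exact/onW_bij/ffpair_bij.
apply: eq_bigr => z _; rewrite ffpair_fst ffpair_snd -surjective_pairing.
by congr (_ * _); apply: eq_bigr => i _; rewrite ffunE.
Qed.

(** Both sides weigh a pair of sequences by the same product over coordinates. Iterated, this folds
    the nested averages of [expA] into one i.i.d. law. *)
Lemma avg_rfun_kernel (A B : finType) (q : A -> R) (k : A -> B -> R)
    (F : {ffun I -> A} -> {ffun I -> B} -> R) :
  avg (rfun_weight (fun _ : I => q))
    (fun a => avg (rfun_weight (fun i => k (a i))) (F a)) =
  avg (rfun_weight (fun _ : I => fun z : A * B => q z.1 * k z.1 z.2))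
    (fun c => F (fmap fst c) (fmap snd c)).
Proof.
rewrite -(avg_ffpair (fun z => q z.1 * k z.1 z.2) (fun z => F z.1 z.2)).
rewrite /avg sum_pairE; apply: eq_bigr => a _; rewrite mulr_sumr.
by apply: eq_bigr => b _; rewrite /rfun_weight mulrA -big_split.
Qed.

Lemma pmf_rfun (A : finType) (k : I -> A -> R) : (forall i, pmf (k i)) ->
  pmf (rfun_weight k).
Proof.
move=> kp; split=> [c|]; first by apply: rfun_weight_ge0 => i; case: (kp i).
by apply: rfun_weight_sum1 => i; case: (kp i).
Qed.

Lemma chebyshev (A : finType) (q L : A -> R) (d : R) : pmf q -> (0 < #|I|)%N ->
  0 < d ->
  avg (rfun_weight (fun _ : I => q))
    (fun c => (#|I|%:R * d <= `|\sum_i (L (c i) - avg q L)|)%R%:R)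
  <= avg q (fun a => (L a - avg q L) ^+ 2) / d ^+ 2 / #|I|%:R.
Proof.
move=> [q0 q1] I0 d0; set mu := avg q L.
have nd0 : 0 < #|I|%:R * d by rewrite mulr_gt0 ?ltr0n.
pose Z (_ : I) a := L a - mu.
have varE : \sum_c rfun_weight (fun _ : I => q) c * (\sum_i Z i (c i)) ^+ 2 =
    #|I|%:R * avg q (fun a => (L a - mu) ^+ 2).
  rewrite rfun_weight_variance // => [|i]; last first.
    rewrite /Z; under eq_bigr do rewrite mulrBr.
    by rewrite sumrB -mulr_suml q1 mul1r /mu /avg subrr.
  by rewrite /Z sumr_const -[LHS]mulr_natl.
apply: (@le_trans _ _ (avg (rfun_weight (fun _ : I => q))
   (fun c => (\sum_i Z i (c i)) ^+ 2 / (#|I|%:R * d) ^+ 2))).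
  apply: ler_avg => [c|c]; first by apply: rfun_weight_ge0.
  case: (leP (#|I|%:R * d) _) => [ge|_]; last by rewrite divr_ge0 ?sqr_ge0.
  rewrite ler_pdivlMr ?exprn_gt0 // mul1r -[leRHS]real_normK ?num_real //.
  by rewrite ler_sqr ?nnegrE // ltW.
rewrite avgZr [avg _ _]varE le_eqVlt; apply/orP; left; apply/eqP.
by field; rewrite !gt_eqF ?ltr0n.
Qed.

End Product.

Section Concentration.
Variables (R : realFieldType) (I : finType) (A : finType) (q : A -> R).
Variable lg : R -> R.
Hypothesis lgM : forall a b, 0 < a -> 0 < b -> lg (a * b) = lg a + lg b.
Hypothesis lg_lt : forall a b, 0 < a -> a < b -> lg a < lg b.
Hypotheses (qp : pmf q) (I0 : (0 < #|I|)%N).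

Lemma lg_prod (J : finType) (f : J -> R) : (forall i, 0 < f i) ->
  lg (\prod_i f i) = \sum_i lg (f i).
Proof.
move=> f0; have lg1 : lg 1 = 0.
  by have := lgM ltr01 ltr01; rewrite mulr1 => h; rewrite -(subrr (lg 1)) {2}h addrK.
have : 0 < \prod_i f i /\ lg (\prod_i f i) = \sum_i lg (f i); last by case.
elim/big_rec2: _ => [|i x y _ [x0 <-]]; first by rewrite lg1.
by rewrite mulr_gt0 // lgM.
Qed.

(** The Chebyshev constant of [lg k]: over [n] letters, a deviation of [n d] has probability at most
    [lgvar k d / n]. *)
Definition lgvar (k : A -> R) (d : R) : R :=
  avg q (fun a => (lg (k a) - avg q (fun a => lg (k a))) ^+ 2) / d ^+ 2.

Lemma rfun_weight_gt0 (c : {ffun I -> A}) :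
  rfun_weight (fun _ : I => q) c != 0 -> forall i, 0 < q (c i).
Proof.
move=> /prodf_neq0 h i; have [q0 _] := qp.
by rewrite lt_neqAle q0 andbT eq_sym h.
Qed.

Lemma ler_avg_supp (J : finType) (w F G : J -> R) : (forall i, 0 <= w i) ->
  (forall i, w i != 0 -> F i <= G i) -> avg w F <= avg w G.
Proof.
move=> w0 FG; apply: ler_sum => i _.
have [->|wi] := eqVneq (w i) 0; first by rewrite !mul0r.
by apply: ler_wpM2l => //; exact: FG.
Qed.

Variables (k : A -> R) (d : R).
Hypotheses (k0 : forall a, 0 < q a -> 0 < k a) (d0 : 0 < d).

(** Asymptotic equipartition: the logarithm of the product is an i.i.d. sum, to which Chebyshev
    applies. Sequences leaving the support have weight zero, so [k] has to be positive only where
    [q] is. *)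
Lemma prod_le_concentration (tau : R) : 0 < tau ->
  #|I|%:R * (avg q (fun a => lg (k a)) + d) <= lg tau ->
  avg (rfun_weight (fun _ : I => q))
    (fun c : {ffun I -> A} => (tau < \prod_i k (c i))%R%:R) <= lgvar k d / #|I|%:R.
Proof.
move=> tau0 tau_ge.
apply: le_trans (chebyshev (fun a => lg (k a)) qp I0 d0).
apply: ler_avg_supp => [c|c /rfun_weight_gt0 qc].
  by apply: rfun_weight_ge0 => i; case: qp.
rewrite ler_nat; case: (ltP tau) => //= tau_lt.
suff -> : #|I|%:R * d <= `|\sum_i (lg (k (c i)) - avg q (fun a => lg (k a)))| by [].
apply: le_trans (ler_norm _).
rewrite sumrB sumr_const -lg_prod; last by move=> i; apply: k0.
have := lg_lt tau0 tau_lt; rewrite -[_ *+ _]mulr_natl -[#|_|]/#|I|.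
by move=> ?; lra.
Qed.

Lemma prod_ge_concentration (sg : R) : 0 < sg ->
  lg sg <= #|I|%:R * (avg q (fun a => lg (k a)) - d) ->
  avg (rfun_weight (fun _ : I => q))
    (fun c : {ffun I -> A} => (~~ (sg <= \prod_i k (c i))%R)%:R)
  <= lgvar k d / #|I|%:R.
Proof.
move=> sg0 sg_le.
apply: le_trans (chebyshev (fun a => lg (k a)) qp I0 d0).
apply: ler_avg_supp => [c|c /rfun_weight_gt0 qc].
  by apply: rfun_weight_ge0 => i; case: qp.
rewrite ler_nat -ltNge; case: (ltP _ sg) => //= sg_gt.
suff -> : #|I|%:R * d <= `|\sum_i (lg (k (c i)) - avg q (fun a => lg (k a)))| by [].
rewrite -normrN; apply: le_trans (ler_norm _).
rewrite sumrB sumr_const -lg_prod; last by move=> i; apply: k0.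
have : lg (\prod_i k (c i)) < lg sg.
  by apply: lg_lt => //; apply: prodr_gt0 => i _; apply: k0.
rewrite -[_ *+ _]mulr_natl -[#|_|]/#|I|.
by move=> ?; lra.
Qed.

End Concentration.

Lemma sum_le_concentration (R : realFieldType) (I A : finType) (q L : A -> R)
    (d D : R) : pmf q -> (0 < #|I|)%N -> 0 < d -> avg q L <= D ->
  avg (rfun_weight (fun _ : I => q))
    (fun c : {ffun I -> A} => (~~ (\sum_i L (c i) <= #|I|%:R * (D + d))%R)%:R)
  <= avg q (fun a => (L a - avg q L) ^+ 2) / d ^+ 2 / #|I|%:R.
Proof.
move=> qp I0 d0 LD; apply: le_trans (chebyshev L qp I0 d0).
apply: ler_avg => [c|c]; first by apply: rfun_weight_ge0 => i; case: qp.
rewrite ler_nat -ltNge; case: (ltP _ (\sum_i _)) => //= gt.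
suff -> : #|I|%:R * d <= `|\sum_i (L (c i) - avg q L)| by [].
apply: le_trans (ler_norm _).
rewrite sumrB sumr_const -[_ *+ _]mulr_natl -[#|_|]/#|I|.
have : #|I|%:R * avg q L <= #|I|%:R * D by rewrite ler_wpM2l.
by lra.
Qed.

Lemma prod_le1 (R : realFieldType) (I : finType) (f : I -> R) :
  (forall i, 0 <= f i <= 1) -> \prod_i f i <= 1.
Proof. by move=> f01; apply: prodr_ile1 => i _; exact: f01. Qed.

(** * Block codes from single-letter kernels *)

Section IID.
Variables (R : realFieldType) (lg : R -> R).
Hypothesis lgM : forall a b, 0 < a -> 0 < b -> lg (a * b) = lg a + lg b.
Hypothesis lg_lt : forall a b, 0 < a -> a < b -> lg a < lg b.

Variables X Y T U V W : finType.
Variables (p : X * Y -> R) (kT : X -> T -> R) (kU : X * T -> U -> R).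
Variables (kV : X * T -> V -> R) (kW : T * U * Y -> W -> R).
Hypotheses (pp : pmf p) (kTp : forall c, pmf (kT c)) (kUp : forall c, pmf (kU c)).
Hypotheses (kVp : forall c, pmf (kV c)) (kWp : forall c, pmf (kW c)).

Let Om := (X * Y * T * U * V * W)%type.
Let oX (o : Om) := o.1.1.1.1.1.
Let oY (o : Om) := o.1.1.1.1.2.
Let oT (o : Om) := o.1.1.1.2.
Let oU (o : Om) := o.1.1.2.
Let oV (o : Om) := o.1.2.
Let oW (o : Om) := o.2.

Definition law (o : Om) : R :=
  p (oX o, oY o) * kT (oX o) (oT o) * kU (oX o, oT o) (oU o)
  * kV (oX o, oT o) (oV o) * kW (oT o, oU o, oY o) (oW o).

Section Letters.
Variable I : finType.
Notation "A ^n" := {ffun I -> A} (at level 2, format "A ^n").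

Definition pn (z : X^n * Y^n) : R := \prod_i p (z.1 i, z.2 i).
Definition kTn (x : X^n) : T^n -> R := rfun_weight (fun i => kT (x i)).
Definition kUn (c : X^n * T^n) : U^n -> R :=
  rfun_weight (fun i => kU (c.1 i, c.2 i)).
Definition kVn (c : X^n * T^n) : V^n -> R :=
  rfun_weight (fun i => kV (c.1 i, c.2 i)).
Definition kWn (c : T^n * U^n * Y^n) : W^n -> R :=
  rfun_weight (fun i => kW (c.1.1 i, c.1.2 i, c.2 i)).

Definition lawn : Om^n -> R := rfun_weight (fun _ : I => law).

Lemma pn_pmf : pmf pn.
Proof.
have p0 := (pp).1; split=> [z|]; first exact: prodr_ge0.
transitivity (avg pn (fun _ => 1)); first by apply: eq_bigr => z _; rewrite mulr1.
rewrite /pn (avg_ffpair (I := I) p) avg_cst //; exact: pmf_rfun.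
Qed.

(** [avg_rfun_kernel] is applied once per kernel, each time reading the context of the kernel off
    the tuple accumulated so far. *)
Lemma expA_iid (F : X^n -> Y^n -> T^n -> U^n -> V^n -> W^n -> R) :
  expA pn kTn kUn kVn kWn F =
  avg lawn (fun o => F (fmap oX o) (fmap oY o) (fmap oT o) (fmap oU o)
                       (fmap oV o) (fmap oW o)).
Proof.
rewrite /expA /pn (avg_ffpair (I := I) p) /=.
have kTnE (c : (X * Y)^n) :
    kTn (fmap fst c) = rfun_weight (fun i => (fun z : X * Y => kT z.1) (c i)).
  rewrite /kTn /rfun_weight; apply: boolp.funext => t.
  by apply: eq_bigr => i _; rewrite fmapE.
under eq_avg do rewrite kTnE.
etransitivity; first exact: (avg_rfun_kernel _ (fun z : X * Y => kT z.1) _).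
rewrite /=.
have kUnE (c : (X * Y * T)^n) : kUn (fmap fst (fmap fst c), fmap snd c) =
    rfun_weight (fun i => (fun z : X * Y * T => kU (z.1.1, z.2)) (c i)).
  rewrite /kUn /rfun_weight; apply: boolp.funext => t.
  by apply: eq_bigr => i _; rewrite !fmapE.
under eq_avg do rewrite kUnE.
etransitivity; first exact: (avg_rfun_kernel _ (fun z : X * Y * T => kU (z.1.1, z.2)) _).
rewrite /=.
have kVnE (c : (X * Y * T * U)^n) :
    kVn (fmap fst (fmap fst (fmap fst c)), fmap snd (fmap fst c)) =
    rfun_weight (fun i => (fun z : X * Y * T * U => kV (z.1.1.1, z.1.2)) (c i)).
  rewrite /kVn /rfun_weight; apply: boolp.funext => t.
  by apply: eq_bigr => i _; rewrite !fmapE.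
under eq_avg do rewrite kVnE.
etransitivity; first exact: (avg_rfun_kernel _
  (fun z : X * Y * T * U => kV (z.1.1.1, z.1.2)) _).
rewrite /=.
have kWnE (c : (X * Y * T * U * V)^n) :
    kWn (fmap snd (fmap fst (fmap fst c)), fmap snd (fmap fst c),
         fmap snd (fmap fst (fmap fst (fmap fst c)))) =
    rfun_weight (fun i => (fun z : X * Y * T * U * V =>
      kW (z.1.1.2, z.1.2, z.1.1.1.2)) (c i)).
  rewrite /kWn /rfun_weight; apply: boolp.funext => t.
  by apply: eq_bigr => i _; rewrite !fmapE.
under eq_avg do rewrite kWnE.
etransitivity; first exact: (avg_rfun_kernel _
  (fun z : X * Y * T * U * V => kW (z.1.1.2, z.1.2, z.1.1.1.2)) _).
rewrite /=.
transitivity (avg lawn (fun c => F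
  (fmap fst (fmap fst (fmap fst (fmap fst (fmap fst c)))))
  (fmap snd (fmap fst (fmap fst (fmap fst (fmap fst c)))))
  (fmap snd (fmap fst (fmap fst (fmap fst c))))
  (fmap snd (fmap fst (fmap fst c))) (fmap snd (fmap fst c)) (fmap snd c))).
  apply: eq_bigr => c _; congr (_ * _); apply: eq_bigr => i _.
  by case: (c i) => [[[[[x y] t] u] v] w].
by apply: eq_avg => c; rewrite !fmap_comp.
Qed.

Lemma law_pmf : pmf law.
Proof.
have [[p0 p1] kT0 kU0 kV0 kW0] := And5 pp (fun c => (kTp c).1) (fun c => (kUp c).1)
  (fun c => (kVp c).1) (fun c => (kWp c).1).
split=> [o|]; first by rewrite /law !mulr_ge0.
rewrite -p1 !sum_pairE /law /oX /oY /oT /oU /oV /oW /=.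
apply: eq_bigr => x _; apply: eq_bigr => y _.
transitivity (\sum_t p (x, y) * kT x t); last by rewrite -mulr_sumr (kTp x).2 mulr1.
apply: eq_bigr => t _; transitivity (\sum_u p (x, y) * kT x t * kU (x, t) u);
  last by rewrite -mulr_sumr (kUp _).2 mulr1.
apply: eq_bigr => u _.
transitivity (\sum_v p (x, y) * kT x t * kU (x, t) u * kV (x, t) v);
  last by rewrite -mulr_sumr (kVp _).2 mulr1.
by apply: eq_bigr => v _; rewrite -mulr_sumr (kWp _).2 mulr1.
Qed.

Lemma law_gt0 o : 0 < law o -> [/\ 0 < kT (oX o) (oT o),
  0 < kU (oX o, oT o) (oU o), 0 < kV (oX o, oT o) (oV o)
  & 0 < kW (oT o, oU o, oY o) (oW o)].
Proof.
rewrite /law !lt_neqAle ![0 == _]eq_sym !mulf_eq0 !negb_or => /andP[/andP[]].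
move=> /andP[/andP[/andP[_ ->] ->] ->] -> _.
by rewrite (kTp _).1 (kUp _).1 (kVp _).1 (kWp _).1.
Qed.

Variables (s1 s2 : Y -> T * U -> R) (s3 s4 s5 s6 : T * V * W -> R).
Hypotheses (s10 : forall y a, 0 <= s1 y a) (s20 : forall y a, 0 <= s2 y a).
Hypotheses (s30 : forall a, 0 <= s3 a) (s40 : forall a, 0 <= s4 a).
Hypotheses (s50 : forall a, 0 <= s5 a) (s60 : forall a, 0 <= s6 a).
Hypotheses (s11 : forall y, \sum_a s1 y a <= 1).
Hypotheses (s21 : forall y t, \sum_u s2 y (t, u) <= 1).
Hypotheses (s31 : \sum_a s3 a <= 1) (s41 : forall t w, \sum_v s4 (t, v, w) <= 1).
Hypotheses (s51 : forall t v, \sum_w s5 (t, v, w) <= 1).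
Hypotheses (s61 : forall t, \sum_v \sum_w s6 (t, v, w) <= 1).

Let eT o := kT (oX o) (oT o).
Let eU o := kU (oX o, oT o) (oU o).
Let eV o := kV (oX o, oT o) (oV o).
Let eW o := kW (oT o, oU o, oY o) (oW o).
Let e1 o := s1 (oY o) (oT o, oU o).
Let e2 o := s2 (oY o) (oT o, oU o).
Let e3 o := s3 (oT o, oV o, oW o).
Let e4 o := s4 (oT o, oV o, oW o).
Let e5 o := s5 (oT o, oV o, oW o).
Let e6 o := s6 (oT o, oV o, oW o).
Hypotheses (e10 : forall o, 0 < law o -> 0 < e1 o).
Hypotheses (e20 : forall o, 0 < law o -> 0 < e2 o).
Hypotheses (e30 : forall o, 0 < law o -> 0 < e3 o).
Hypotheses (e40 : forall o, 0 < law o -> 0 < e4 o).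
Hypotheses (e50 : forall o, 0 < law o -> 0 < e5 o).
Hypotheses (e60 : forall o, 0 < law o -> 0 < e6 o).

Variables (c1 c2 : X -> Y -> T * V * W -> R) (D1 D2 d : R).
Let C1 o := c1 (oX o) (oY o) (oT o, oV o, oW o).
Let C2 o := c2 (oX o) (oY o) (oT o, oV o, oW o).
Hypotheses (C1D : avg law C1 <= D1) (C2D : avg law C2 <= D2) (d0 : 0 < d).

(** The coefficient of 1/n in the error: one Chebyshev constant per cost and per score, and one per
    kernel, doubled because leftover hashing charges heavy atoms twice. *)
Definition iid_const : R :=
  avg law (fun o => (C1 o - avg law C1) ^+ 2) / d ^+ 2
  + avg law (fun o => (C2 o - avg law C2) ^+ 2) / d ^+ 2
  + lgvar law lg e1 d + lgvar law lg e2 d + lgvar law lg e3 d + lgvar law lg e4 d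
  + lgvar law lg e5 d + lgvar law lg e6 d
  + 2 * (lgvar law lg eT d + lgvar law lg eU d + lgvar law lg eV d
         + lgvar law lg eW d).

Variables KT KU KV KW M0 MX MY : finType.
Hypotheses (KT0 : (0 < #|KT|)%N) (KU0 : (0 < #|KU|)%N).
Hypotheses (KV0 : (0 < #|KV|)%N) (KW0 : (0 < #|KW|)%N).
Hypotheses (M00 : (0 < #|M0|)%N) (MX0 : (0 < #|MX|)%N) (MY0 : (0 < #|MY|)%N).
Hypothesis I0 : (0 < #|I|)%N.
Variables (g1 g2 g3 g4 g5 g6 : R) (tT tU tV tW h : R).
Hypotheses (g10 : 0 < g1) (g20 : 0 < g2) (g30 : 0 < g3) (g40 : 0 < g4).
Hypotheses (g50 : 0 < g5) (g60 : 0 < g6) (h0 : 0 < h).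
Hypotheses (tT0 : 0 < tT) (tU0 : 0 < tU) (tV0 : 0 < tV) (tW0 : 0 < tW).
Let mean (k : Om -> R) := avg law (fun o => lg (k o)).
Hypotheses (lg1 : lg g1 <= #|I|%:R * (mean e1 - d)).
Hypotheses (lg2 : lg g2 <= #|I|%:R * (mean e2 - d)).
Hypotheses (lg3 : lg g3 <= #|I|%:R * (mean e3 - d)).
Hypotheses (lg4 : lg g4 <= #|I|%:R * (mean e4 - d)).
Hypotheses (lg5 : lg g5 <= #|I|%:R * (mean e5 - d)).
Hypotheses (lg6 : lg g6 <= #|I|%:R * (mean e6 - d)).
Hypotheses (lgT : #|I|%:R * (mean eT + d) <= lg tT).
Hypotheses (lgU : #|I|%:R * (mean eU + d) <= lg tU).
Hypotheses (lgV : #|I|%:R * (mean eV + d) <= lg tV).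
Hypotheses (lgW : #|I|%:R * (mean eW + d) <= lg tW).

Definition within_cost (x : X^n) (y : Y^n) (a : T^n * V^n * W^n) : bool :=
  (\sum_i c1 (x i) (y i) (a.1.1 i, a.1.2 i, a.2 i) <= #|I|%:R * (D1 + d))
  && (\sum_i c2 (x i) (y i) (a.1.1 i, a.1.2 i, a.2 i) <= #|I|%:R * (D2 + d)).

(** Typicality is a lower bound on product scores. Scores that sum to at most one per letter have
    products that sum to at most one over sequences, by expanding a product of sums, so [one_shot]
    applies; all its tail events are then Chebyshev terms. *)
Theorem iid_code :
  exists (phi0 : X^n -> M0) (phiX : X^n -> MX) (phiY : Y^n -> M0 -> MY)
         (psi : MX -> MY -> T^n * V^n * W^n),
  avg pn (fun z => (~~ within_cost z.1 z.2 (psi (phiX z.1) (phiY z.2 (phi0 z.1))))%:R) <=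
  iid_const / #|I|%:R
  + (hash_loss KT tT h + hash_loss KU tU h + hash_loss KV tV h + hash_loss KW tW h)
  + (unif R (KT * unit)%type * unif R (KU * M0)%type / g1 + unif R (KU * M0)%type / g2)
  + (unif R (KT * unit)%type * unif R (KV * MX)%type * unif R (KW * MY)%type / g3
     + unif R (KV * MX)%type / g4 + unif R (KW * MY)%type / g5
     + unif R (KV * MX)%type * unif R (KW * MY)%type / g6).
Proof.
pose S2 (s : Y -> T * U -> R) (y : Y^n) (a : T^n * U^n) :=
  \prod_i s (y i) (a.1 i, a.2 i).
pose S3 (s : T * V * W -> R) (a : T^n * V^n * W^n) :=
  \prod_i s (a.1.1 i, a.1.2 i, a.2 i).
pose typY y a := (g1 <= S2 s1 y a) && (g2 <= S2 s2 y a).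
pose typD a := [&& g3 <= S3 s3 a, g4 <= S3 s4 a, g5 <= S3 s5 a & g6 <= S3 s6 a].
have [] := @one_shot R X^n Y^n T^n U^n V^n W^n KT KU KV KW M0 MX MY
  pn kTn kUn kVn kWn pn_pmf (fun x => pmf_rfun (fun i => kTp (x i)))
  (fun c => pmf_rfun (fun i => kUp _)) (fun c => pmf_rfun (fun i => kVp _))
  (fun c => pmf_rfun (fun i => kWp _)) KT0 KU0 KV0 KW0 M00 MX0 MY0
  typY typD within_cost (S2 s1) (S2 s2) (S3 s3) (S3 s4) (S3 s5) (S3 s6)
  g1 g2 g3 g4 g5 g6 tT tU tV tW h h h h.
all: try by move=> *; apply: prodr_ge0.
all: try by apply: ltW.
all: try by [].
- move=> y; rewrite sum_pairE.
  under eq_bigr => t _ do rewrite -(bigA_distr_bigA (fun i u => s1 (y i) (t i, u))).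
  rewrite -(bigA_distr_bigA (fun i t => \sum_u s1 (y i) (t, u))).
  apply: prod_le1 => i; rewrite -(sum_pairE (s1 (y i))) s11 andbT.
  exact: sumr_ge0.
- move=> y t; rewrite -(bigA_distr_bigA (fun i u => s2 (y i) (t i, u))).
  by apply: prod_le1 => i; rewrite s21 andbT sumr_ge0.
- rewrite !sum_pairE.
  under eq_bigr => t _ do under eq_bigr => v _ do
    rewrite -(bigA_distr_bigA (fun i w => s3 (t i, v i, w))).
  under eq_bigr => t _ do
    rewrite -(bigA_distr_bigA (fun i v => \sum_w s3 (t i, v, w))).
  rewrite -(bigA_distr_bigA (fun i t => \sum_v \sum_w s3 (t, v, w))).
  apply: prod_le1 => i.
  have -> : \sum_t \sum_v \sum_w s3 (t, v, w) = \sum_a s3 a by rewrite !sum_pairE.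
  by rewrite s31 andbT sumr_ge0.
- move=> t w; rewrite -(bigA_distr_bigA (fun i v => s4 (t i, v, w i))).
  by apply: prod_le1 => i; rewrite s41 andbT sumr_ge0.
- move=> t v; rewrite -(bigA_distr_bigA (fun i w => s5 (t i, v i, w))).
  by apply: prod_le1 => i; rewrite s51 andbT sumr_ge0.
- move=> t; under eq_bigr => v _ do
    rewrite -(bigA_distr_bigA (fun i w => s6 (t i, v i, w))).
  rewrite -(bigA_distr_bigA (fun i v => \sum_w s6 (t i, v, w))).
  by apply: prod_le1 => i; rewrite s61 andbT sumr_ge0 // => v _; rewrite sumr_ge0.
- by move=> y a /andP[].
- by move=> a /and4P[].
move=> phi0 [phiX [phiY [psi err_le]]]; exists phi0, phiX, phiY, psi.
apply: le_trans err_le _; rewrite !expA_iid.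
have lawp := law_pmf.
have ge0 (o : Om^n) : 0 <= lawn o by apply: rfun_weight_ge0 => i; exact: (lawp.1).
have ind_and (a b : bool) : (~~ (a && b))%:R <= (~~ a)%:R + (~~ b)%:R :> R.
  by case: a; case: b; rewrite /=; lra.
have goodE : avg lawn (fun o => (~~ within_cost (fmap oX o) (fmap oY o)
    (fmap oT o, fmap oV o, fmap oW o))%:R) <=
    avg law (fun o => (C1 o - avg law C1) ^+ 2) / d ^+ 2 / #|I|%:R
    + avg law (fun o => (C2 o - avg law C2) ^+ 2) / d ^+ 2 / #|I|%:R.
  apply: le_trans (lerD (sum_le_concentration lawp I0 d0 C1D)
                        (sum_le_concentration lawp I0 d0 C2D)).
  rewrite -avgD; apply: ler_avg => // o; rewrite /within_cost.
  under eq_bigr do rewrite !fmapE; under [X in _ && (X <= _)]eq_bigr do rewrite !fmapE.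
  exact: ind_and.
have S2E s o : S2 s (fmap oY o) (fmap oT o, fmap oU o) =
    \prod_i s (oY (o i)) (oT (o i), oU (o i)).
  by apply: eq_bigr => i _; rewrite !fmapE.
have S3E s o : S3 s (fmap oT o, fmap oV o, fmap oW o) =
    \prod_i s (oT (o i), oV (o i), oW (o i)).
  by apply: eq_bigr => i _; rewrite !fmapE.
have typYE : avg lawn (fun o => (~~ typY (fmap oY o) (fmap oT o, fmap oU o))%:R) <=
    lgvar law lg e1 d / #|I|%:R + lgvar law lg e2 d / #|I|%:R.
  apply: le_trans (lerD
    (prod_ge_concentration lgM lg_lt lawp I0 e10 d0 g10 lg1)
    (prod_ge_concentration lgM lg_lt lawp I0 e20 d0 g20 lg2)).
  by rewrite -avgD; apply: ler_avg => // o; rewrite /typY !S2E; exact: ind_and.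
have typDE : avg lawn (fun o => (~~ typD (fmap oT o, fmap oV o, fmap oW o))%:R) <=
    lgvar law lg e3 d / #|I|%:R + (lgvar law lg e4 d / #|I|%:R
    + (lgvar law lg e5 d / #|I|%:R + lgvar law lg e6 d / #|I|%:R)).
  apply: le_trans (lerD
    (prod_ge_concentration lgM lg_lt lawp I0 e30 d0 g30 lg3) (lerD
    (prod_ge_concentration lgM lg_lt lawp I0 e40 d0 g40 lg4) (lerD
    (prod_ge_concentration lgM lg_lt lawp I0 e50 d0 g50 lg5)
    (prod_ge_concentration lgM lg_lt lawp I0 e60 d0 g60 lg6)))).
  rewrite -!avgD; apply: ler_avg => // o; rewrite /typD !S3E.
  apply: le_trans (ind_and _ _) (lerD (lexx _) _).
  apply: le_trans (ind_and _ _) (lerD (lexx _) _).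
  exact: ind_and.
have eT0 o : 0 < law o -> 0 < eT o by case/law_gt0.
have eU0 o : 0 < law o -> 0 < eU o by case/law_gt0.
have eV0 o : 0 < law o -> 0 < eV o by case/law_gt0.
have eW0 o : 0 < law o -> 0 < eW o by case/law_gt0.
have TE : avg lawn (fun o => (tT < kTn (fmap oX o) (fmap oT o))%R%:R) <=
    lgvar law lg eT d / #|I|%:R.
  apply: le_trans (prod_le_concentration lgM lg_lt lawp I0 eT0 d0 tT0 lgT).
  apply: ler_avg => // o; rewrite /kTn /rfun_weight.
  by under eq_bigr do rewrite !fmapE.
have UE : avg lawn (fun o => (tU < kUn (fmap oX o, fmap oT o) (fmap oU o))%R%:R) <=
    lgvar law lg eU d / #|I|%:R.
  apply: le_trans (prod_le_concentration lgM lg_lt lawp I0 eU0 d0 tU0 lgU).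
  apply: ler_avg => // o; rewrite /kUn /rfun_weight.
  by under eq_bigr do rewrite !fmapE.
have VE : avg lawn (fun o => (tV < kVn (fmap oX o, fmap oT o) (fmap oV o))%R%:R) <=
    lgvar law lg eV d / #|I|%:R.
  apply: le_trans (prod_le_concentration lgM lg_lt lawp I0 eV0 d0 tV0 lgV).
  apply: ler_avg => // o; rewrite /kVn /rfun_weight.
  by under eq_bigr do rewrite !fmapE.
have WE : avg lawn (fun o =>
    (tW < kWn (fmap oT o, fmap oU o, fmap oY o) (fmap oW o))%R%:R) <=
    lgvar law lg eW d / #|I|%:R.
  apply: le_trans (prod_le_concentration lgM lg_lt lawp I0 eW0 d0 tW0 lgW).
  apply: ler_avg => // o; rewrite /kWn /rfun_weight.
  by under eq_bigr do rewrite !fmapE.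
rewrite !lerD2r /iid_const !mulrDl.
lra.
Qed.

End Letters.
End IID.

(** * Marginals of the six coordinates *)

Section MarginalDefinition.
Variables (R : realFieldType) (X Y T U V W : finType).
Local Notation Om := (X * Y * T * U * V * W)%type.
Implicit Types (o : Om) (q : Om -> R).

Definition oX o := o.1.1.1.1.1.
Definition oY o := o.1.1.1.1.2.
Definition oT o := o.1.1.1.2.
Definition oU o := o.1.1.2.
Definition oV o := o.1.2.
Definition oW o := o.2.

Definition agree (bx bb bt bu bv bw : bool) o o' :=
  [&& bx ==> (oX o' == oX o), bb ==> (oY o' == oY o), bt ==> (oT o' == oT o),
      bu ==> (oU o' == oU o), bv ==> (oV o' == oV o) & bw ==> (oW o' == oW o)].

(* The marginal mass, under [q], of the coordinates of [o] selected by the flags. *)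
Definition marg_of q bx bb bt bu bv bw o : R :=
  \sum_(o' | agree bx bb bt bu bv bw o o') q o'.

End MarginalDefinition.

(* The letters in the name are the coordinates that are kept. *)
Local Notation m_x q := (marg_of q true false false false false false).
Local Notation m_xy q := (marg_of q true true false false false false).
Local Notation m_y q := (marg_of q false true false false false false).
Local Notation m_xt q := (marg_of q true false true false false false).
Local Notation m_t q := (marg_of q false false true false false false).
Local Notation m_u q := (marg_of q false false false true false false).
Local Notation m_tu q := (marg_of q false false true true false false).
Local Notation m_xu q := (marg_of q true false false true false false).
Local Notation m_xtu q := (marg_of q true false true true false false).
Local Notation m_xytu q := (marg_of q true true true true false false).
Local Notation m_yu q := (marg_of q false true false true false false).
Local Notation m_xyu q := (marg_of q true true false true false false).
Local Notation m_ytu q := (marg_of q false true true true false false).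
Local Notation m_xyt q := (marg_of q true true true false false false).
Local Notation m_yt q := (marg_of q false true true false false false).
Local Notation m_xtv q := (marg_of q true false true false true false).
Local Notation m_xytuv q := (marg_of q true true true true true false).
Local Notation m_xytv q := (marg_of q true true true false true false).
Local Notation m_xtw q := (marg_of q true false true false false true).
Local Notation m_yuw q := (marg_of q false true false true false true).
Local Notation m_ytuvw q := (marg_of q false true true true true true).
Local Notation m_ytuv q := (marg_of q false true true true true false).
Local Notation m_ytuw q := (marg_of q false true true true false true).
Local Notation m_xtvw q := (marg_of q true false true false true true).
Local Notation m_tvw q := (marg_of q false false true false true true).
Local Notation m_tw q := (marg_of q false false true false false true).
Local Notation m_tv q := (marg_of q false false true false true false).
Local Notation m_xytvw q := (marg_of q true true true false true true).
Local Notation m_xytuw q := (marg_of q true true true true false true).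

Section Marginals.
Variables (R : realFieldType) (X Y T U V W : finType).
Local Notation Om := (X * Y * T * U * V * W)%type.
Implicit Types o : Om.
Local Notation oX := (@oX X Y T U V W).
Local Notation oY := (@oY X Y T U V W).
Local Notation oT := (@oT X Y T U V W).
Local Notation oU := (@oU X Y T U V W).
Local Notation oV := (@oV X Y T U V W).
Local Notation oW := (@oW X Y T U V W).
Variable q : Om -> R.
Hypothesis q0 : forall o, 0 <= q o.
Local Notation marg := (marg_of q).
Implicit Types bx bb bt bu bv bw : bool.

Lemma marg_ge0 bx bb bt bu bv bw o : 0 <= marg bx bb bt bu bv bw o.
Proof. exact: sumr_ge0. Qed.

Lemma marg_all o : marg true true true true true true o = q o.
Proof.
rewrite /marg_of (big_pred1 o) // => o'; rewrite /agree /=.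
case: o o' => [[[[[x y] t] u] v] w] [[[[[x' y'] t'] u'] v'] w'].
by rewrite /pred1 /= !xpair_eqE -!andbA.
Qed.

Lemma marg_none o : \sum_o q o = 1 -> marg false false false false false false o = 1.
Proof. by move=> <-. Qed.

Lemma marg_mono bx bb bt bu bv bw cx cy ct cu cv cw o :
  cx ==> bx -> cy ==> bb -> ct ==> bt -> cu ==> bu -> cv ==> bv -> cw ==> bw ->
  marg bx bb bt bu bv bw o <= marg cx cy ct cu cv cw o.
Proof.
move=> hx hy ht hu hv hw; rewrite /marg_of [leLHS]big_mkcond [leRHS]big_mkcond /=.
apply: ler_sum => o' _; case: ifP => [|_]; last by case: ifP.
rewrite /agree => /and5P[ax ay at_ au /andP[av aw]].
suff -> : [&& cx ==> (oX o' == oX o), cy ==> (oY o' == oY o),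
  ct ==> (oT o' == oT o), cu ==> (oU o' == oU o), cv ==> (oV o' == oV o)
  & cw ==> (oW o' == oW o)] by [].
by move: hx hy ht hu hv hw ax ay at_ au av aw;
  do ![move=> /implyP ?]; apply/and5P; split; [..|apply/andP; split];
  apply/implyP; auto.
Qed.

Lemma marg_gt0 bx bb bt bu bv bw o : 0 < q o -> 0 < marg bx bb bt bu bv bw o.
Proof.
move=> qo; apply: lt_le_trans qo _; rewrite -marg_all.
by apply: marg_mono; rewrite implybT.
Qed.

Lemma marg_eq0 bx bb bt bu bv bw cx cy ct cu cv cw o :
  marg cx cy ct cu cv cw o = 0 ->
  cx ==> bx -> cy ==> bb -> ct ==> bt -> cu ==> bu -> cv ==> bv -> cw ==> bw ->
  marg bx bb bt bu bv bw o = 0.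
Proof.
move=> m0 *; apply/eqP; rewrite eq_le marg_ge0 andbT -[leRHS]m0.
exact: marg_mono.
Qed.

Lemma sum_pred_fiber (Z J : finType) (f : J -> R) (P : Z -> pred J) (P0 : pred J)
    (c : J -> Z) : (forall z j, P z j = (c j == z) && P0 j) ->
  \sum_z \sum_(j | P z j) f j = \sum_(j | P0 j) f j.
Proof.
move=> PE; under eq_bigr do rewrite big_mkcond; rewrite exchange_big /=.
rewrite [RHS]big_mkcond; apply: eq_bigr => j _ /=.
rewrite (bigD1 (c j)) //= PE eqxx /= big1 ?addr0 // => z /negPf.
by rewrite PE eq_sym => ->.
Qed.

Lemma marg_sumX bb bt bu bv bw x y t u v w :
  \sum_x' marg true bb bt bu bv bw (x', y, t, u, v, w) =
  marg false bb bt bu bv bw (x, y, t, u, v, w).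
Proof. by apply: (@sum_pred_fiber _ _ q _ _ oX) => z o. Qed.

Lemma marg_sumY bx bt bu bv bw x y t u v w :
  \sum_y' marg bx true bt bu bv bw (x, y', t, u, v, w) =
  marg bx false bt bu bv bw (x, y, t, u, v, w).
Proof.
apply: (@sum_pred_fiber _ _ q _ _ oY) => z o.
by rewrite /agree /=; case: (_ == z); rewrite /= ?andbF.
Qed.

Lemma marg_sumT bx bb bu bv bw x y t u v w :
  \sum_t' marg bx bb true bu bv bw (x, y, t', u, v, w) =
  marg bx bb false bu bv bw (x, y, t, u, v, w).
Proof.
apply: (@sum_pred_fiber _ _ q _ _ oT) => z o.
by rewrite /agree /=; case: (_ == z); rewrite /= ?andbF.
Qed.

Lemma marg_sumU bx bb bt bv bw x y t u v w :
  \sum_u' marg bx bb bt true bv bw (x, y, t, u', v, w) =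
  marg bx bb bt false bv bw (x, y, t, u, v, w).
Proof.
apply: (@sum_pred_fiber _ _ q _ _ oU) => z o.
by rewrite /agree /=; case: (_ == z); rewrite /= ?andbF.
Qed.

Lemma marg_sumV bx bb bt bu bw x y t u v w :
  \sum_v' marg bx bb bt bu true bw (x, y, t, u, v', w) =
  marg bx bb bt bu false bw (x, y, t, u, v, w).
Proof.
apply: (@sum_pred_fiber _ _ q _ _ oV) => z o.
by rewrite /agree /=; case: (_ == z); rewrite /= ?andbF.
Qed.

Lemma marg_sumW bx bb bt bu bv x y t u v w :
  \sum_w' marg bx bb bt bu bv true (x, y, t, u, v, w') =
  marg bx bb bt bu bv false (x, y, t, u, v, w).
Proof.
apply: (@sum_pred_fiber _ _ q _ _ oW) => z o.
by rewrite /agree /=; case: (_ == z); rewrite /= ?andbF ?andbT.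
Qed.

Definition chain_TUXY : Prop := (forall o, m_xtu q o * m_u q o = m_tu q o * m_xu q o)
  /\ (forall o, m_xytu q o * m_x q o = m_xtu q o * m_xy q o).

Definition chain_VXTUYW : Prop :=
  (forall o, m_xytuv q o * m_xt q o = m_xtv q o * m_xytu q o)
  /\ (forall o, q o * m_yu q o = m_xytuv q o * m_yuw q o).

Hypotheses (cT : chain_TUXY) (cV : chain_VXTUYW).

(** The way to divide by a marginal that may vanish: where it does, the finer marginals in the
    identity vanish as well, by [marg_eq0]. *)
Lemma mulr_cancel_eq (c a b : R) : (c = 0 -> a = b) -> c * a = c * b -> a = b.
Proof.
move=> h; have [/h //|c0] := eqVneq c 0; exact: mulfI.
Qed.

Lemma marg_xyt o : m_xyt q o * m_x q o = m_xt q o * m_xy q o.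
Proof.
case: o => [[[[[x y] t] u] v] w].
rewrite -(marg_sumU true true true false false x y t u v w).
rewrite -(marg_sumU true false true false false x y t u v w) !mulr_suml.
apply: eq_bigr => u' _.
exact: ((cT).2 (x, y, t, u', v, w)).
Qed.

Lemma marg_xyu o : m_xyu q o * m_x q o = m_xu q o * m_xy q o.
Proof.
case: o => [[[[[x y] t] u] v] w].
rewrite -(marg_sumT true true true false false x y t u v w).
rewrite -(marg_sumT true false true false false x y t u v w) !mulr_suml.
apply: eq_bigr => t' _.
exact: ((cT).2 (x, y, t', u, v, w)).
Qed.

(** The links T - U - X and (T, U) - X - Y merge into T - U - (X, Y). *)
Lemma marg_xytu_u o : m_xytu q o * m_u q o = m_tu q o * m_xyu q o.
Proof.
apply: (@mulr_cancel_eq (m_x q o)) => [m0|].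
  have -> : m_xytu q o = 0 by exact: (marg_eq0 m0).
  have -> : m_xyu q o = 0 by exact: (marg_eq0 m0).
  by rewrite mul0r mulr0.
have := (cT).1 o; have := (cT).2 o; have := marg_xyu o => e1 e2 e3.
transitivity (m_xytu q o * m_x q o * m_u q o); first by ring.
rewrite e2; transitivity (m_xtu q o * m_u q o * m_xy q o); first by ring.
rewrite e3; transitivity (m_tu q o * (m_xu q o * m_xy q o)); first by ring.
by rewrite -e1; ring.
Qed.

Lemma marg_ytu_u o : m_ytu q o * m_u q o = m_tu q o * m_yu q o.
Proof.
case: o => [[[[[x y] t] u] v] w].
rewrite -(marg_sumX true true true false false x y t u v w).
rewrite -(marg_sumX true false true false false x y t u v w) mulr_suml mulr_sumr.
apply: eq_bigr => x' _.
exact: (marg_xytu_u (x', y, t, u, v, w)).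
Qed.

Lemma marg_xytu_yu o : m_xytu q o * m_yu q o = m_xyu q o * m_ytu q o.
Proof.
apply: (@mulr_cancel_eq (m_u q o)) => [m0|].
  have -> : m_xytu q o = 0 by exact: (marg_eq0 m0).
  have -> : m_xyu q o = 0 by exact: (marg_eq0 m0).
  by rewrite !mul0r.
have := marg_xytu_u o; have := marg_ytu_u o => e1 e2.
transitivity (m_xytu q o * m_u q o * m_yu q o); first by ring.
rewrite e2; transitivity (m_xyu q o * (m_tu q o * m_yu q o)); first by ring.
by rewrite -e1; ring.
Qed.

Lemma marg_xytuw o : m_xytuw q o * m_yu q o = m_xytu q o * m_yuw q o.
Proof.
case: o => [[[[[x y] t] u] v] w].
rewrite -(marg_sumV true true true true true x y t u v w).
rewrite -(marg_sumV true true true true false x y t u v w) !mulr_suml.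
apply: eq_bigr => v' _; rewrite marg_all.
exact: ((cV).2 (x, y, t, u, v', w)).
Qed.

(** Given (X, T), V is independent of (Y, U, W). This is derived with all coordinates present, by
    merging the two links of the second chain; the flags record which of y, u, w have since been
    summed out. *)
Lemma marg_xtv_cond bb bu bw o :
  marg true bb true bu true bw o * m_xt q o = m_xtv q o * marg true bb true bu false bw o.
Proof.
have full o' : q o' * m_xt q o' = m_xtv q o' * marg true true true true false true o'.
  apply: (@mulr_cancel_eq (m_yu q o')) => [m0|].
    rewrite -marg_all.
    have -> : marg true true true true true true o' = 0 by exact: (marg_eq0 m0).
    have -> : marg true true true true false true o' = 0 by exact: (marg_eq0 m0).
    by rewrite mul0r mulr0.
  have := (cV).1 o'; have := (cV).2 o'; have := marg_xytuw o' => e1 e2 e3.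
  transitivity (q o' * m_yu q o' * m_xt q o'); first by ring.
  rewrite e2; transitivity (m_xytuv q o' * m_xt q o' * m_yuw q o'); first by ring.
  rewrite e3; transitivity (m_xtv q o' * (m_xytu q o' * m_yuw q o')); first by ring.
  by rewrite -e1; ring.
have stepW o' : marg true true true true true bw o' * m_xt q o' =
    m_xtv q o' * marg true true true true false bw o'.
  case: bw; first by rewrite marg_all.
  case: o' => [[[[[x y] t] u] v] w].
  rewrite -(marg_sumW true true true true true x y t u v w).
  rewrite -(marg_sumW true true true true false x y t u v w) mulr_suml mulr_sumr.
  by apply: eq_bigr => w' _; rewrite marg_all; exact: (full (x, y, t, u, v, w')).
have stepU o' : marg true true true bu true bw o' * m_xt q o' =
    m_xtv q o' * marg true true true bu false bw o'.
  case: bu => //; case: o' => [[[[[x y] t] u] v] w].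
  rewrite -(marg_sumU true true true true bw x y t u v w).
  rewrite -(marg_sumU true true true false bw x y t u v w) mulr_suml mulr_sumr.
  by apply: eq_bigr => u' _; exact: (stepW (x, y, t, u', v, w)).
case: bb => //; case: o => [[[[[x y] t] u] v] w].
rewrite -(marg_sumY true true bu true bw x y t u v w).
rewrite -(marg_sumY true true bu false bw x y t u v w) mulr_suml mulr_sumr.
by apply: eq_bigr => y' _; exact: (stepU (x, y', t, u, v, w)).
Qed.

Lemma marg_ytuvw_yu o : m_ytuvw q o * m_yu q o = m_ytuv q o * m_yuw q o.
Proof.
case: o => [[[[[x y] t] u] v] w]; rewrite -(marg_sumX true true true true true x y t u v w).
rewrite -(marg_sumX true true true true false x y t u v w) !mulr_suml.
apply: eq_bigr => x' _; rewrite marg_all.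
exact: ((cV).2 (x', y, t, u, v, w)).
Qed.

Lemma marg_ytuw_yu o : m_ytuw q o * m_yu q o = m_ytu q o * m_yuw q o.
Proof.
case: o => [[[[[x y] t] u] v] w].
rewrite -(marg_sumV false true true true true x y t u v w).
rewrite -(marg_sumV false true true true false x y t u v w) !mulr_suml.
by apply: eq_bigr => v' _; exact: (marg_ytuvw_yu (x, y, t, u, v', w)).
Qed.

End Marginals.

(** * Information densities *)

Section Information.
Variables (R : realFieldType) (lg : R -> R) (lc : R).
Hypothesis lgM : forall a b, 0 < a -> 0 < b -> lg (a * b) = lg a + lg b.
Hypotheses (lc0 : 0 <= lc) (lg_ge : forall a, 0 < a -> lc * (1 - a^-1) <= lg a).

Lemma lgV (a : R) : 0 < a -> lg a^-1 = - lg a.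
Proof.
move=> a0; have lg1 : lg 1 = 0.
  by have := lgM ltr01 ltr01; rewrite mulr1 => h; rewrite -(subrr (lg 1)) {2}h addrK.
have : lg (a^-1 * a) = lg a^-1 + lg a by rewrite lgM ?invr_gt0.
rewrite mulVf ?gt_eqF // lg1 => h; apply/eqP; by rewrite -addr_eq0 -h.
Qed.

Lemma lg_rel (a b c d : R) : 0 < a -> 0 < b -> 0 < c -> 0 < d ->
  a * b = c * d -> lg a + lg b = lg c + lg d.
Proof. by move=> *; rewrite -!lgM //; congr lg. Qed.

Section Keys.
Variables (Om : finType) (P : Om -> R).
Hypothesis P0 : forall o, 0 <= P o.

Definition pk (K : finType) (A : Om -> K) a : R := \sum_(o | A o == a) P o.

Lemma pk_ge0 (K : finType) (A : Om -> K) a : 0 <= pk A a.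
Proof. exact: sumr_ge0. Qed.

Lemma pk_gt0 (K : finType) (A : Om -> K) o : 0 < P o -> 0 < pk A (A o).
Proof.
move=> Po; rewrite /pk (bigD1 o) //=; apply: ltr_wpDr => //; exact: sumr_ge0.
Qed.

Lemma avg_key (K : finType) (A : Om -> K) (f : K -> R) :
  avg P (fun o => f (A o)) = \sum_a pk A a * f a.
Proof.
rewrite /avg (partition_big A xpredT) //=; apply: eq_bigr => a _.
by rewrite mulr_suml; apply: eq_bigr => o /eqP->.
Qed.

Lemma sum_pk (K : finType) (A : Om -> K) : \sum_a pk A a = \sum_o P o.
Proof. by rewrite [RHS](partition_big A xpredT). Qed.

Lemma sum_pk_pair (K K' : finType) (A : Om -> K) (B : Om -> K') b :
  \sum_a pk (fun o => (A o, B o)) (a, b) = pk B b.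
Proof.
rewrite /pk [RHS](partition_big A xpredT) //=; apply: eq_bigr => a _.
by apply: eq_bigl => o; rewrite xpair_eqE andbC.
Qed.

(** Nonnegativity of relative entropy, from [lg_ge] applied to each likelihood ratio. Only the total
    masses are compared, so it also holds for the restriction of a law to [T = t]. *)
Lemma gibbs (K : finType) (A : Om -> K) (N : K -> R) :
  (forall a, 0 <= N a) -> (forall o, 0 < P o -> 0 < N (A o)) ->
  \sum_a N a <= \sum_o P o ->
  0 <= avg P (fun o => lg (pk A (A o) / N (A o))).
Proof.
move=> N0 NA sN.
apply: (@le_trans _ _ (avg P (fun o => lc * (1 - N (A o) / pk A (A o))))).
  rewrite avgZ mulr_ge0 // (avg_key A (fun a => 1 - N a / pk A a)).
  under eq_bigr do rewrite mulrBr mulr1.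
  rewrite sumrB sum_pk subr_ge0; apply: le_trans sN; apply: ler_sum => a _.
  have [->|n0] := eqVneq (pk A a) 0; first by rewrite mul0r.
  by rewrite mulrCA mulfV // mulr1.
apply: ler_avg_supp => // o Po.
have {}Po : 0 < P o by rewrite lt_neqAle P0 eq_sym Po.
by rewrite -[X in 1 - X]invf_div; apply: lg_ge; rewrite divr_gt0 ?NA ?pk_gt0.
Qed.

Variables (KA KB KC : finType) (A : Om -> KA) (B : Om -> KB) (C : Om -> KC).

Definition dens o : R := lg (pk (fun o => (A o, B o, C o)) (A o, B o, C o))
  + lg (pk C (C o)) - lg (pk (fun o => (A o, C o)) (A o, C o))
  - lg (pk (fun o => (B o, C o)) (B o, C o)).

Definition cmi : R := \sum_(k : KA * KB * KC)
  let pabc := pk (fun o => (A o, B o, C o)) k in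
  if 0 < pabc then pabc * lg (pabc * pk C k.2
    / (pk (fun o => (A o, C o)) (k.1.1, k.2) * pk (fun o => (B o, C o)) (k.1.2, k.2)))
  else 0.

Lemma dens_lg o : 0 < P o ->
  lg (pk (fun o => (A o, B o, C o)) (A o, B o, C o) * pk C (C o)
    / (pk (fun o => (A o, C o)) (A o, C o) * pk (fun o => (B o, C o)) (B o, C o)))
  = dens o.
Proof.
move=> Po.
have h1 : 0 < pk (fun o => (A o, B o, C o)) (A o, B o, C o).
  exact: (pk_gt0 (fun o => (A o, B o, C o)) Po).
have h2 : 0 < pk C (C o) by exact: pk_gt0.
have h3 : 0 < pk (fun o => (A o, C o)) (A o, C o).
  exact: (pk_gt0 (fun o => (A o, C o)) Po).
have h4 : 0 < pk (fun o => (B o, C o)) (B o, C o).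
  exact: (pk_gt0 (fun o => (B o, C o)) Po).
rewrite lgM ?invr_gt0 ?mulr_gt0 // lgM // lgV ?mulr_gt0 // lgM // /dens.
ring.
Qed.

Lemma cmiE : cmi = avg P dens.
Proof.
pose f (k : KA * KB * KC) := lg (pk (fun o => (A o, B o, C o)) k * pk C k.2
    / (pk (fun o => (A o, C o)) (k.1.1, k.2) * pk (fun o => (B o, C o)) (k.1.2, k.2))).
transitivity (avg P (fun o => f (A o, B o, C o))).
  rewrite (avg_key (fun o => (A o, B o, C o)) f); apply: eq_bigr => k _ /=.
  case: ltP => // le0; have -> : pk (fun o => (A o, B o, C o)) k = 0.
    by apply/eqP; rewrite eq_le le0 pk_ge0.
  by rewrite mul0r.
apply: eq_bigr => o _; have [->|Po] := eqVneq (P o) 0; first by rewrite !mul0r.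
by congr (_ * _); apply: dens_lg; rewrite lt_neqAle P0 eq_sym Po.
Qed.

Lemma avg_dens_ge0 : 0 <= avg P dens.
Proof.
(* The law with the same (A, C) and (B, C) marginals under which A and B are independent given C. *)
pose N (k : KA * KB * KC) := pk (fun o => (A o, C o)) (k.1.1, k.2)
  * pk (fun o => (B o, C o)) (k.1.2, k.2) / pk C k.2.
have N0 k : 0 <= N k by rewrite divr_ge0 ?mulr_ge0 ?pk_ge0.
have NA o : 0 < P o -> 0 < N (A o, B o, C o).
  move=> Po; rewrite /N /= divr_gt0 ?pk_gt0 ?mulr_gt0 //.
    exact: (pk_gt0 (fun o => (A o, C o)) Po).
  exact: (pk_gt0 (fun o => (B o, C o)) Po).
have sN : \sum_k N k <= \sum_o P o.
  rewrite -(sum_pk C) !sum_pairE exchange_big /=.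
  under eq_bigr do rewrite exchange_big /=.
  rewrite exchange_big /=; apply: ler_sum => c _; rewrite /N /=.
  under eq_bigr do rewrite -mulr_suml -mulr_suml sum_pk_pair.
  rewrite -mulr_suml -mulr_sumr sum_pk_pair.
  have [->|n0] := eqVneq (pk C c) 0; first by rewrite !mul0r.
  by rewrite mulfK.
have := gibbs N0 NA sN; congr (_ <= _); apply: eq_bigr => o _.
have [->|Po] := eqVneq (P o) 0; first by rewrite !mul0r.
have {}Po : 0 < P o by rewrite lt_neqAle P0 eq_sym Po.
rewrite -dens_lg //; congr (_ * lg _).
by rewrite /N /= invf_div mulrA.
Qed.

End Keys.
End Information.

(** * Densities of the four rate bounds *)

Section Densities.
Variables (R : realFieldType) (lg : R -> R) (lc : R).
Hypothesis lgM : forall a b, 0 < a -> 0 < b -> lg (a * b) = lg a + lg b.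
Hypotheses (lc0 : 0 <= lc) (lg_ge : forall a, 0 < a -> lc * (1 - a^-1) <= lg a).
Variables (X Y T U V W : finType).
Local Notation Om := (X * Y * T * U * V * W)%type.
Local Notation oX := (@oX X Y T U V W).
Local Notation oY := (@oY X Y T U V W).
Local Notation oT := (@oT X Y T U V W).
Local Notation oU := (@oU X Y T U V W).
Local Notation oV := (@oV X Y T U V W).
Local Notation oW := (@oW X Y T U V W).
Variable q : Om -> R.
Hypothesis q0 : forall o, 0 <= q o.
Hypothesis q1 : \sum_o q o = 1.
Local Notation marg := (marg_of q).
Implicit Type o : Om.

(** Information densities spelled out in log-marginals: on the support each Markov relation becomes
    a linear equation between them, and identities between rates become linear arithmetic. *)
Definition info_U o := lg (m_xyu q o) + lg (m_y q o) - lg (m_xy q o) - lg (m_yu q o).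
Definition info_V o := lg (m_xtvw q o) + lg (m_tw q o) - lg (m_tvw q o) - lg (m_xtw q o).
Definition info_W o := lg (m_ytuvw q o) + lg (m_tv q o) - lg (m_ytuv q o) - lg (m_tvw q o).
Definition info_sum o := lg (m_xytvw q o) - lg (m_xy q o) - lg (m_tvw q o)
  + (lg (q o) + lg (m_xytv q o) - lg (m_xytuv q o) - lg (m_xytvw q o)).

Lemma lg_one : lg 1 = 0.
Proof.
by have := lgM ltr01 ltr01; rewrite mulr1 => h; rewrite -(subrr (lg 1)) {2}h addrK.
Qed.

Lemma cmi_info_U : cmi lg q oX oU oY = avg q info_U.
Proof.
rewrite cmiE //; apply: eq_bigr => o _; congr (_ * _); rewrite /dens /info_U.
congr (lg _ + lg _ - lg _ - lg _); apply: eq_bigl => o';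
  by rewrite /agree ?xpair_eqE ?eqxx /=; do !case: (_ == _).
Qed.

Lemma cmi_info_V : cmi lg q oV oX (fun o => (oT o, oW o)) = avg q info_V.
Proof.
rewrite cmiE //; apply: eq_bigr => o _; congr (_ * _); rewrite /dens /info_V.
congr (lg _ + lg _ - lg _ - lg _); apply: eq_bigl => o';
  by rewrite /agree ?xpair_eqE ?eqxx /=; do !case: (_ == _).
Qed.

Lemma cmi_info_W :
  cmi lg q (fun o => (oU o, oY o)) oW (fun o => (oV o, oT o)) = avg q info_W.
Proof.
rewrite cmiE //; apply: eq_bigr => o _; congr (_ * _); rewrite /dens /info_W.
congr (lg _ + lg _ - lg _ - lg _); apply: eq_bigl => o';
  by rewrite /agree ?xpair_eqE ?eqxx /=; do !case: (_ == _).
Qed.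

Lemma cmi_info_sum : cmi lg q (fun o => (oX o, oY o)) (fun o => (oV o, oT o, oW o))
    (fun=> tt) + cmi lg q oU oW (fun o => (oV o, oX o, oT o, oY o)) = avg q info_sum.
Proof.
rewrite !cmiE // -avgD; apply: eq_bigr => o _; congr (_ * _); rewrite /info_sum.
congr (_ + _); rewrite /dens.
  have -> : pk q (fun=> tt) tt = 1 by rewrite -q1; apply: eq_bigl.
  rewrite lg_one addr0; congr (lg _ - lg _ - lg _); apply: eq_bigl => o';
    by rewrite /agree ?xpair_eqE ?eqxx /=; do !case: (_ == _).
rewrite -(marg_all q o).
congr (lg _ + lg _ - lg _ - lg _); apply: eq_bigl => o';
  by rewrite /agree ?xpair_eqE ?eqxx /=; do !case: (_ == _).
Qed.

Hypotheses (cT : chain_TUXY q) (cV : chain_VXTUYW q).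

Section Support.
Variable o : Om.
Hypothesis qo : 0 < q o.
Let g bx bb bt bu bv bw := marg_gt0 q0 bx bb bt bu bv bw qo.

(** X and T are independent given (U, Y), whence I(X;U|Y) = I(X;T,U|Y). In this form t accompanies u
    everywhere, as needed both for decoding (t, u) and for reweighting T. *)
Lemma info_U_T : info_U o = lg (m_xytu q o) + lg (m_y q o) - lg (m_xy q o) - lg (m_ytu q o).
Proof.
have := lg_rel lgM (g _ _ _ _ _ _) (g _ _ _ _ _ _) (g _ _ _ _ _ _) (g _ _ _ _ _ _)
  (marg_xytu_yu q0 cT o).
rewrite /info_U; lra.
Qed.

(** On average: H(T,U|Y) - H(T|X) - H(U|X,T), a Slepian-Wolf rate minus the entropies that the
    shared indices can absorb. The next three lemmas have the same shape, namely H(V|T,W) -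
    H(V|X,T), H(W|T,V) - H(W|U,Y) and H(T,V,W) - H(T|X) - H(V|X,T) - H(W|U,Y). *)
Lemma info_U_kernels : info_U o = (lg (m_xt q o) - lg (m_x q o))
  + (lg (m_xtu q o) - lg (m_xt q o)) - (lg (m_ytu q o) - lg (m_y q o)).
Proof.
have := lg_rel lgM (g _ _ _ _ _ _) (g _ _ _ _ _ _) (g _ _ _ _ _ _) (g _ _ _ _ _ _)
  ((cT).2 o).
rewrite info_U_T; lra.
Qed.

Lemma info_V_kernels : info_V o =
  (lg (m_xtv q o) - lg (m_xt q o)) - (lg (m_tvw q o) - lg (m_tw q o)).
Proof.
have := lg_rel lgM (g _ _ _ _ _ _) (g _ _ _ _ _ _) (g _ _ _ _ _ _) (g _ _ _ _ _ _)
  (marg_xtv_cond q0 cV false false true o).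
rewrite /info_V; lra.
Qed.

Lemma info_W_kernels : info_W o =
  (lg (m_yuw q o) - lg (m_yu q o)) - (lg (m_tvw q o) - lg (m_tv q o)).
Proof.
have := lg_rel lgM (g _ _ _ _ _ _) (g _ _ _ _ _ _) (g _ _ _ _ _ _) (g _ _ _ _ _ _)
  (marg_ytuvw_yu cV o).
rewrite /info_W; lra.
Qed.

Lemma info_sum_kernels : info_sum o =
  (lg (m_xt q o) - lg (m_x q o)) + (lg (m_xtv q o) - lg (m_xt q o))
  + (lg (m_yuw q o) - lg (m_yu q o)) - lg (m_tvw q o).
Proof.
have := lg_rel lgM qo (g _ _ _ _ _ _) (g _ _ _ _ _ _) (g _ _ _ _ _ _) ((cV).2 o).
have := lg_rel lgM (g _ _ _ _ _ _) (g _ _ _ _ _ _) (g _ _ _ _ _ _) (g _ _ _ _ _ _)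
  (marg_xtv_cond q0 cV true false false o).
have := lg_rel lgM (g _ _ _ _ _ _) (g _ _ _ _ _ _) (g _ _ _ _ _ _) (g _ _ _ _ _ _)
  (marg_xyt cT o).
rewrite /info_sum; lra.
Qed.

Lemma l_xt_given_y : lg (m_xt q o) - lg (m_x q o) = lg (m_xyt q o) - lg (m_xy q o).
Proof.
have := lg_rel lgM (g _ _ _ _ _ _) (g _ _ _ _ _ _) (g _ _ _ _ _ _) (g _ _ _ _ _ _)
  (marg_xyt cT o).
lra.
Qed.

End Support.

(** This is I(X;T|Y), rewritten by T - X - Y so that only the kernel of t given x appears. *)
Lemma avg_XT_given_Y_ge0 :
  0 <= avg q (fun o => (lg (m_xt q o) - lg (m_x q o)) - (lg (m_yt q o) - lg (m_y q o))).
Proof.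
have := avg_dens_ge0 lgM lc0 lg_ge q0 oX oT oY; congr (_ <= _).
apply: eq_bigr => o _; have [->|qo] := eqVneq (q o) 0; first by rewrite !mul0r.
congr (_ * _); rewrite l_xt_given_y ?lt_neqAle ?q0 1?eq_sym ?qo // /dens.
have -> : pk q (fun o => (oX o, oT o, oY o)) (oX o, oT o, oY o) = m_xyt q o.
  by apply: eq_bigl => o'; rewrite /agree ?xpair_eqE ?eqxx /=; do !case: (_ == _).
have -> : pk q oY (oY o) = m_y q o.
  by apply: eq_bigl => o'; rewrite /agree /=; do !case: (_ == _).
have -> : pk q (fun o => (oX o, oY o)) (oX o, oY o) = m_xy q o.
  by apply: eq_bigl => o'; rewrite /agree ?xpair_eqE ?eqxx /=; do !case: (_ == _).
have -> : pk q (fun o => (oT o, oY o)) (oT o, oY o) = m_yt q o.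
  by apply: eq_bigl => o'; rewrite /agree ?xpair_eqE ?eqxx /=; do !case: (_ == _).
ring.
Qed.

(** The probability of [T = t] times the divergence of the law of X given t from the law of X. The
    sum over t is I(X;T), but the corner points need the inequality for each t separately. *)
Lemma avg_X_given_t_ge0 (t : T) :
  0 <= avg (fun o => if oT o == t then q o else 0)
           (fun o => lg (m_xt q o) - lg (m_x q o) - lg (m_t q o)).
Proof.
set P := fun o => _.
have P0 o : 0 <= P o by rewrite /P; case: ifP.
pose N x := pk q oX x * pk q oT t.
have sN : \sum_x N x <= \sum_o P o.
  by rewrite /N -mulr_suml sum_pk q1 mul1r /pk [leLHS]big_mkcond.
have N0 x : 0 <= N x by rewrite mulr_ge0 // pk_ge0.
have NE o : oT o = t -> N (oX o) = m_x q o * m_t q o.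
  move=> ot; rewrite /N -ot; congr (_ * _); apply: eq_bigl => o';
    by rewrite /agree /=; do !case: (_ == _).
have NA o : 0 < P o -> 0 < N (oX o).
  rewrite /P; case: eqP => [ot qo|]; last by rewrite ltxx.
  by rewrite NE // mulr_gt0 ?marg_gt0.
have := gibbs lc0 lg_ge P0 N0 NA sN; congr (_ <= _); apply: eq_bigr => o _; rewrite /P.
case: eqP => [ot|]; last by rewrite !mul0r.
have [->|qo] := eqVneq (q o) 0; first by rewrite !mul0r.
have {}qo : 0 < q o by rewrite lt_neqAle q0 eq_sym qo.
congr (_ * _); rewrite NE //.
have -> : pk (fun o => if oT o == t then q o else 0) oX (oX o) = m_xt q o.
  rewrite /pk -big_mkcondr /=; apply: eq_bigl => o'.
  by rewrite /agree /= ot; do !case: (_ == _).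
rewrite lgM ?invr_gt0 ?mulr_gt0 ?marg_gt0 // (lgV lgM) ?mulr_gt0 ?marg_gt0 //.
rewrite lgM ?marg_gt0 //; ring.
Qed.

Lemma avg_VW_given_t_ge0 (t : T) :
  0 <= avg (fun o => if oT o == t then q o else 0)
           (fun o => lg (m_tvw q o) + lg (m_t q o) - lg (m_tv q o) - lg (m_tw q o)).
Proof.
set P := fun o => _.
have P0 o : 0 <= P o by rewrite /P; case: ifP.
have := avg_dens_ge0 lgM lc0 lg_ge P0 oV oW oT; congr (_ <= _).
apply: eq_bigr => o _; rewrite {1 3}/P; case: eqP => [ot|]; last by rewrite !mul0r.
congr (_ * _); rewrite /dens /pk /P -!big_mkcondr /=.
congr (lg _ + lg _ - lg _ - lg _); apply: eq_bigl => o';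
  by rewrite /agree ?xpair_eqE ?eqxx /= ot; do !case: (_ == _).
Qed.

End Densities.

(** * Single-letter coding data *)

Lemma avgB (R : realFieldType) (I : finType) (w F G : I -> R) :
  avg w (fun i => F i - G i) = avg w F - avg w G.
Proof. by rewrite /avg -sumrB; apply: eq_bigr => i _; rewrite mulrBr. Qed.

Section SafeKernel.
Variables (R : realFieldType) (A : finType) (num : A -> R) (a0 : A).

Definition ker_of (den : R) a : R := if den == 0 then (a == a0)%:R else num a / den.

Lemma ker_of_pmf den : (forall a, 0 <= num a) -> \sum_a num a = den -> pmf (ker_of den).
Proof.
move=> n0 nd; rewrite /ker_of; case: eqP => [_|/eqP d0]; split=> [a|].
- by rewrite ler0n.
- rewrite (bigD1 a0) //= eqxx big1 ?addr0 // => a /negPf->; by [].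
- by rewrite divr_ge0 // -nd sumr_ge0.
by rewrite -mulr_suml nd mulfV.
Qed.

Lemma ker_ofE den a : 0 < den -> ker_of den a = num a / den.
Proof. by move=> d0; rewrite /ker_of gt_eqF. Qed.

End SafeKernel.

Section CodingData.
Variables (R : realFieldType) (lg : R -> R) (lc : R).
Hypothesis lgM : forall a b, 0 < a -> 0 < b -> lg (a * b) = lg a + lg b.
Hypothesis lg_lt : forall a b, 0 < a -> a < b -> lg a < lg b.
Hypotheses (lc0 : 0 <= lc) (lg_ge : forall a, 0 < a -> lc * (1 - a^-1) <= lg a).
Variables (X Y T U V W : finType).
Local Notation Om := (X * Y * T * U * V * W)%type.
Local Notation oX := (@oX X Y T U V W).
Local Notation oY := (@oY X Y T U V W).
Local Notation oT := (@oT X Y T U V W).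
Local Notation oU := (@oU X Y T U V W).
Local Notation oV := (@oV X Y T U V W).
Local Notation oW := (@oW X Y T U V W).
Variable q : Om -> R.
Hypothesis q0 : forall o, 0 <= q o.
Hypothesis q1 : \sum_o q o = 1.
Local Notation marg := (marg_of q).
Implicit Type o : Om.
Hypotheses (cT : chain_TUXY q) (cV : chain_VXTUYW q).
Variables (x0 : X) (y0 : Y) (t0 : T) (u0 : U) (v0 : V) (w0 : W).

(** The base points [x0], ..., [w0] fill the coordinates that a marginal ignores. *)
Definition pXY (z : X * Y) : R := m_xy q (z.1, z.2, t0, u0, v0, w0).
Let kT x := ker_of (fun t => m_xt q (x, y0, t, u0, v0, w0)) t0
  (m_x q (x, y0, t0, u0, v0, w0)).
Let kU (c : X * T) := ker_of (fun u => m_xtu q (c.1, y0, c.2, u, v0, w0)) u0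
  (m_xt q (c.1, y0, c.2, u0, v0, w0)).
Let kV (c : X * T) := ker_of (fun v => m_xtv q (c.1, y0, c.2, u0, v, w0)) v0
  (m_xt q (c.1, y0, c.2, u0, v0, w0)).
Let kW (c : T * U * Y) := ker_of (fun w => m_yuw q (x0, c.2, t0, c.1.2, v0, w)) w0
  (m_yu q (x0, c.2, t0, c.1.2, v0, w0)).
(** The scores are the probabilities of (t, u) given y, u given (t, y), (t, v, w), v given (t, w), w
    given (t, v), and (v, w) given t: the symbols that are wrong, conditioned on what the decoder
    has right, one score per collision event. *)
Let s1 y (a : T * U) := m_ytu q (x0, y, a.1, a.2, v0, w0)
  / m_y q (x0, y, a.1, a.2, v0, w0).
Let s2 y (a : T * U) := m_ytu q (x0, y, a.1, a.2, v0, w0)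
  / m_yt q (x0, y, a.1, a.2, v0, w0).
Let s3 (a : T * V * W) := m_tvw q (x0, y0, a.1.1, u0, a.1.2, a.2).
Let s4 (a : T * V * W) := m_tvw q (x0, y0, a.1.1, u0, a.1.2, a.2)
  / m_tw q (x0, y0, a.1.1, u0, a.1.2, a.2).
Let s5 (a : T * V * W) := m_tvw q (x0, y0, a.1.1, u0, a.1.2, a.2)
  / m_tv q (x0, y0, a.1.1, u0, a.1.2, a.2).
Let s6 (a : T * V * W) := m_tvw q (x0, y0, a.1.1, u0, a.1.2, a.2)
  / m_t q (x0, y0, a.1.1, u0, a.1.2, a.2).

Lemma pXY_pmf : pmf pXY.
Proof.
split=> [z|]; first exact: marg_ge0.
rewrite sum_pairE /pXY /=.
under eq_bigr => x _ do rewrite (marg_sumY q true false false false false x y0).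
by rewrite (marg_sumX q false false false false false x0) marg_none.
Qed.

Let kTp x : pmf (kT x).
Proof.
by apply: ker_of_pmf => [t|]; [exact: marg_ge0|exact: marg_sumT].
Qed.

Let kUp c : pmf (kU c).
Proof.
by apply: ker_of_pmf => [u|]; [exact: marg_ge0|exact: marg_sumU].
Qed.

Let kVp c : pmf (kV c).
Proof.
by apply: ker_of_pmf => [v|]; [exact: marg_ge0|exact: marg_sumV].
Qed.

Let kWp c : pmf (kW c).
Proof.
by apply: ker_of_pmf => [w|]; [exact: marg_ge0|exact: marg_sumW].
Qed.

Let kernelsE o : 0 < q o -> [/\ kT (oX o) (oT o) = m_xt q o / m_x q o,
  kU (oX o, oT o) (oU o) = m_xtu q o / m_xt q o,
  kV (oX o, oT o) (oV o) = m_xtv q o / m_xt q o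
  & kW (oT o, oU o, oY o) (oW o) = m_yuw q o / m_yu q o].
Proof.
case: o => [[[[[x y] t] u] v] w] qo.
have g bx bb bt bu bv bw := marg_gt0 q0 bx bb bt bu bv bw qo.
split; apply: ker_ofE.
- exact: (g true false false false false false).
- exact: (g true false true false false false).
- exact: (g true false true false false false).
exact: (g false true false true false false).
Qed.

(* The two sides agree where [q] is positive and both sum to one, so they agree
   everywhere: no case analysis on vanishing conditional masses is needed. *)
Let law_q o : law pXY kT kU kV kW o = q o.
Proof.
have le_law o' : q o' <= law pXY kT kU kV kW o'.
  have [qo|qo] := eqVneq (q o') 0.
    by rewrite qo; have [] := law_pmf pXY_pmf kTp kUp kVp kWp.
  have {}qo : 0 < q o' by rewrite lt_neqAle q0 eq_sym qo.
  have [eT eU eV eW] := kernelsE qo.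
  rewrite /law eT eU eV eW.
  have g bx bb bt bu bv bw := marg_gt0 q0 bx bb bt bu bv bw qo.
  have gx := g true false false false false false.
  have gxt := g true false true false false false.
  have gyu := g false true false true false false.
  have e1 : m_xytu q o' = m_xtu q o' * m_xy q o' / m_x q o'.
    by rewrite -(cT).2 mulfK // gt_eqF.
  have e2 : m_xytuv q o' = m_xtv q o' * m_xytu q o' / m_xt q o'.
    by rewrite -(cV).1 mulfK // gt_eqF.
  have -> : q o' = m_xytuv q o' * m_yuw q o' / m_yu q o'.
    by rewrite -(cV).2 mulfK // gt_eqF.
  rewrite e2 e1 le_eqVlt; apply/orP; left; apply/eqP.
  have -> : pXY (o'.1.1.1.1.1, o'.1.1.1.1.2) = m_xy q o' by [].
  by field; rewrite !gt_eqF.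
apply/esym/eqP; rewrite -subr_eq0 -oppr_eq0 opprB; apply/eqP.
have lawp := law_pmf pXY_pmf kTp kUp kVp kWp.
have : \sum_o (law pXY kT kU kV kW o - q o) = 0 by rewrite sumrB q1 lawp.2 subrr.
move=> /eqP; rewrite psumr_eq0 => [/allP/(_ o)|o' _]; last by rewrite subr_ge0.
by rewrite mem_index_enum => /(_ isT)/eqP.
Qed.

Let sum_div_le1 (A : finType) (num : A -> R) den : \sum_a num a = den ->
  \sum_a num a / den <= 1.
Proof.
move=> nd; rewrite -mulr_suml nd.
by have [->|d0] := eqVneq den 0; [rewrite mul0r ler01|rewrite mulfV].
Qed.

(** Negated conditional entropies: [muT], [muU], [muV], [muW] belong to the kernels, [mu1] to [mu6]
    to the six scores. *)
Definition muT := avg q (fun o => lg (m_xt q o) - lg (m_x q o)).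
Definition muU := avg q (fun o => lg (m_xtu q o) - lg (m_xt q o)).
Definition muV := avg q (fun o => lg (m_xtv q o) - lg (m_xt q o)).
Definition muW := avg q (fun o => lg (m_yuw q o) - lg (m_yu q o)).
Definition mu1 := avg q (fun o => lg (m_ytu q o) - lg (m_y q o)).
Definition mu2 := avg q (fun o => lg (m_ytu q o) - lg (m_yt q o)).
Definition mu3 := avg q (fun o => lg (m_tvw q o)).
Definition mu4 := avg q (fun o => lg (m_tvw q o) - lg (m_tw q o)).
Definition mu5 := avg q (fun o => lg (m_tvw q o) - lg (m_tv q o)).
Definition mu6 := avg q (fun o => lg (m_tvw q o) - lg (m_t q o)).

Lemma eq_avg_supp (F G : Om -> R) : (forall o, 0 < q o -> F o = G o) ->
  avg q F = avg q G.
Proof.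
move=> FG; apply: eq_bigr => o _.
have [->|qo] := eqVneq (q o) 0; first by rewrite !mul0r.
by rewrite FG // lt_neqAle q0 eq_sym qo.
Qed.

Lemma avg_info_U : avg q (info_U lg q) = muT + muU - mu1.
Proof.
rewrite /muT /muU /mu1 -avgD -avgB; apply: eq_avg_supp => o qo.
by rewrite (info_U_kernels lgM q0 cT qo); ring.
Qed.

(** The right t with a wrong u at transmitter Y requires only I(X;U|T,Y); the slack is I(X;T|Y). *)
Lemma avg_info_U_ge : muU - mu2 <= avg q (info_U lg q).
Proof.
have := avg_XT_given_Y_ge0 lgM lc0 lg_ge q0 cT.
suff -> : avg q (info_U lg q) = muU - mu2
    + avg q (fun o => (lg (m_xt q o) - lg (m_x q o))
                      - (lg (m_yt q o) - lg (m_y q o))) by lra.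
rewrite /muU /mu2 -avgB -avgD; apply: eq_avg_supp => o qo.
by rewrite (info_U_kernels lgM q0 cT qo); ring.
Qed.

Lemma avg_info_V : avg q (info_V lg q) = muV - mu4.
Proof.
rewrite /muV /mu4 -avgB; apply: eq_avg_supp => o qo.
by rewrite (info_V_kernels lgM q0 cV qo); ring.
Qed.

Lemma avg_info_W : avg q (info_W lg q) = muW - mu5.
Proof.
rewrite /muW /mu5 -avgB; apply: eq_avg_supp => o qo.
by rewrite (info_W_kernels lgM q0 cV qo); ring.
Qed.

Lemma avg_info_sum : avg q (info_sum lg q) = muT + muV + muW - mu3.
Proof.
rewrite /muT /muV /muW /mu3 -!avgD -avgB; apply: eq_avg_supp => o qo.
by rewrite (info_sum_kernels lgM q0 cT cV qo); ring.
Qed.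

(** The right t with v and w both wrong; compared with a wrong t, the slack is I(X;T). *)
Lemma avg_info_sum_ge : muV + muW - mu6 <= avg q (info_sum lg q).
Proof.
have h : 0 <= avg q (fun o => lg (m_xt q o) - lg (m_x q o) - lg (m_t q o)).
  have -> : avg q (fun o => lg (m_xt q o) - lg (m_x q o) - lg (m_t q o)) = \sum_t
      avg (fun o => if oT o == t then q o else 0)
          (fun o => lg (m_xt q o) - lg (m_x q o) - lg (m_t q o)).
    rewrite /avg (partition_big oT xpredT) //=; apply: eq_bigr => t _.
    rewrite big_mkcond; apply: eq_bigr => o _ /=; case: ifP => //.
    by rewrite mul0r.
  by apply: sumr_ge0 => t _; apply: (avg_X_given_t_ge0 lgM lc0 lg_ge q0 q1).
suff -> : avg q (info_sum lg q) = muV + muW - mu6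
    + avg q (fun o => lg (m_xt q o) - lg (m_x q o) - lg (m_t q o)) by lra.
rewrite /muV /muW /mu6 -avgD -avgB -avgD; apply: eq_avg_supp => o qo.
by rewrite (info_sum_kernels lgM q0 cT cV qo); ring.
Qed.

(** The constant [c] is chosen before the block: it depends only on the single-letter law, the costs
    and [d], so the term [c / #|I|] vanishes with the block length. *)
Theorem coding (c1 c2 : X -> Y -> T * V * W -> R) (D1 D2 d : R) : 0 < d ->
  avg q (fun o => c1 (oX o) (oY o) (oT o, oV o, oW o)) <= D1 ->
  avg q (fun o => c2 (oX o) (oY o) (oT o, oV o, oW o)) <= D2 ->
  exists c, forall (I KT KU KV KW M0 MX MY : finType)
    (g1 g2 g3 g4 g5 g6 tT tU tV tW h : R),
  (0 < #|I|)%N -> (0 < #|KT|)%N -> (0 < #|KU|)%N -> (0 < #|KV|)%N ->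
  (0 < #|KW|)%N -> (0 < #|M0|)%N -> (0 < #|MX|)%N -> (0 < #|MY|)%N ->
  0 < g1 -> 0 < g2 -> 0 < g3 -> 0 < g4 -> 0 < g5 -> 0 < g6 ->
  0 < tT -> 0 < tU -> 0 < tV -> 0 < tW -> 0 < h ->
  lg g1 <= #|I|%:R * (mu1 - d) -> lg g2 <= #|I|%:R * (mu2 - d) ->
  lg g3 <= #|I|%:R * (mu3 - d) -> lg g4 <= #|I|%:R * (mu4 - d) ->
  lg g5 <= #|I|%:R * (mu5 - d) -> lg g6 <= #|I|%:R * (mu6 - d) ->
  #|I|%:R * (muT + d) <= lg tT -> #|I|%:R * (muU + d) <= lg tU ->
  #|I|%:R * (muV + d) <= lg tV -> #|I|%:R * (muW + d) <= lg tW ->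
  exists (phi0 : {ffun I -> X} -> M0) (phiX : {ffun I -> X} -> MX)
    (phiY : {ffun I -> Y} -> M0 -> MY)
    (psi : MX -> MY -> {ffun I -> T} * {ffun I -> V} * {ffun I -> W}),
  avg (fun z : {ffun I -> X} * {ffun I -> Y} => \prod_i pXY (z.1 i, z.2 i))
    (fun z => (~~ within_cost c1 c2 D1 D2 d z.1 z.2
       (psi (phiX z.1) (phiY z.2 (phi0 z.1))))%:R) <=
  c / #|I|%:R
  + (hash_loss KT tT h + hash_loss KU tU h + hash_loss KV tV h + hash_loss KW tW h)
  + (unif R (KT * unit)%type * unif R (KU * M0)%type / g1
     + unif R (KU * M0)%type / g2)
  + (unif R (KT * unit)%type * unif R (KV * MX)%type * unif R (KW * MY)%type / g3
     + unif R (KV * MX)%type / g4 + unif R (KW * MY)%type / g5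
     + unif R (KV * MX)%type * unif R (KW * MY)%type / g6).
Proof.
move=> d0 C1D C2D.
have lawE : law pXY kT kU kV kW = q by apply: boolp.funext => o; exact: law_q.
exists (iid_const lg pXY kT kU kV kW s1 s2 s3 s4 s5 s6 c1 c2 d).
move=> I KT KU KV KW M0 MX MY g1 g2 g3 g4 g5 g6 tT tU tV tW h.
move=> I0 KT0 KU0 KV0 KW0 M00 MX0 MY0 g10 g20 g30 g40 g50 g60 tT0 tU0 tV0 tW0 h0.
move=> l1 l2 l3 l4 l5 l6 lT lU lV lW.
have lgB a b : 0 < a -> 0 < b -> lg (a / b) = lg a - lg b.
  by move=> a0 b0; rewrite lgM ?invr_gt0 // (lgV lgM).
have g o (qo : 0 < q o) bx bb bt bu bv bw := marg_gt0 q0 bx bb bt bu bv bw qo.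
have meanE (k l : Om -> R) : (forall o, 0 < q o -> lg (k o) = l o) ->
    avg (law pXY kT kU kV kW) (fun o => lg (k o)) = avg q l.
  by move=> kl; rewrite lawE; apply: eq_avg_supp.
apply: (@iid_code R lg lgM lg_lt X Y T U V W pXY kT kU kV kW pXY_pmf kTp kUp kVp kWp
  I s1 s2 s3 s4 s5 s6) => //.
- by move=> y a; rewrite divr_ge0 ?marg_ge0.
- by move=> y a; rewrite divr_ge0 ?marg_ge0.
- by move=> a; exact: marg_ge0.
- by move=> a; rewrite divr_ge0 ?marg_ge0.
- by move=> a; rewrite divr_ge0 ?marg_ge0.
- by move=> a; rewrite divr_ge0 ?marg_ge0.
- move=> y; apply: (sum_div_le1 (den := m_y q (x0, y, t0, u0, v0, w0))).
  rewrite sum_pairE /=.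
  under eq_bigr => t _ do rewrite (marg_sumU q false true true false false x0 y t u0).
  exact: (marg_sumT q false true false false false x0 y t0).
- move=> y t; apply: (sum_div_le1 (den := m_yt q (x0, y, t, u0, v0, w0))).
  exact: (marg_sumU q false true true false false x0 y t u0).
- rewrite !sum_pairE /s3 /=.
  under eq_bigr => t _ do under eq_bigr => v _ do
    rewrite (marg_sumW q false false true false true x0 y0 t u0 v w0).
  under eq_bigr => t _ do
    rewrite (marg_sumV q false false true false false x0 y0 t u0 v0 w0).
  by rewrite (marg_sumT q false false false false false x0 y0 t0 u0 v0 w0) marg_none.
- move=> t w; apply: (sum_div_le1 (den := m_tw q (x0, y0, t, u0, v0, w))).
  exact: (marg_sumV q false false true false true x0 y0 t u0 v0 w).
- move=> t v; apply: (sum_div_le1 (den := m_tv q (x0, y0, t, u0, v, w0))).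
  exact: (marg_sumW q false false true false true x0 y0 t u0 v w0).
- move=> t; rewrite -(sum_pairE (fun z => s6 (t, z.1, z.2))).
  apply: (sum_div_le1 (den := m_t q (x0, y0, t, u0, v0, w0))).
  rewrite sum_pairE /=; under eq_bigr => v _ do
    rewrite (marg_sumW q false false true false true x0 y0 t u0 v w0).
  exact: (marg_sumV q false false true false false x0 y0 t u0 v0 w0).
- move=> o; rewrite lawE => qo; apply: divr_gt0.
    exact: (g o qo false true true true false false).
  exact: (g o qo false true false false false false).
- move=> o; rewrite lawE => qo; apply: divr_gt0.
    exact: (g o qo false true true true false false).
  exact: (g o qo false true true false false false).
- move=> o; rewrite lawE => qo.
  exact: (g o qo false false true false true true).
- move=> o; rewrite lawE => qo; apply: divr_gt0.
    exact: (g o qo false false true false true true).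
  exact: (g o qo false false true false false true).
- move=> o; rewrite lawE => qo; apply: divr_gt0.
    exact: (g o qo false false true false true true).
  exact: (g o qo false false true false true false).
- move=> o; rewrite lawE => qo; apply: divr_gt0.
    exact: (g o qo false false true false true true).
  exact: (g o qo false false true false false false).
- by rewrite lawE.
- by rewrite lawE.
- rewrite (meanE _ (fun o => lg (m_ytu q o) - lg (m_y q o))) // => o qo; apply: lgB.
    exact: (g o qo false true true true false false).
  exact: (g o qo false true false false false false).
- rewrite (meanE _ (fun o => lg (m_ytu q o) - lg (m_yt q o))) // => o qo; apply: lgB.
    exact: (g o qo false true true true false false).
  exact: (g o qo false true true false false false).
- by rewrite (meanE _ (fun o => lg (m_tvw q o))).
- rewrite (meanE _ (fun o => lg (m_tvw q o) - lg (m_tw q o))) // => o qo; apply: lgB.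
    exact: (g o qo false false true false true true).
  exact: (g o qo false false true false false true).
- rewrite (meanE _ (fun o => lg (m_tvw q o) - lg (m_tv q o))) // => o qo; apply: lgB.
    exact: (g o qo false false true false true true).
  exact: (g o qo false false true false true false).
- rewrite (meanE _ (fun o => lg (m_tvw q o) - lg (m_t q o))) // => o qo; apply: lgB.
    exact: (g o qo false false true false true true).
  exact: (g o qo false false true false false false).
- rewrite (meanE _ (fun o => lg (m_xt q o) - lg (m_x q o))) // => o qo.
  by have [-> _ _ _] := kernelsE qo; apply: lgB; exact: g.
- rewrite (meanE _ (fun o => lg (m_xtu q o) - lg (m_xt q o))) // => o qo.
  by have [_ -> _ _] := kernelsE qo; apply: lgB; exact: g.
- rewrite (meanE _ (fun o => lg (m_xtv q o) - lg (m_xt q o))) // => o qo.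
  by have [_ _ -> _] := kernelsE qo; apply: lgB; exact: g.
rewrite (meanE _ (fun o => lg (m_yuw q o) - lg (m_yu q o))) // => o qo.
by have [_ _ _ ->] := kernelsE qo; apply: lgB; exact: g.
Qed.

End CodingData.

(** * Real-valued statements *)

Notation RR := Rdefinitions.R.

Lemma rsumE (T : finType) (f : T -> RR) : rsum f = \sum_x f x.
Proof.
rewrite /rsum -big_enum; elim: (enum T) => [|x s IHs]; first by rewrite big_nil.
by rewrite big_cons /= IHs.
Qed.

Lemma rprodE (T : finType) (f : T -> RR) : rprod f = \prod_x f x.
Proof.
rewrite /rprod -big_enum; elim: (enum T) => [|x s IHs]; first by rewrite big_nil.
by rewrite big_cons /= IHs.
Qed.

Lemma ln2_gt0 : 0 < ln (IZR 2).
Proof.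
apply/RltP; apply: Rlt_trans ln_lt_2; apply: Rinv_0_lt_compat; exact: Rlt_0_2.
Qed.

Lemma log2M (a b : RR) : 0 < a -> 0 < b -> log2 (a * b) = log2 a + log2 b.
Proof.
move=> /RltP a0 /RltP b0; rewrite /log2 ln_mult // -RplusE.
by rewrite /Rdiv Rmult_plus_distr_r.
Qed.

Lemma log2_lt (a b : RR) : 0 < a -> a < b -> log2 a < log2 b.
Proof.
move=> /RltP a0 /RltP ab; apply/RltP; apply: Rmult_lt_compat_r.
  by apply: Rinv_0_lt_compat; apply/RltP; exact: ln2_gt0.
exact: ln_increasing.
Qed.

(** The inequality exp y >= 1 + y at y = - ln a; nonnegativity of all informations rests on it. *)
Lemma log2_ge (a : RR) : 0 < a -> (ln (IZR 2))^-1 * (1 - a^-1) <= log2 a.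
Proof.
move=> a0; rewrite /log2 RdivE [leRHS]mulrC ler_pM2l ?invr_gt0 ?ln2_gt0 //.
have /RltP a0' := a0.
have := exp_ineq1_le (- ln a); rewrite exp_Ropp exp_ln // => /RleP.
rewrite -RplusE RinvE RoppE => h.
by rewrite lerBlDr -lerBlDl.
Qed.

Lemma log2_Rpower (x : RR) : log2 (Rpower (IZR 2) x) = x.
Proof.
rewrite /log2 /Rpower ln_exp /Rdiv Rmult_assoc Rinv_r ?Rmult_1_r //.
by have /RltP := ln2_gt0 => h; apply: Rgt_not_eq.
Qed.

Lemma is_pmfP (T : finType) (P : T -> RR) : is_pmf P <-> pmf P.
Proof.
rewrite /is_pmf rsumE; split=> -[P0 P1]; split=> // i; first exact/RleP.
exact/RleP.
Qed.

Section Glue.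
Variables (X Y T U V W : finType) (q : X * Y * T * U * V * W -> RR).
Local Notation Om := (X * Y * T * U * V * W)%type.
Local Notation oX := (@oX X Y T U V W).
Local Notation oY := (@oY X Y T U V W).
Local Notation oT := (@oT X Y T U V W).
Local Notation oU := (@oU X Y T U V W).
Local Notation oV := (@oV X Y T U V W).
Local Notation oW := (@oW X Y T U V W).
Local Notation marg := (marg_of q).
Lemma prE (E : pred Om) : pr q E = \sum_(o | E o) q o.
Proof. by rewrite /pr rsumE [RHS]big_mkcond. Qed.

Lemma expectE (h : Om -> RR) : expect q h = avg q h.
Proof. by rewrite /expect rsumE. Qed.

Lemma condMIE (al be ga : finType) (A : Om -> al) (B : Om -> be) (C : Om -> ga) :
  condMI q A B C = cmi log2 q A B C.
Proof.
rewrite /condMI rsumE; apply: eq_bigr => -[[a b] c] _ /=; rewrite !prE.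
have -> : \sum_(o | [&& A o == a, B o == b & C o == c]) q o =
    pk q (fun o => (A o, B o, C o)) (a, b, c).
  by apply: eq_bigl => o; rewrite !xpair_eqE -andbA.
have -> : \sum_(o | (A o == a) && (C o == c)) q o =
    pk q (fun o => (A o, C o)) (a, c).
  by apply: eq_bigl => o; rewrite !xpair_eqE.
have -> : \sum_(o | (B o == b) && (C o == c)) q o =
    pk q (fun o => (B o, C o)) (b, c).
  by apply: eq_bigl => o; rewrite !xpair_eqE.
case: Rlt_dec => h /=; first by move/RltP: (h) => ->.
by move/RltP/negPf: h => ->.
Qed.

Lemma markov4_TUXY : pmf q -> markov4 q oT oU oX oY <-> chain_TUXY q.
Proof.
move=> qp; have [[[[[x0 y0] t0] u0] v0] w0] := pmf_inh qp.
rewrite /markov4 /markov3; split=> -[h1 h2]; split.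
- move=> o; have := h1 (oT o) (oU o) (oX o); rewrite !prE !RmultE => e.
  etransitivity; last (etransitivity; first exact: e);
    congr (_ * _); apply: eq_bigl => o';
    by rewrite /agree ?xpair_eqE /=; do !case: (_ == _).
- move=> o; have := h2 (oT o, oU o) (oX o) (oY o); rewrite !prE !RmultE => e.
  etransitivity; last (etransitivity; first exact: e);
    congr (_ * _); apply: eq_bigl => o';
    by rewrite /agree ?xpair_eqE /=; do !case: (_ == _).
- move=> t u x; have e := h1 (x, y0, t, u, v0, w0); rewrite !prE !RmultE.
  etransitivity; last (etransitivity; first exact: e);
    congr (_ * _); apply: eq_bigl => o';
    by rewrite /agree ?xpair_eqE /=; do !case: (_ == _).
move=> [t u] x y; have e := h2 (x, y, t, u, v0, w0); rewrite !prE !RmultE.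
etransitivity; last (etransitivity; first exact: e);
  congr (_ * _); apply: eq_bigl => o';
  by rewrite /agree ?xpair_eqE /=; do !case: (_ == _).
Qed.

Lemma markov4_VXTUYW : pmf q ->
  markov4 q oV (fun o => (oX o, oT o)) (fun o => (oU o, oY o)) oW <-> chain_VXTUYW q.
Proof.
move=> qp; have [[[[[x0 y0] t0] u0] v0] w0] := pmf_inh qp.
rewrite /markov4 /markov3; split=> -[h1 h2]; split.
- move=> o; have := h1 (oV o) (oX o, oT o) (oU o, oY o); rewrite !prE !RmultE => e.
  etransitivity; last (etransitivity; first exact: e);
    congr (_ * _); apply: eq_bigl => o';
    by rewrite /agree ?xpair_eqE /=; do !case: (_ == _).
- move=> o; have := h2 (oV o, (oX o, oT o)) (oU o, oY o) (oW o).
  rewrite !prE !RmultE -(marg_all q o) => e.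
  etransitivity; last (etransitivity; first exact: e);
    congr (_ * _); apply: eq_bigl => o';
    by rewrite /agree ?xpair_eqE /=; do !case: (_ == _).
- move=> v [x t] [u y]; have e := h1 (x, y, t, u, v, w0); rewrite !prE !RmultE.
  etransitivity; last (etransitivity; first exact: e);
    congr (_ * _); apply: eq_bigl => o';
    by rewrite /agree ?xpair_eqE /=; do !case: (_ == _).
move=> [v [x t]] [u y] w; have e := h2 (x, y, t, u, v, w).
rewrite -(marg_all q) in e; rewrite !prE !RmultE.
etransitivity; last (etransitivity; first exact: e);
  congr (_ * _); apply: eq_bigl => o';
  by rewrite /agree ?xpair_eqE /=; do !case: (_ == _).
Qed.

Lemma marg_xyP (p : X -> Y -> RR) : pmf q ->
  (forall x y, pr q (fun o => (oX o == x) && (oY o == y)) = p x y) <->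
  (forall o, m_xy q o = p (oX o) (oY o)).
Proof.
move=> qp; have [[[[[x0 y0] t0] u0] v0] w0] := pmf_inh qp; split=> h.
  move=> o; rewrite -h prE; apply: eq_bigl => o'.
  by rewrite /agree /=; do !case: (_ == _).
move=> x y; rewrite -[RHS](h (x, y, t0, u0, v0, w0)) prE; apply: eq_bigl => o'.
by rewrite /agree /=; do !case: (_ == _).
Qed.

End Glue.

(** [inner_cond] in terms of marginals: each rate and distortion constraint becomes the average of
    one function against [q], the form in which both halves of the theorem use it. *)
Definition inner_region (X Y F1 F2 : finType) (p : X -> Y -> RR)
  (f1 : X -> Y -> F1) (f2 : X -> Y -> F2)
  (d1 : F1 -> F1 -> RR) (d2 : F2 -> F2 -> RR)
  (D1 D2 R0 RX RY : RR)
  (T U V W : finType) (q : X * Y * T * U * V * W -> RR)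
  (g1 : V -> T -> W -> F1) (g2 : V -> T -> W -> F2) : Prop :=
  pmf q /\
  (forall o, marg_of q true true false false false false o = p (oX o) (oY o)) /\
  chain_TUXY q /\ chain_VXTUYW q /\
  avg q (fun o => d1 (f1 (oX o) (oY o)) (g1 (oV o) (oT o) (oW o))) <= D1 /\
  avg q (fun o => d2 (f2 (oX o) (oY o)) (g2 (oV o) (oT o) (oW o))) <= D2 /\
  avg q (info_U log2 q) < R0 /\ avg q (info_V log2 q) < RX /\ avg q (info_W log2 q) < RY /\
  avg q (info_sum log2 q) < RX + RY.

Lemma inner_condP (X Y F1 F2 : finType) (p : X -> Y -> RR)
  (f1 : X -> Y -> F1) (f2 : X -> Y -> F2)
  (d1 : F1 -> F1 -> RR) (d2 : F2 -> F2 -> RR)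
  (D1 D2 R0 RX RY : RR)
  (T U V W : finType) (q : X * Y * T * U * V * W -> RR)
  (g1 : V -> T -> W -> F1) (g2 : V -> T -> W -> F2) :
  inner_cond p f1 f2 d1 d2 D1 D2 R0 RX RY q g1 g2 <->
  inner_region p f1 f2 d1 d2 D1 D2 R0 RX RY q g1 g2.
Proof.
split.
  move=> [] /is_pmfP qp [] mp [] c1 [] c2 [] e1 [] e2 [] r0 [] rx [] ry rxy.
  split=> //; split; first by apply/(marg_xyP p qp).
  split; first by apply/markov4_TUXY.
  split; first by apply/markov4_VXTUYW.
  split; first by rewrite -expectE; apply/RleP.
  split; first by rewrite -expectE; apply/RleP.
  split; first by rewrite -(cmi_info_U log2M (qp).1) -condMIE; apply/RltP.
  split; first by rewrite -(cmi_info_V log2M (qp).1) -condMIE; apply/RltP.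
  split; first by rewrite -(cmi_info_W log2M (qp).1) -condMIE; apply/RltP.
  by rewrite -(cmi_info_sum log2M (qp).1 (qp).2) -!condMIE; apply/RltP.
move=> [] qp [] mp [] c1 [] c2 [] e1 [] e2 [] r0 [] rx [] ry rxy.
split; first exact/is_pmfP.
split; first by apply/(marg_xyP p qp).
split; first exact/(markov4_TUXY qp).
split; first exact/(markov4_VXTUYW qp).
split; first by rewrite -expectE in e1; apply/RleP.
split; first by rewrite -expectE in e2; apply/RleP.
split; first by rewrite -(cmi_info_U log2M (qp).1) -condMIE in r0; apply/RltP.
split; first by rewrite -(cmi_info_V log2M (qp).1) -condMIE in rx; apply/RltP.
split; first by rewrite -(cmi_info_W log2M (qp).1) -condMIE in ry; apply/RltP.
by rewrite -(cmi_info_sum log2M (qp).1 (qp).2) -!condMIE in rxy; apply/RltP.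
Qed.

(** * Exponents and rounded set sizes *)

Definition pow2 (x : RR) : RR := Rpower (IZR 2) x.
Arguments pow2 x%_ring_scope.

Lemma pow2_gt0 (x : RR) : 0 < pow2 x.
Proof. by apply/RltP; exact: exp_pos. Qed.

Lemma log2_pow2 (x : RR) : log2 (pow2 x) = x.
Proof. exact: log2_Rpower. Qed.

Lemma pow2D (a b : RR) : pow2 (a + b) = pow2 a * pow2 b.
Proof. exact: Rpower_plus. Qed.

Lemma pow2N (a : RR) : pow2 (- a) = (pow2 a)^-1.
Proof. exact: Rpower_Ropp. Qed.

Lemma pow2_le (a b : RR) : a <= b -> pow2 a <= pow2 b.
Proof.
move=> /RleP ab; apply/RleP; apply: Rle_Rpower => //.
exact: (IZR_le 1 2).
Qed.

(** Makes exponentially small errors at most a constant over [n], so that they merge with the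
    Chebyshev terms. *)
Lemma pow2_lin (a : RR) : a * ln (IZR 2) <= pow2 a.
Proof.
have /RleP := exp_ineq1_le (Rmult a (ln (IZR 2))).
rewrite /pow2 /Rpower RplusE RmultE => h; apply: le_trans h; rewrite lerDr.
exact: ler01.
Qed.

(** [up] leaves at least one bin even when the exponent is negative; its excess of at most one is
    absorbed by the [#|K| - 1] of the hash loss. *)
Definition hash_size (s : RR) : nat := Z.to_nat (up (pow2 s)).

Lemma hash_size_bounds s :
  [/\ (0 < hash_size s)%N, pow2 s <= (hash_size s)%:R
    & (hash_size s)%:R - 1 <= pow2 s].
Proof.
have p0 := pow2_gt0 s.
have /RltP/Rlt_le/up_nat_bounds[] := p0.
rewrite INRE => /RltP h1 /RleP h2; rewrite /hash_size; split.
- by rewrite -(ltr0n RR); apply: lt_trans h1.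
- exact: ltW.
by move: h2; rewrite RplusE R1E; lra.
Qed.

(** Rounding [x >= 1] down to [m >= 1] loses at most a factor 2, since [x < m + 1 <= 2 m]. *)
Lemma msgs_bounds n (r : RR) : 0 <= r ->
  (0 < msgs n r)%N /\ pow2 (n%:R * r) / 2 <= (msgs n r)%:R.
Proof.
move=> r0; rewrite /msgs INRE RmultE -/(pow2 _); have p0 := pow2_gt0 (n%:R * r).
have p1 : 1 <= pow2 (n%:R * r).
  have pow20 : pow2 0 = 1 by apply: Rpower_O; exact: Rlt_0_2.
  by rewrite -[leLHS]pow20; apply: pow2_le; rewrite mulr_ge0.
have /RltP/Rlt_le/Int_part_nat_bounds[] := p0.
rewrite INRE => /RleP h1 /RltP; rewrite RplusE => h2.
set m := Z.to_nat _ in h1 h2 *.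
rewrite R1E in h2.
have m0 : (0 < m)%N by rewrite -(ltr0n RR); lra.
split=> //; have m1 : 1 <= m%:R :> RR by rewrite ler1n.
by lra.
Qed.

Section Tuples.
Variables (X Y : finType) (n : nat).

Definition tuple_of_ffun (A : finType) (x : {ffun 'I_n -> A}) : n.-tuple A :=
  [tuple x i | i < n].
Definition ffun_of_tuple (A : finType) (x : n.-tuple A) : {ffun 'I_n -> A} :=
  [ffun i => tnth x i].

Lemma tuple_of_ffunK (A : finType) : cancel (@tuple_of_ffun A) (@ffun_of_tuple A).
Proof. by move=> x; apply/ffunP => i; rewrite ffunE tnth_mktuple. Qed.

Lemma ffun_of_tupleK (A : finType) : cancel (@ffun_of_tuple A) (@tuple_of_ffun A).
Proof. by move=> x; apply: eq_from_tnth => i; rewrite tnth_mktuple ffunE. Qed.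

Lemma tuple_of_ffun_bij (A : finType) : bijective (@tuple_of_ffun A).
Proof.
by exists (@ffun_of_tuple A); [exact: tuple_of_ffunK|exact: ffun_of_tupleK].
Qed.

Lemma avg_distE (F : finType) (p : X -> Y -> RR) (f : X -> Y -> F)
    (d : F -> F -> RR) (Fhat : n.-tuple X -> n.-tuple Y -> n.-tuple F) :
  avg_dist p f d Fhat = n%:R^-1 *
    avg (fun z : {ffun 'I_n -> X} * {ffun 'I_n -> Y} => \prod_i p (z.1 i) (z.2 i))
     (fun z => \sum_i d (f (z.1 i) (z.2 i))
        (tnth (Fhat (tuple_of_ffun z.1) (tuple_of_ffun z.2)) i)).
Proof.
rewrite /avg_dist INRE RinvE RmultE; congr (_ * _); rewrite rsumE /avg sum_pairE.
rewrite (reindex (@tuple_of_ffun X)) /=; last exact/onW_bij/tuple_of_ffun_bij.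
apply: eq_bigr => x _; rewrite rsumE.
rewrite (reindex (@tuple_of_ffun Y)) /=; last exact/onW_bij/tuple_of_ffun_bij.
apply: eq_bigr => y _; rewrite rprodE rsumE RmultE; congr (_ * _).
  by apply: eq_bigr => i _; rewrite !tnth_mktuple.
by apply: eq_bigr => i _; rewrite !tnth_mktuple.
Qed.

End Tuples.

Lemma bounded_above (A : finType) (f : A -> RR) : exists2 b, 0 <= b & forall a, f a <= b.
Proof.
exists (\sum_a `|f a|) => [|a]; first exact: sumr_ge0.
rewrite (bigD1 a) //=; apply: le_trans (ler_norm _) _.
by rewrite lerDl sumr_ge0.
Qed.

(* Of the six exponents, the largest budget is [7 d]: one for the threshold and two
   for each of the three hash sizes. *)
Lemma collision_bounds (n : nat) (d R0 RX RY mT mU mV mW m1 m2 m3 m4 m5 m6 : RR)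
    (KT KU KV KW M0 MX MY : nat) (e := pow2 (- (n%:R * d))) :
  pow2 (n%:R * (- mT - 2 * d)) <= KT%:R -> pow2 (n%:R * (- mU - 2 * d)) <= KU%:R ->
  pow2 (n%:R * (- mV - 2 * d)) <= KV%:R -> pow2 (n%:R * (- mW - 2 * d)) <= KW%:R ->
  pow2 (n%:R * R0) / 2 <= M0%:R -> pow2 (n%:R * RX) / 2 <= MX%:R ->
  pow2 (n%:R * RY) / 2 <= MY%:R ->
  mT + mU - m1 + 8 * d <= R0 -> mU - m2 + 8 * d <= R0 ->
  mV - m4 + 8 * d <= RX -> mW - m5 + 8 * d <= RY ->
  mT + mV + mW - m3 + 8 * d <= RX + RY -> mV + mW - m6 + 8 * d <= RX + RY ->
  0 < d ->
  [/\ KT%:R^-1 * (KU%:R * M0%:R)^-1 / pow2 (n%:R * (m1 - d)) <= 4 * e,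
      (KU%:R * M0%:R)^-1 / pow2 (n%:R * (m2 - d)) <= 4 * e
    & [/\ KT%:R^-1 * (KV%:R * MX%:R)^-1 * (KW%:R * MY%:R)^-1
            / pow2 (n%:R * (m3 - d)) <= 4 * e,
      (KV%:R * MX%:R)^-1 / pow2 (n%:R * (m4 - d)) <= 4 * e,
      (KW%:R * MY%:R)^-1 / pow2 (n%:R * (m5 - d)) <= 4 * e
    & (KV%:R * MX%:R)^-1 * (KW%:R * MY%:R)^-1 / pow2 (n%:R * (m6 - d)) <= 4 * e]].
Proof.
move=> hT hU hV hW h0 hX hY c1 c2 c4 c5 c3 c6 d0.
have inv (k : nat) a : pow2 a <= k%:R -> (0 : RR) <= k%:R^-1 <= pow2 (- a).
  move=> h; have p0 := pow2_gt0 a; rewrite invr_ge0 ler0n /= pow2N lef_pV2 //.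
  by rewrite posrE (lt_le_trans p0).
(* Each rounded message set costs a factor 2; a collision term involves at most two of them, hence
   the constant 4. *)
have inv2 (k : nat) a : pow2 a / 2 <= k%:R -> (0 : RR) <= k%:R^-1 <= 2 * pow2 (- a).
  move=> h; have p0 := pow2_gt0 a; rewrite invr_ge0 ler0n /= pow2N.
  have -> : 2 * (pow2 a)^-1 = (pow2 a / 2)^-1 by rewrite invf_div.
  by rewrite lef_pV2 // posrE; lra.
have mul2 (a b a' b' : RR) : 0 <= a <= a' -> 0 <= b <= b' -> 0 <= a * b <= a' * b'.
  by move=> /andP[a0 aa] /andP[b0 bb]; rewrite mulr_ge0 //= ler_pM.
have n0 : 0 <= n%:R :> RR by rewrite ler0n.
have e0 : 0 < e by exact: pow2_gt0.
have wpow a c : (0 <= c <= 4)%R -> d <= a -> c * pow2 (- (n%:R * a)) <= 4 * e.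
  move=> /andP[c0 c4'] da; apply: ler_pM => //; first exact/ltW/pow2_gt0.
  by apply: pow2_le; rewrite lerN2 ler_wpM2l.
have [KTi KUi KVi KWi] := And4 (inv _ _ hT) (inv _ _ hU) (inv _ _ hV) (inv _ _ hW).
have [M0i MXi MYi] := And3 (inv2 _ _ h0) (inv2 _ _ hX) (inv2 _ _ hY).
have g a : 0 <= (pow2 (n%:R * a))^-1 <= pow2 (- (n%:R * a)).
  by rewrite pow2N lexx invr_ge0 ltW ?pow2_gt0.
split; [| |split].
- have /andP[_ h] := mul2 _ _ _ _ (mul2 _ _ _ _ KTi (mul2 _ _ _ _ KUi M0i)) (g (m1 - d)).
  rewrite invfM; apply: le_trans h _.
  apply: le_trans (wpow (- mT - 2 * d + (- mU - 2 * d) + R0 + (m1 - d)) 2 _ _); try lra.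
  by rewrite !mulrDr !opprD !pow2D; lra.
- have /andP[_ h] := mul2 _ _ _ _ (mul2 _ _ _ _ KUi M0i) (g (m2 - d)).
  rewrite invfM; apply: le_trans h _.
  apply: le_trans (wpow (- mU - 2 * d + R0 + (m2 - d)) 2 _ _); try lra.
  by rewrite !mulrDr !opprD !pow2D; lra.
- have /andP[_ h] := mul2 _ _ _ _ (mul2 _ _ _ _ (mul2 _ _ _ _ KTi
    (mul2 _ _ _ _ KVi MXi)) (mul2 _ _ _ _ KWi MYi)) (g (m3 - d)).
  rewrite ![(_ * _)^-1]invfM; apply: le_trans h _.
  apply: le_trans (wpow (- mT - 2 * d + (- mV - 2 * d) + RX + (- mW - 2 * d) + RY
    + (m3 - d)) 4 _ _); try lra.
  by rewrite !mulrDr !opprD !pow2D; lra.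
- have /andP[_ h] := mul2 _ _ _ _ (mul2 _ _ _ _ KVi MXi) (g (m4 - d)).
  rewrite invfM; apply: le_trans h _.
  apply: le_trans (wpow (- mV - 2 * d + RX + (m4 - d)) 2 _ _); try lra.
  by rewrite !mulrDr !opprD !pow2D; lra.
- have /andP[_ h] := mul2 _ _ _ _ (mul2 _ _ _ _ KWi MYi) (g (m5 - d)).
  rewrite invfM; apply: le_trans h _.
  apply: le_trans (wpow (- mW - 2 * d + RY + (m5 - d)) 2 _ _); try lra.
  by rewrite !mulrDr !opprD !pow2D; lra.
have /andP[_ h] := mul2 _ _ _ _ (mul2 _ _ _ _
    (mul2 _ _ _ _ KVi MXi) (mul2 _ _ _ _ KWi MYi)) (g (m6 - d)).
rewrite ![(_ * _)^-1]invfM; apply: le_trans h _.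
apply: le_trans (wpow (- mV - 2 * d + RX + (- mW - 2 * d) + RY
    + (m6 - d)) 4 _ _); try lra.
by rewrite !mulrDr !opprD !pow2D; lra.
Qed.

Lemma archi_nat (a b : RR) : 0 < b -> exists N : nat, forall n, (N <= n)%N ->
  (0 < n)%N /\ a / n%:R <= b.
Proof.
move=> b0; exists (Z.to_nat (up (`|a| / b))) => n Nn.
have ab0 : 0 <= `|a| / b by rewrite divr_ge0 // ltW.
have /RleP/up_nat_bounds[] := ab0; rewrite INRE => /RltP h _.
have hn : `|a| / b < n%:R by apply: lt_le_trans h _; rewrite ler_nat.
have n0 : 0 < n%:R :> RR by apply: le_lt_trans ab0 hn.
split; first by rewrite -(ltr0n RR).
rewrite ler_pdivrMr //; apply: le_trans (ler_norm _) _.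
by rewrite mulrC -ler_pdivrMr // ltW.
Qed.

(** Threshold times excess bin count is at most [2^(-n d)]; taking [theta] as the square root of
    this quantity balances the two terms of the loss. *)
Lemma hash_loss_le (K : finType) (n : nat) (m d : RR) :
  #|K|%:R - 1 <= pow2 (n%:R * (- m - 2 * d)) ->
  hash_loss K (pow2 (n%:R * (m + d))) (pow2 (- (n%:R * d / 2)))
  <= pow2 (- (n%:R * d / 2)).
Proof.
move=> hK; rewrite /hash_loss; set h := pow2 (- _).
have h0 : 0 < h by exact: pow2_gt0.
suff : (#|K|%:R - 1) * pow2 (n%:R * (m + d)) / h <= h by lra.
rewrite ler_pdivrMr //; apply: le_trans (ler_wpM2r (ltW (pow2_gt0 _)) hK) _.
rewrite -!pow2D; apply: pow2_le; lra.
Qed.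

Lemma exists_common_gap (a a' b b' c c' e e' f : RR) :
  a < a' -> b < b' -> c < c' -> e < e' -> 0 < f ->
  exists d, [/\ 0 < d, a + 8 * d <= a', b + 8 * d <= b', c + 8 * d <= c'
    & e + 8 * d <= e' /\ d <= f / 2].
Proof.
move=> ha hb hc he hf.
pose m := Num.min (a' - a) (Num.min (b' - b) (Num.min (c' - c) (Num.min (e' - e) f))).
have m0 : 0 < m by rewrite !lt_min !subr_gt0 ha hb hc he hf.
have [m1 m2 m3 m4 m5] : [/\ m <= a' - a, m <= b' - b, m <= c' - c, m <= e' - e & m <= f].
  by rewrite /m; split; rewrite !ge_min lexx ?orbT.
by exists (m / 8); split; try split; lra.
Qed.

Lemma pow2_half_le (n : nat) (d : RR) : 0 < d ->
  pow2 (- (n%:R * d)) <= pow2 (- (n%:R * d / 2)).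
Proof.
move=> d0; apply: pow2_le; rewrite lerN2 ler_pdivrMr ?ltr0n //.
by rewrite mulr_natr mulr2n lerDl mulr_ge0 // ltW.
Qed.

(** 28 = 4 + 6 * 4: four hash losses, and six collision terms with constant 4. *)
Lemma sum_error_le (c h e a b1 b2 b3 b4 b5 b6 lT lU lV lW : RR) :
  b1 <= 4 * e -> b2 <= 4 * e -> b3 <= 4 * e -> b4 <= 4 * e -> b5 <= 4 * e ->
  b6 <= 4 * e -> lT <= h -> lU <= h -> lV <= h -> lW <= h -> e <= h -> h <= a ->
  c + (lT + lU + lV + lW) + (b1 + b2) + (b3 + b4 + b5 + b6) <= c + 28 * a.
Proof. lra. Qed.

(** * Achievability: choice of sizes and block length *)

Section Achievability.
Variables (X Y F1 F2 : finType) (p : X -> Y -> RR).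
Variables (f1 : X -> Y -> F1) (f2 : X -> Y -> F2).
Variables (d1 : F1 -> F1 -> RR) (d2 : F2 -> F2 -> RR) (D1 D2 R0 RX RY : RR).
Variables (T U V W : finType) (q : X * Y * T * U * V * W -> RR).
Variables (g1 : V -> T -> W -> F1) (g2 : V -> T -> W -> F2).

Lemma achievable_inner : 0 <= D1 -> 0 <= D2 ->
  inner_region p f1 f2 d1 d2 D1 D2 R0 RX RY q g1 g2 ->
  achievable p f1 f2 d1 d2 D1 D2 R0 RX RY.
Proof.
move=> HD1 HD2 [] qp [] mp [] cT [] cV [] e1 [] e2 [] r0 [] rx [] ry rxy.
have q0 := (qp).1; have q1 := (qp).2.
have lc0 : 0 <= (ln (IZR 2))^-1 by rewrite invr_ge0 ltW ?ln2_gt0.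
have lge := log2_ge; have lgM := log2M; have lglt := log2_lt.
(* A rate exceeding an information is nonnegative, so [msgs_bounds] applies and no message set is
   empty. *)
have R00 : 0 <= R0.
  apply: le_trans (ltW r0); rewrite -(cmi_info_U lgM q0) cmiE //.
  exact: (avg_dens_ge0 lgM lc0 lge q0).
have RX0 : 0 <= RX.
  apply: le_trans (ltW rx); rewrite -(cmi_info_V lgM q0) cmiE //.
  exact: (avg_dens_ge0 lgM lc0 lge q0).
have RY0 : 0 <= RY.
  apply: le_trans (ltW ry); rewrite -(cmi_info_W lgM q0) cmiE //.
  exact: (avg_dens_ge0 lgM lc0 lge q0).
have [[[[[x0 y0] t0] u0] v0] w0] := pmf_inh qp.
move=> eps /RltP eps0.
pose mT := muT log2 q; pose mU := muU log2 q; pose mV := muV log2 q.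
pose mW := muW log2 q; pose m1 := mu1 log2 q; pose m2 := mu2 log2 q.
pose m3 := mu3 log2 q; pose m4 := mu4 log2 q; pose m5 := mu5 log2 q.
pose m6 := mu6 log2 q.
have E0 := avg_info_U lgM q0 cT; have E0U := avg_info_U_ge lgM lc0 lge q0 cT.
have Ea := avg_info_V lgM q0 cV; have Eb := avg_info_W lgM q0 cV.
have Ec := avg_info_sum lgM q0 cT cV; have EcVW := avg_info_sum_ge lgM lc0 lge q0 q1 cT cV.
have [d [d_gt0 gap0 gapX gapY [gapXY d_eps]]] := exists_common_gap r0 rx ry rxy eps0.
have [B1 B10 HB1] := bounded_above (fun z => d1 z.1 z.2).
have [B2 B20 HB2] := bounded_above (fun z => d2 z.1 z.2).
pose c1 x y (a : T * V * W) := d1 (f1 x y) (g1 a.1.2 a.1.1 a.2).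
pose c2 x y (a : T * V * W) := d2 (f2 x y) (g2 a.1.2 a.1.1 a.2).
have [c Hc] := @coding RR log2 lgM lglt X Y T U V W q q0 q1 cT cV x0 y0 t0 u0 v0 w0
  c1 c2 D1 D2 d d_gt0 e1 e2.
have ln20 := ln2_gt0.
(* 56 = 28 * 2: by [pow2_lin], each of the 28 units of [sum_error_le] is at most
   [2 / (d * ln 2) / n]. *)
pose C := c + 56 / (d * ln (IZR 2)).
have [N HN] := archi_nat ((B1 + B2) * C) (divr_gt0 eps0 (ltr0n RR 2)).
exists N => n /HN[n0 errn].
have nr0 : 0 < n%:R :> RR by rewrite ltr0n.
(* The shared rate is the entropy [- m] lowered by [2 * d]: one [d] pays for the typicality
   threshold, the other makes the hash loss decay. *)
pose sz m := hash_size (n%:R * (- m - 2 * d)).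
have szP m := hash_size_bounds (n%:R * (- m - 2 * d)).
pose h := pow2 (- (n%:R * d / 2)).
have [M00 M0b] := msgs_bounds n R00; have [MX0 MXb] := msgs_bounds n RX0.
have [MY0 MYb] := msgs_bounds n RY0.
have cardp (k : nat) (M : finType) : unif RR ('I_k * M)%type = (k%:R * #|M|%:R)^-1.
  by rewrite /unif card_prod card_ord natrM.
have := Hc 'I_n 'I_(sz mT) 'I_(sz mU) 'I_(sz mV) 'I_(sz mW)
  'I_(msgs n R0) 'I_(msgs n RX) 'I_(msgs n RY)
  (pow2 (n%:R * (m1 - d))) (pow2 (n%:R * (m2 - d))) (pow2 (n%:R * (m3 - d)))
  (pow2 (n%:R * (m4 - d))) (pow2 (n%:R * (m5 - d))) (pow2 (n%:R * (m6 - d)))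
  (pow2 (n%:R * (mT + d))) (pow2 (n%:R * (mU + d)))
  (pow2 (n%:R * (mV + d))) (pow2 (n%:R * (mW + d))) h.
rewrite !card_ord !log2_pow2 !cardp !card_ord !card_unit mulr1.
have sz0 m : (0 < sz m)%N by have [] := szP m.
move=> /(_ n0 (sz0 _) (sz0 _) (sz0 _) (sz0 _) M00 MX0 MY0 (pow2_gt0 _) (pow2_gt0 _)
  (pow2_gt0 _) (pow2_gt0 _) (pow2_gt0 _) (pow2_gt0 _) (pow2_gt0 _) (pow2_gt0 _)
  (pow2_gt0 _) (pow2_gt0 _) (pow2_gt0 _) (lexx _) (lexx _) (lexx _) (lexx _)
  (lexx _) (lexx _) (lexx _) (lexx _) (lexx _) (lexx _)).
move=> [phi0 [phiX [phiY [psi err_le]]]].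
have {err_le} : avg (fun z : {ffun 'I_n -> X} * {ffun 'I_n -> Y} =>
      \prod_i p (z.1 i) (z.2 i))
    (fun z => (~~ within_cost c1 c2 D1 D2 d z.1 z.2
       (psi (phiX z.1) (phiY z.2 (phi0 z.1))))%:R) <= C / n%:R.
  have -> : (fun z : {ffun 'I_n -> X} * {ffun 'I_n -> Y} =>
      \prod_i p (z.1 i) (z.2 i)) =
      (fun z => \prod_i pXY q t0 u0 v0 w0 (z.1 i, z.2 i)).
    by apply: boolp.funext => z; apply: eq_bigr => i _; rewrite /pXY mp.
  apply: le_trans err_le _.
  have szK m : #|'I_(sz m)|%:R - 1 <= pow2 (n%:R * (- m - 2 * d)).
    by rewrite card_ord; have [] := szP m.
  have szG m : pow2 (n%:R * (- m - 2 * d)) <= (sz m)%:R by have [] := szP m.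
  have [hT hU hV hW] := And4 (hash_loss_le (szK mT)) (hash_loss_le (szK mU))
    (hash_loss_le (szK mV)) (hash_loss_le (szK mW)).
  have gap1 : mT + mU - m1 + 8 * d <= R0 by move: gap0; rewrite E0.
  have gap2 : mU - m2 + 8 * d <= R0 by apply: le_trans gap0; rewrite lerD2r; exact: E0U.
  have gap4 : mV - m4 + 8 * d <= RX by move: gapX; rewrite Ea.
  have gap5 : mW - m5 + 8 * d <= RY by move: gapY; rewrite Eb.
  have gap3 : mT + mV + mW - m3 + 8 * d <= RX + RY by move: gapXY; rewrite Ec.
  have gap6 : mV + mW - m6 + 8 * d <= RX + RY.
    by apply: le_trans gapXY; rewrite lerD2r; exact: EcVW.
  have [b1 b2 [b3 b4 b5 b6]] := collision_bounds (szG mT) (szG mU) (szG mV) (szG mW)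
    M0b MXb MYb gap1 gap2 gap4 gap5 gap3 gap6 d_gt0.
  have eh : pow2 (- (n%:R * d)) <= h.
    exact: pow2_half_le.
  have hn : h <= 2 / (d * ln (IZR 2)) / n%:R.
    rewrite /h pow2N; have l0 : 0 < n%:R * d / 2 * ln (IZR 2).
      by rewrite !mulr_gt0 // invr_gt0 ltr0n.
    apply: (@le_trans _ _ (n%:R * d / 2 * ln (IZR 2))^-1).
      by rewrite lef_pV2 ?posrE ?pow2_gt0 //; exact: pow2_lin.
    rewrite le_eqVlt; apply/orP; left; apply/eqP; field.
    by rewrite !gt_eqF.
  have -> : C / n%:R = c / n%:R + 28 * (2 / (d * ln (IZR 2)) / n%:R).
    by rewrite /C; field; rewrite !gt_eqF.
  rewrite -/h in hT hU hV hW.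
  exact: sum_error_le b1 b2 b3 b4 b5 b6 hT hU hV hW eh hn.
set P := fun z : {ffun 'I_n -> X} * {ffun 'I_n -> Y} => _ => err_le.
have PP : pmf P.
  have := pn_pmf (pXY_pmf q0 q1 x0 y0 t0 u0 v0 w0) 'I_n.
  by congr pmf; apply: boolp.funext => z; apply: eq_bigr => i _; rewrite /pXY mp.
pose rec F (g : V -> T -> W -> F) a b : n.-tuple F :=
  [tuple g ((psi a b).1.2 i) ((psi a b).1.1 i) ((psi a b).2 i) | i < n].
exists (phi0 \o @ffun_of_tuple n X), (phiX \o @ffun_of_tuple n X),
  (fun y => phiY (ffun_of_tuple y)), (@rec F1 g1), (@rec F2 g2).
have C0 : 0 <= C / n%:R.
  by apply: le_trans err_le; apply: avg_ge0 => z; [exact: (PP).1|rewrite ler0n].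
(* The total cost is at most [n (D + d)] on the good event and at most [n B] otherwise; [d] and
   [B C / n] each take half of [eps]. *)
have distle (F : finType) f dd (g : V -> T -> W -> F) D B (HD : 0 <= D) (B0 : 0 <= B)
    (HB : forall z, dd z.1 z.2 <= B)
    (Bn : B * (C / n%:R) <= eps / 2)
    (wi : forall (x : {ffun 'I_n -> X}) (y : {ffun 'I_n -> Y}) a,
       within_cost c1 c2 D1 D2 d x y a ->
       \sum_i dd (f (x i) (y i)) (g (a.1.2 i) (a.1.1 i) (a.2 i)) <= n%:R * (D + d)) :
    avg_dist p f dd (fun xs ys => rec F g ((phiX \o @ffun_of_tuple n X) xs)
      (phiY (ffun_of_tuple ys) ((phi0 \o @ffun_of_tuple n X) xs))) <= D + eps.
  rewrite avg_distE -/P mulrC ler_pdivrMr //.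
  apply: (@le_trans _ _ (avg P (fun z => n%:R * (D + d) + n%:R * B *
     (~~ within_cost c1 c2 D1 D2 d z.1 z.2
       (psi (phiX z.1) (phiY z.2 (phi0 z.1))))%:R))).
    apply: ler_avg => [|z]; first exact: (PP).1.
    rewrite /= !tuple_of_ffunK; set a := psi _ _.
    under eq_bigr => i _ do rewrite tnth_mktuple -/a.
    case: (boolP (within_cost _ _ _ _ _ _ _ _)) => [ok|_] /=.
      by rewrite mulr0 addr0; exact: wi ok.
    rewrite mulr1; apply: (@le_trans _ _ (n%:R * B)).
      apply: (@le_trans _ _ (\sum_(i < n) B)); last first.
        by rewrite sumr_const card_ord -[leLHS]mulr_natl.
      by apply: ler_sum => i _; exact: (HB (f (z.1 i) (z.2 i), g _ _ _)).
    by rewrite lerDr mulr_ge0 ?ler0n ?addr_ge0 // ltW.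
  rewrite avgD avg_cst // avgZ -mulrA -mulrDr [leRHS]mulrC ler_pM2l //.
  have : B * avg P (fun z => (~~ within_cost c1 c2 D1 D2 d z.1 z.2
       (psi (phiX z.1) (phiY z.2 (phi0 z.1))))%:R) <= B * (C / n%:R).
    exact: ler_wpM2l.
  move: Bn d_eps; lra.
have BB (b : RR) : b <= B1 + B2 -> b * (C / n%:R) <= eps / 2.
  by move=> bb; apply: le_trans errn; rewrite -[leRHS]mulrA; apply: ler_wpM2r.
split; apply/RleP.
  apply: (distle F1 f1 d1 g1 D1 B1) => //; first by apply: BB; rewrite lerDl.
  by move=> x y a /andP[] + _; rewrite card_ord.
apply: (distle F2 f2 d2 g2 D2 B2) => //; first by apply: BB; rewrite lerDr.
by move=> x y a /andP[] _; rewrite card_ord.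
Qed.

End Achievability.

(** * Carathéodory reduction *)

Section Caratheodory.
Variables (R : realFieldType) (I K : finType) (h : K -> I -> R) (c : I -> R).
Variable nu : K -> R.

Lemma linear_dependence (S : {set I}) : (#|K| < #|S|)%N -> exists mu : I -> R,
  [/\ exists i, mu i != 0, forall i, mu i != 0 -> i \in S
    & forall k, \sum_i mu i * h k i = 0].
Proof.
move=> KS; pose A : 'M[R]_(#|S|, #|K|) := \matrix_(i, k) h (enum_val k) (enum_val i).
have : kermx A != 0.
  rewrite kermx_eq0 /row_free; apply: contraL KS => /eqP rA.
  by rewrite -leqNgt -rA rank_leq_col.
case/rowV0Pn => v /sub_kermxP vA v0.
pose mu i := \sum_j (enum_val j == i)%:R * v 0 j.
have muE F : \sum_i mu i * F i = \sum_j v 0 j * F (enum_val j).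
  under eq_bigr do rewrite mulr_suml.
  rewrite exchange_big; apply: eq_bigr => j _ /=.
  under eq_bigr => i _ do rewrite eq_sym -mulrA.
  by rewrite sum_ind_eq.
exists mu; split.
- have /existsP[j vj] : [exists j, v 0 j != 0].
    apply: contra_neqT v0; rewrite negb_exists => /forallP v0.
    by apply/rowP => j; apply/eqP; rewrite mxE -[_ == _]negbK v0.
  exists (enum_val j); rewrite /mu.
  under eq_bigr => i _ do rewrite (inj_eq enum_val_inj).
  by rewrite sum_ind_eq.
- move=> i; apply: contra_neqT => iS; apply: big1 => j _.
  case: eqP => [ji|]; last by rewrite mul0r.
  by move: iS; rewrite -ji enum_valP.
move=> k; rewrite muE; have /rowP/(_ (enum_rank k)) := vA.
rewrite !mxE => vAk; rewrite -[RHS]vAk; apply: eq_bigr => j _.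
by rewrite mxE enum_rankK.
Qed.

(** While the support exceeds [#|K|], the weights move along a linear dependence supported in it,
    oriented so that the cost does not increase, until one of them vanishes. The combination [nu],
    positive on the support, guarantees that a move in that direction does hit zero. *)
Lemma caratheodory_support (lam : I -> R) : (forall i, 0 <= lam i) ->
  (forall i, lam i != 0 -> 0 < \sum_k nu k * h k i) ->
  exists lam' : I -> R, [/\ forall i, 0 <= lam' i,
    forall k, \sum_i lam' i * h k i = \sum_i lam i * h k i,
    \sum_i lam' i * c i <= \sum_i lam i * c i
    & (#|[set i | lam' i != 0%R]| <= #|K|)%N].
Proof.
have [m] := ubnP #|[set i | lam i != 0]|; elim: m lam => // m IHm lam lem lam0 pos.
have [le|gt] := leqP #|[set i | lam i != 0]| #|K|; first by exists lam.
have [mu0 [[i1 mu1] muS0 muh0]] := linear_dependence gt.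
have [mu [[i2 mu2] muS muh muc]] : exists mu : I -> R,
    [/\ exists i, mu i != 0, forall i, mu i != 0 -> lam i != 0,
      forall k, \sum_i mu i * h k i = 0 & \sum_i mu i * c i <= 0].
  have {}muS0 i : mu0 i != 0 -> lam i != 0 by move/muS0; rewrite inE.
  have [le0|gt0] := leP (\sum_i mu0 i * c i) 0; first by exists mu0; split=> //; exists i1.
  exists (fun i => - mu0 i); split.
  - by exists i1; rewrite oppr_eq0.
  - by move=> i; rewrite oppr_eq0; exact: muS0.
  - by move=> k; under eq_bigr do rewrite mulNr; rewrite sumrN muh0 oppr0.
  by under eq_bigr do rewrite mulNr; rewrite sumrN oppr_le0 ltW.
pose N i := \sum_k nu k * h k i.
have muN : \sum_i mu i * N i = 0.
  rewrite /N; under eq_bigr do rewrite mulr_sumr.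
  rewrite exchange_big big1 // => k _; under eq_bigr do rewrite mulrCA.
  by rewrite -mulr_sumr muh mulr0.
(* [mu] annihilates a functional that is positive on its support, so its nonzero entries cannot all
   be positive. *)
have [i0 mui0] : exists i, mu i < 0.
  apply/existsP; apply: contraT; rewrite negb_exists => /forallP muge.
  have muN0 i : 0 <= mu i * N i.
    have [->|mi] := eqVneq (mu i) 0; first by rewrite mul0r.
    by apply: mulr_ge0; [rewrite leNgt|apply/ltW/pos/muS].
  move/eqP: muN; rewrite psumr_eq0 => [/allP/(_ i2)|i _]; last exact: muN0.
  rewrite mem_index_enum => /(_ isT); rewrite mulf_eq0 (negPf mu2) /=.
  by rewrite gt_eqF // pos // muS.
(* Ratio test: the first weight to reach zero determines the step length [t], so the others stay
   nonnegative. *)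
have [i mui min_i] := @arg_minP _ R I i0 (fun i => mu i < 0)
  (fun i => lam i / - mu i) mui0.
set t := lam i / - mu i in min_i.
have t0 : 0 <= t by rewrite divr_ge0 // oppr_ge0 ltW.
pose lam1 j := lam j + t * mu j.
have lam10 j : 0 <= lam1 j.
  rewrite /lam1; have [muj|muj] := leP 0 (mu j).
    by apply: addr_ge0; [exact: lam0|exact: mulr_ge0].
  have := min_i j muj; rewrite ler_pdivlMr ?oppr_gt0 // mulrN.
  by rewrite -subr_ge0 opprK.
have lam1i : lam1 i = 0.
  by rewrite /lam1 /t invrN mulrN mulNr -mulrA mulVf ?lt_eqF // mulr1 subrr.
have lam1S j : lam1 j != 0 -> lam j != 0.
  apply: contra_neq => lj; rewrite /lam1 lj add0r.
  have [->|/muS] := eqVneq (mu j) 0; first by rewrite mulr0.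
  by rewrite lj eqxx.
have lam1E F : \sum_j lam1 j * F j = \sum_j lam j * F j + t * \sum_j mu j * F j.
  rewrite mulr_sumr -big_split; apply: eq_bigr => j _ /=.
  by rewrite /lam1 mulrDl mulrA.
have [||lam' [l0 lh lcst lK]] := IHm lam1 _ lam10.
- rewrite -ltnS; apply: leq_trans _ lem; rewrite ltnS; apply: proper_card.
  apply/properP; split; first by apply/subsetP => j; rewrite !inE; exact: lam1S.
  exists i; rewrite !inE ?lam1i ?eqxx // muS //; exact: ltr0_neq0.
- by move=> j /lam1S; exact: pos.
exists lam'; split=> // [k|].
  by rewrite lh lam1E muh mulr0 addr0.
apply: le_trans lcst _; rewrite lam1E gerDl; exact: mulr_ge0_le0.
Qed.

(** Zero weights pad the support to exactly [m] atoms, so that the reductions of V for different t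
    share one index type. *)
Lemma caratheodory (m : nat) (lam : I -> R) (i0 : I) : #|K| = m ->
  (forall i, 0 <= lam i) ->
  (forall i, lam i != 0 -> 0 < \sum_k nu k * h k i) ->
  exists (e : 'I_m -> I) (rho : 'I_m -> R), [/\ forall j, 0 <= rho j,
    forall k, \sum_j rho j * h k (e j) = \sum_i lam i * h k i
    & \sum_j rho j * c (e j) <= \sum_i lam i * c i].
Proof.
move=> Km lam0 pos; have [lam' [l0 lh lcst lK]] := caratheodory_support lam0 pos.
pose S := [set i | lam' i != 0].
pose e (j : 'I_m) := nth i0 (enum S) j.
pose rho (j : 'I_m) := if (j < #|S|)%N then lam' (e j) else 0.
have rhoE F : \sum_j rho j * F (e j) = \sum_i lam' i * F i.
  have -> : \sum_i lam' i * F i = \sum_(i in S) lam' i * F i.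
    rewrite [RHS]big_mkcond; apply: eq_bigr => i _; rewrite inE.
    by case: eqP => //= ->; rewrite mul0r.
  rewrite -[RHS]big_enum [RHS](big_nth i0) -cardE big_mkord.
  rewrite (big_ord_widen _ (fun j => lam' (nth i0 (enum S) j) * F (nth i0 (enum S) j))
    (leq_trans lK (eq_leq Km))).
  rewrite [RHS]big_mkcond; apply: eq_bigr => j _ /=; rewrite /rho /e.
  by case: ifP => // _; rewrite mul0r.
exists e, rho; split=> [j|k|].
- by rewrite /rho; case: ifP.
- by rewrite rhoE lh.
by rewrite rhoE.
Qed.

End Caratheodory.

(** * Reweighting the auxiliary variables *)

Lemma exchange_big4 (R : nmodType) (A B C D : finType) (F : A -> B -> C -> D -> R) :
  \sum_a \sum_b \sum_c \sum_d F a b c d = \sum_c \sum_d \sum_a \sum_b F a b c d.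
Proof.
transitivity (\sum_(z : A * B) \sum_(k : C * D) F z.1 z.2 k.1 k.2).
  rewrite sum_pairE; apply: eq_bigr => a _; apply: eq_bigr => b _.
  by rewrite sum_pairE.
rewrite exchange_big sum_pairE /=; apply: eq_bigr => c _; apply: eq_bigr => d _.
by rewrite sum_pairE.
Qed.

Section Reweight.
Variables (R : realFieldType) (lg : R -> R).
Hypothesis lgM : forall a b, 0 < a -> 0 < b -> lg (a * b) = lg a + lg b.
Variables (X Y T U V W T' U' V' : finType).
Local Notation Om := (X * Y * T * U * V * W)%type.
Local Notation Om' := (X * Y * T' * U' * V' * W)%type.
Variable q : Om -> R.
Hypothesis q0 : forall o, 0 <= q o.
Hypothesis q1 : \sum_o q o = 1.
Hypotheses (cT : chain_TUXY q) (cV : chain_VXTUYW q).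
Variables (e : T' -> T) (eU : U' -> U) (e' : T' -> V' -> V).
Variables (r : T' -> V' -> R) (s : T' -> R) (rho : U' -> R).
Hypotheses (r0 : forall t v, 0 <= r t v) (s0 : forall t, 0 <= s t).
Hypotheses (rho0 : forall u, 0 <= rho u).
Hypothesis rhoE : forall F : U -> R, \sum_u' rho u' * F (eU u') = \sum_u F u.
Local Notation marg := (marg_of q).
Hypothesis rE : forall x y t' u v w,
  \sum_v' r t' v' * m_xtv q (x, y, e t', u, e' t' v', w) =
  s t' * m_xt q (x, y, e t', u, v, w).
Hypothesis sE : forall x y t u v w, \sum_t' s t' * m_xt q (x, y, e t', u, v, w) =
  m_x q (x, y, t, u, v, w).

Definition proj (o : Om') : Om :=
  (oX o, oY o, e (oT o), eU (oU o), e' (oT o) (oV o), oW o).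

(** [s] and [r] are weights relative to the old masses of t and of (t, v). [rE] says that
    reweighting v keeps the masses of (x, t) up to [s], and [sE] that reweighting t keeps the law of
    x. [rho] splits the mass of each u among its preimages. *)
Definition rewt (o : Om') : R := r (oT o) (oV o) * rho (oU o) * q (proj o).

Local Notation marg' := (marg_of rewt).
Let wU (bu : bool) (u : U') : R := if bu then rho u else 1.

Lemma rewt_ge0 o : 0 <= rewt o.
Proof. by rewrite !mulr_ge0. Qed.

Lemma marg_rewt_TV bx bb bu bw o :
  marg' bx bb true bu true bw o =
  r (oT o) (oV o) * wU bu (oU o) * marg bx bb true bu true bw (proj o).
Proof.
have sW o' : marg' true true true true true bw o' =
    r (oT o') (oV o') * wU true (oU o') * marg true true true true true bw (proj o').
  case: bw; first by rewrite !marg_all.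
  case: o' => [[[[[x y] t] u] v] w].
  rewrite -(marg_sumW rewt true true true true true x y t u v w).
  rewrite -(marg_sumW q true true true true true x y (e t) (eU u) (e' t v) w).
  by rewrite mulr_sumr; apply: eq_bigr => w' _; rewrite !marg_all.
have sU o' : marg' true true true bu true bw o' =
    r (oT o') (oV o') * wU bu (oU o') * marg true true true bu true bw (proj o').
  case: bu => //; case: o' => [[[[[x y] t] u] v] w].
  rewrite -(marg_sumU rewt true true true true bw x y t u v w).
  rewrite -(marg_sumU q true true true true bw x y (e t) (eU u) (e' t v) w).
  rewrite -rhoE mulr_sumr; apply: eq_bigr => u' _; rewrite sW /wU /=.
  by rewrite mulr1 mulrA.
have sY o' : marg' true bb true bu true bw o' =
    r (oT o') (oV o') * wU bu (oU o') * marg true bb true bu true bw (proj o').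
  case: bb => //; case: o' => [[[[[x y] t] u] v] w].
  rewrite -(marg_sumY rewt true true bu true bw x y t u v w).
  rewrite -(marg_sumY q true true bu true bw x y (e t) (eU u) (e' t v) w).
  by rewrite mulr_sumr; apply: eq_bigr => y' _; rewrite sU.
case: bx => //; case: o => [[[[[x y] t] u] v] w].
rewrite -(marg_sumX rewt bb true bu true bw x y t u v w).
rewrite -(marg_sumX q bb true bu true bw x y (e t) (eU u) (e' t v) w).
by rewrite mulr_sumr; apply: eq_bigr => x' _; rewrite sY.
Qed.

(** Given (X, T), V is independent of the other coordinates, so summing v out of any marginal
    reduces to the marginal of (x, t, v), where [rE] applies. *)
Lemma marg_rewt_T bx bb bu bw o :
  marg' bx bb true bu false bw o =
  s (oT o) * wU bu (oU o) * marg bx bb true bu false bw (proj o).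
Proof.
have full o' : marg' true bb true bu false bw o' =
    s (oT o') * wU bu (oU o') * marg true bb true bu false bw (proj o').
  case: o' => [[[[[x y] t] u] v] w].
  rewrite -(marg_sumV rewt true bb true bu bw x y t u v w).
  under eq_bigr => v' _ do rewrite marg_rewt_TV.
  rewrite /oT /oU /oV /=.
  apply: (@mulr_cancel_eq _ (m_xt q (proj (x, y, t, u, v, w)))) => [m0|].
    have -> : marg true bb true bu false bw (proj (x, y, t, u, v, w)) = 0.
      exact: (marg_eq0 q0 m0).
    rewrite mulr0 big1 // => v' _.
    have m0' : m_xt q (proj (x, y, t, u, v', w)) = 0 := m0.
    have -> : marg true bb true bu true bw (proj (x, y, t, u, v', w)) = 0.
      exact: (marg_eq0 q0 m0').
    by rewrite mulr0.
  rewrite mulr_sumr.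
  transitivity (\sum_v' r t v' * m_xtv q (x, y, e t, eU u, e' t v', w)
     * (wU bu u * marg true bb true bu false bw (proj (x, y, t, u, v, w)))).
    apply: eq_bigr => v' _.
    have := marg_xtv_cond q0 cV bb bu bw (x, y, e t, eU u, e' t v', w).
    rewrite -[X in _ * X = _]/(m_xt q (proj (x, y, t, u, v, w))).
    rewrite -[X in _ = _ * X]/(marg true bb true bu false bw (proj (x, y, t, u, v, w))).
    move=> ve; transitivity (r t v' * wU bu u *
      (marg true bb true bu true bw (x, y, e t, eU u, e' t v', w)
       * m_xt q (proj (x, y, t, u, v, w)))); first by rewrite mulrC mulrA.
    by rewrite ve; ring.
  rewrite -mulr_suml (rE x y t (eU u) (e' t v) w) -/(proj (x, y, t, u, v, w)).
  rewrite -[m_xt q (x, y, e t, _, _, _)]/(m_xt q (proj (x, y, t, u, v, w))).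
  by ring.
case: bx => //; case: o => [[[[[x y] t] u] v] w].
rewrite -(marg_sumX rewt bb true bu false bw x y t u v w).
rewrite -(marg_sumX q bb true bu false bw x y (e t) (eU u) (e' t v) w).
by rewrite mulr_sumr; apply: eq_bigr => x' _; rewrite full.
Qed.

Lemma marg_rewt_noT bx bb bu bw x y t u v w :
  marg' bx bb false bu false bw (x, y, t, u, v, w) =
  wU bu u * \sum_t' s t' * marg bx bb true bu false bw (x, y, e t', eU u, e' t v, w).
Proof.
rewrite -(marg_sumT rewt bx bb bu false bw x y t u v w) mulr_sumr.
apply: eq_bigr => t' _; rewrite marg_rewt_T /oT /oU /= mulrA.
by rewrite [wU _ _ * _]mulrC.
Qed.

(** [sE] gives the law of x; the chain T - X - Y carries it over to (x, y), and summing out x to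
    y. *)
Lemma marg_rewt_XY bx bb o : bx || bb ->
  marg' bx bb false false false false o = marg bx bb false false false false (proj o).
Proof.
have fullX bb' o' : marg' true bb' false false false false o' =
    marg true bb' false false false false (proj o').
  case: o' => [[[[[x y] t] u] v] w]; rewrite marg_rewt_noT /wU mul1r.
  case: bb'; last exact: (sE x y (e t) (eU u) (e' t v) w).
  apply: (@mulr_cancel_eq _ (m_x q (proj (x, y, t, u, v, w)))) => [m0|].
    have -> : m_xy q (proj (x, y, t, u, v, w)) = 0 by exact: (marg_eq0 q0 m0).
    rewrite big1 // => t' _.
    have m0' : m_x q (x, y, e t', eU u, e' t v, w) = 0 := m0.
    have -> : m_xyt q (x, y, e t', eU u, e' t v, w) = 0 by exact: (marg_eq0 q0 m0').
    by rewrite mulr0.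
  rewrite mulr_sumr.
  transitivity (\sum_t' s t' * m_xt q (x, y, e t', eU u, e' t v, w)
     * m_xy q (proj (x, y, t, u, v, w))).
    apply: eq_bigr => t' _; rewrite mulrCA -[RHS]mulrA; congr (_ * _); rewrite mulrC.
    exact: (marg_xyt cT (x, y, e t', eU u, e' t v, w)).
  by rewrite -mulr_suml (sE x y (e t) (eU u) (e' t v) w).
case: bx => [_|]; first exact: fullX.
case: bb => // _; case: o => [[[[[x y] t] u] v] w].
rewrite -(marg_sumX rewt true false false false false x y t u v w).
rewrite -(marg_sumX q true false false false false x y (e t) (eU u) (e' t v) w).
by apply: eq_bigr => x' _; rewrite fullX.
Qed.

Lemma rewt_sum1 (o0 : Om') : \sum_o rewt o = 1.
Proof.
case: o0 => [[[[[x y] t] u] v] w].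
transitivity (marg' false false false false false false (x, y, t, u, v, w)) => //.
rewrite -(marg_sumX rewt false false false false false x y t u v w).
under eq_bigr => x' _ do rewrite marg_rewt_XY //.
rewrite (marg_sumX q false false false false false x y (e t) (eU u) (e' t v) w).
exact: marg_none.
Qed.

(** A new marginal without t is a sum over [t'], so the first link is checked term by term: the law
    of x given (t, u) depends on u alone, hence agrees for t and [t']. The second link only involves
    factors that cancel. *)
Lemma rewt_chain_TUXY : chain_TUXY rewt.
Proof.
split=> o.
  rewrite !marg_rewt_T; case: o => [[[[[x y] t] u] v] w]; rewrite !marg_rewt_noT.
  rewrite /oT /oU /wU /=.
  have h t' : m_xtu q (x, y, e t, eU u, e' t v, w) * m_tu q (x, y, e t', eU u, e' t v, w)
      = m_tu q (x, y, e t, eU u, e' t v, w) * m_xtu q (x, y, e t', eU u, e' t v, w).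
    apply: (@mulr_cancel_eq _ (m_u q (x, y, e t, eU u, e' t v, w))) => [m0|].
      have -> : m_tu q (x, y, e t, eU u, e' t v, w) = 0 by exact: (marg_eq0 q0 m0).
      have -> : m_xtu q (x, y, e t, eU u, e' t v, w) = 0 by exact: (marg_eq0 q0 m0).
      by rewrite !mul0r.
    have h1 := (cT).1 (x, y, e t, eU u, e' t v, w).
    have h2 := (cT).1 (x, y, e t', eU u, e' t v, w).
    rewrite -[m_u q (x, y, e t', _, _, _)]/(m_u q (x, y, e t, eU u, e' t v, w)) in h2.
    rewrite -[m_xu q (x, y, e t', _, _, _)]/(m_xu q (x, y, e t, eU u, e' t v, w)) in h2.
    move: h1 h2; move: (m_u q _) (m_xu q _) (m_xtu q _) (m_tu q _) (m_xtu q _) (m_tu q _).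
    move=> A B C D E F h1 h2; transitivity (E * A * D); first by ring.
    rewrite h1; transitivity (F * (D * B)); first by ring.
    by rewrite -h2; ring.
  have hS : m_xtu q (x, y, e t, eU u, e' t v, w)
        * (\sum_t' s t' * m_tu q (x, y, e t', eU u, e' t v, w))
      = m_tu q (x, y, e t, eU u, e' t v, w)
        * (\sum_t' s t' * m_xtu q (x, y, e t', eU u, e' t v, w)).
    rewrite !mulr_sumr; apply: eq_bigr => t' _.
    by rewrite mulrCA [RHS]mulrCA h.
  move: hS; rewrite /proj /oX /oY /oT /oU /oV /oW /=.
  move: (\sum_t' _) (\sum_t' _) (m_xtu q _) (m_tu q _) => A B C D hS.
  transitivity (s t * rho u * rho u * (C * B)); first by ring.
  by rewrite hS; ring.
rewrite !marg_rewt_T !marg_rewt_XY // -!mulrA; congr (_ * (_ * _)).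
exact: ((cT).2 (proj o)).
Qed.

Lemma rewt_chain_VXTUYW : chain_VXTUYW rewt.
Proof.
split=> o.
  rewrite !marg_rewt_TV !marg_rewt_T.
  have h := (cV).1 (proj o); move: (r _ _) (s _) (wU _ _) (wU _ _) h => a b c d.
  move: (m_xytuv q _) (m_xt q _) (m_xtv q _) (m_xytu q _) => A B C D h.
  transitivity (a * b * c * d * (A * B)); first by ring.
  by rewrite h; ring.
rewrite marg_rewt_TV; case: o => [[[[[x y] t] u] v] w]; rewrite !marg_rewt_noT.
rewrite /rewt /oT /oU /oV /wU /= -!mulrA; congr (_ * (_ * _)).
rewrite mulrCA [RHS]mulrCA; congr (_ * _); rewrite !mulr_sumr; apply: eq_bigr => t' _.
rewrite mulrCA [RHS]mulrCA; congr (_ * _).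
apply: (@mulr_cancel_eq _ (m_yu q (x, y, e t, eU u, e' t v, w))) => [m0|].
  have -> : m_xytuv q (x, y, e t, eU u, e' t v, w) = 0 by exact: (marg_eq0 q0 m0).
  rewrite -[q _]marg_all.
  have -> : marg true true true true true true (proj (x, y, t, u, v, w)) = 0.
    exact: (marg_eq0 q0 m0).
  by rewrite !mul0r.
have h1 := (cV).2 (x, y, e t, eU u, e' t v, w).
have h2 := marg_ytuw_yu cV (x, y, e t', eU u, e' t v, w).
rewrite -[m_yu q (x, y, e t', _, _, _)]/(m_yu q (x, y, e t, eU u, e' t v, w)) in h2.
rewrite -[m_yuw q (x, y, e t', _, _, _)]/(m_yuw q (x, y, e t, eU u, e' t v, w)) in h2.
rewrite -[q (proj _)]/(q (x, y, e t, eU u, e' t v, w)).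
move: h1 h2; move: (m_yu q _) (q _) (m_ytu q _) (m_xytuv q _) (m_ytuw q _) (m_yuw q _).
move=> A B C D E F h1 h2; transitivity (B * A * C); first by ring.
rewrite h1; transitivity (D * (C * F)); first by ring.
by rewrite -h2; ring.
Qed.

Section SupportR.
Variable o : Om'.
Hypothesis qo : 0 < rewt o.

Let posr : [/\ 0 < r (oT o) (oV o), 0 < rho (oU o) & 0 < q (proj o)].
Proof.
move: qo; rewrite /rewt !lt_neqAle ![0 == _]eq_sym !mulf_eq0 !negb_or.
by move=> /andP[/andP[/andP[-> ->] ->] _]; rewrite r0 rho0 q0.
Qed.

Let poss : 0 < s (oT o).
Proof.
have := marg_gt0 rewt_ge0 true false true false false false qo.
rewrite marg_rewt_T /wU mulr1 lt_neqAle eq_sym mulf_eq0 negb_or => /andP[/andP[h _] _].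
by rewrite lt_neqAle eq_sym h s0.
Qed.

Let wUp bu : 0 < wU bu (oU o).
Proof. by case: bu => //=; have [] := posr. Qed.

Let lgTV bx bb bu bw : lg (marg' bx bb true bu true bw o) =
  lg (r (oT o) (oV o)) + lg (wU bu (oU o)) + lg (marg bx bb true bu true bw (proj o)).
Proof.
have [rp _ qp] := posr.
by rewrite marg_rewt_TV lgM ?lgM ?mulr_gt0 ?marg_gt0.
Qed.

Let lgT bx bb bu bw : lg (marg' bx bb true bu false bw o) =
  lg (s (oT o)) + lg (wU bu (oU o)) + lg (marg bx bb true bu false bw (proj o)).
Proof.
have [_ _ qp] := posr.
by rewrite marg_rewt_T lgM ?lgM ?mulr_gt0 ?marg_gt0.
Qed.

Let lg1 : lg (wU false (oU o)) = 0.
Proof. exact: lg_one lgM. Qed.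

(** The marginals of (x, y, u) and (y, u) may change with the law of t. In [info_U_T] every marginal
    either retains t or involves x and y only, so the weights cancel in the logarithms. *)
Lemma info_U_rewt : info_U lg rewt o = info_U lg q (proj o).
Proof.
have [_ _ qp] := posr.
rewrite (info_U_T lgM rewt_ge0 rewt_chain_TUXY qo) (info_U_T lgM q0 cT qp).
by rewrite !lgT !marg_rewt_XY //; ring.
Qed.

Lemma info_V_rewt : info_V lg rewt o = info_V lg q (proj o).
Proof. by rewrite /info_V !lgTV !lgT; ring. Qed.

Lemma info_W_rewt : info_W lg rewt o = info_W lg q (proj o).
Proof. by rewrite /info_W !lgTV; ring. Qed.

Lemma info_sum_rewt : info_sum lg rewt o = info_sum lg q (proj o).
Proof.
rewrite /info_sum -(marg_all rewt o) -(marg_all q (proj o)) !lgTV !marg_rewt_XY //; ring.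
Qed.

End SupportR.

(** The share of (t, v) in the average of [G]. It becomes the coefficient of the weight of (t, v),
    which makes averages under [rewt] linear in [r]. *)
Definition slice (G : Om -> R) t v : R :=
  \sum_x \sum_y \sum_u \sum_w q (x, y, t, u, v, w) * G (x, y, t, u, v, w).

Lemma avg_rewt (G : Om -> R) :
  avg rewt (fun o => G (proj o)) = \sum_t \sum_v r t v * slice G (e t) (e' t v).
Proof.
rewrite /avg !sum_pairE /=.
transitivity (\sum_x \sum_y \sum_t \sum_v r t v *
   \sum_u \sum_w q (x, y, e t, u, e' t v, w) * G (x, y, e t, u, e' t v, w)).
  apply: eq_bigr => x _; apply: eq_bigr => y _; apply: eq_bigr => t _.
  rewrite exchange_big /=; apply: eq_bigr => v _.
  rewrite -rhoE mulr_sumr; apply: eq_bigr => u _; rewrite mulrA mulr_sumr.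
  by apply: eq_bigr => w _; rewrite /rewt /proj /oX /oY /oT /oU /oV /oW /= !mulrA.
rewrite (exchange_big4 (fun x y t v => r t v *
   \sum_u \sum_w q (x, y, e t, u, e' t v, w) * G (x, y, e t, u, e' t v, w))).
apply: eq_bigr => t _; apply: eq_bigr => v _.
rewrite /slice mulr_sumr; apply: eq_bigr => x _.
by rewrite mulr_sumr.
Qed.

End Reweight.

(* [A], [B], [C] are the bounds on [RX], [RY], [RX + RY]; the point of the pentagon is
   dominated by a mixture of its corner points [(A, C - A)] and [(C - B, B)]. *)
Lemma corner_mixture (A B C a b : RR) : A < a -> B < b -> C < a + b -> A + B <= C ->
  exists th, [/\ 0 <= th, th <= 1, th * A + (1 - th) * (C - B) < a
    & th * (C - A) + (1 - th) * B < b].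
Proof.
move=> Aa Bb Cab ABC.
have [h|h] := ltP (C - B) a; first by exists 0; split; lra.
have gap : 0 < C - B - A by lra.
(* On the segment of corner points the coordinates add up to C, so a first coordinate strictly
   between C - b and a meets both bounds. The midpoint [s] of [l] and [a] is such a value, and [th]
   is solved from it. *)
pose l := Num.max A (C - b).
have [lA lb] : A <= l /\ C - b <= l by rewrite /l !le_max !lexx orbT.
have la : l < a by rewrite /l gt_max Aa; lra.
pose s := (l + a) / 2.
have sE : (C - B - s) / (C - B - A) * (C - B - A) = C - B - s.
  by rewrite divfK // gt_eqF.
have th0 : 0 <= (C - B - s) / (C - B - A).
  by rewrite divr_ge0 // ?(ltW gap) // /s; lra.
have th1 : (C - B - s) / (C - B - A) <= 1.
  by rewrite ler_pdivrMr // /s; lra.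
exists ((C - B - s) / (C - B - A)).
move: (_ / _) sE th0 th1 => th sE th0 th1; rewrite /s in sE; split; lra.
Qed.

(** * Reduction of the alphabets of T, V and W *)

Section Cardinality.
Variables (X Y F1 F2 : finType) (p : X -> Y -> RR).
Variables (f1 : X -> Y -> F1) (f2 : X -> Y -> F2).
Variables (d1 : F1 -> F1 -> RR) (d2 : F2 -> F2 -> RR) (D1 D2 R0 RX RY : RR).
Variables (T U V W : finType) (q : X * Y * T * U * V * W -> RR).
Variables (g1 : V -> T -> W -> F1) (g2 : V -> T -> W -> F2).
Local Notation Om := (X * Y * T * U * V * W)%type.
Hypothesis qin : inner_region p f1 f2 d1 d2 D1 D2 R0 RX RY q g1 g2.
Local Notation marg := (marg_of q).
Let q0 : forall o, 0 <= q o := (qin.1).1.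
Let q1 : \sum_o q o = 1 := (qin.1).2.
Let cT : chain_TUXY q := qin.2.2.1.
Let cV : chain_VXTUYW q := qin.2.2.2.1.
Variables (x0 : X) (y0 : Y) (t0 : T) (u0 : U) (v0 : V) (w0 : W).

Let C1 (o : Om) := d1 (f1 (oX o) (oY o)) (g1 (oV o) (oT o) (oW o)).
Let C2 (o : Om) := d2 (f2 (oX o) (oY o)) (g2 (oV o) (oT o) (oW o)).
Let I0 := info_U log2 q.
Let Ia := info_V log2 q.
Let Ib := info_W log2 q.
Let Ic := info_sum log2 q.

Let lc0 : 0 <= (ln (IZR 2))^-1.
Proof. by rewrite invr_ge0 ltW ?ln2_gt0. Qed.

Definition sliceT (G : Om -> RR) t := \sum_v slice q G t v.

Lemma slice_eq0 G t v : m_tv q (x0, y0, t, u0, v, w0) = 0 -> slice q G t v = 0.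
Proof.
move=> m0; apply: big1 => x _; apply: big1 => y _; apply: big1 => u _.
apply: big1 => w _; have m0' : m_tv q (x, y, t, u, v, w) = 0 := m0.
by rewrite -marg_all (marg_eq0 q0 m0') // mul0r.
Qed.

Lemma sliceT_eq0 G t : m_t q (x0, y0, t, u0, v0, w0) = 0 -> sliceT G t = 0.
Proof.
move=> m0; apply: big1 => v _; apply: slice_eq0.
have m0' : m_t q (x0, y0, t, u0, v, w0) = 0 := m0.
exact: (marg_eq0 q0 m0').
Qed.

Lemma sliceTE G t : sliceT G t = avg (fun o => if oT o == t then q o else 0) G.
Proof.
rewrite /sliceT /slice exchange_big /avg !sum_pairE /=; apply: eq_bigr => x _.
rewrite exchange_big /=; apply: eq_bigr => y _.
rewrite (bigD1 t) //= [X in _ = _ + X]big1 ?addr0 => [|t' /negPf tt'].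
  rewrite exchange_big /=; apply: eq_bigr => u _; apply: eq_bigr => v _.
  by apply: eq_bigr => w _; rewrite /oT /= eqxx.
apply: big1 => u _; apply: big1 => v _; apply: big1 => w _.
by rewrite /oT /= tt' mul0r.
Qed.

Lemma sum_sliceT G : \sum_t sliceT G t = avg q G.
Proof.
rewrite [RHS]/avg (partition_big (@oT X Y T U V W) xpredT) //=; apply: eq_bigr => t _.
rewrite sliceTE /avg [RHS]big_mkcond; apply: eq_bigr => o _ /=.
by case: ifP => // _; rewrite mul0r.
Qed.

(** The difference is the probability of t times the divergence of the law of X given t from that of
    X, plus I(V;W|T = t). Hence the corner points of each t lie above (A, B). *)
Lemma sliceT_corner t : sliceT Ia t + sliceT Ib t <= sliceT Ic t.
Proof.
have hX := avg_X_given_t_ge0 log2M lc0 log2_ge q0 q1 t.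
have hVW := avg_VW_given_t_ge0 log2M lc0 log2_ge q0 t.
have h := addr_ge0 hX hVW; rewrite -avgD in h.
rewrite !sliceTE -avgD -subr_ge0 -avgB; move: h; congr (_ <= _).
apply: eq_bigr => o _; case: ifP => _; last by rewrite !mul0r.
have [->|qo] := eqVneq (q o) 0; first by rewrite !mul0r.
have {}qo : 0 < q o by rewrite lt_neqAle q0 eq_sym qo.
rewrite /Ia /Ib /Ic (info_V_kernels log2M q0 cV qo) (info_W_kernels log2M q0 cV qo).
rewrite (info_sum_kernels log2M q0 cT cV qo); congr (_ * _); ring.
Qed.

Let G5 (k : 'I_5) : Om -> RR := nth C1 [:: I0; Ia; Ib; Ic; C1] k.

(** The constraints are the masses of (x, t) and the slices of four densities and the first
    distortion; the slice of the second distortion is minimised. The masses of (x, t) secure every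
    marginal without v, by [marg_rewt_T]. *)
Lemma reduce_V t : exists er : ('I_(#|X| + 5) -> V) * ('I_(#|X| + 5) -> RR),
  [/\ forall j, 0 <= er.2 j,
   forall x, \sum_j er.2 j * m_xtv q (x, y0, t, u0, er.1 j, w0)
     = m_xt q (x, y0, t, u0, v0, w0),
   forall k, \sum_j er.2 j * slice q (G5 k) t (er.1 j) = sliceT (G5 k) t
   & \sum_j er.2 j * slice q C2 t (er.1 j) <= sliceT C2 t].
Proof.
pose h (k : X + 'I_5) v := match k with
  | inl x => m_xtv q (x, y0, t, u0, v, w0) | inr k => slice q (G5 k) t v end.
pose nu (k : X + 'I_5) : RR := match k with inl _ => 1 | inr _ => 0 end.
(* Weight one everywhere is the current law. Letters of mass zero are removed because [caratheodory]
   asks for a functional positive on the support, here the mass of (t, v). *)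
pose lam v : RR := if m_tv q (x0, y0, t, u0, v, w0) == 0 then 0 else 1.
have lamE F : (forall v, m_tv q (x0, y0, t, u0, v, w0) = 0 -> F v = 0) ->
    \sum_v lam v * F v = \sum_v F v.
  move=> F0; apply: eq_bigr => v _; rewrite /lam.
  by case: eqP => [/F0->|_]; rewrite ?mulr0 ?mul1r.
have [||| e [rh [rh0 rhE rhC]]] := @caratheodory _ V (X + 'I_5)%type h
  (slice q C2 t) nu (#|X| + 5) lam v0.
- by rewrite card_sum card_ord.
- by move=> v; rewrite /lam; case: ifP; rewrite ?ler01.
- move=> v; rewrite /lam; have [_|n0 _] := eqVneq (m_tv q (x0, y0, t, u0, v, w0)) 0.
    by rewrite eqxx.
  rewrite big_sumType /= [X in _ + X]big1 ?addr0 => [|k _]; last by rewrite mul0r.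
  under eq_bigr do rewrite mul1r.
  rewrite (marg_sumX q false true false true false x0 y0 t u0 v w0).
  by rewrite lt_neqAle eq_sym n0 marg_ge0.
exists (e, rh); split=> //=.
- move=> x; rewrite (rhE (inl x)) lamE => [|v m0].
    exact: (marg_sumV q true false true false false x y0 t u0 v0 w0).
  have m0' : m_tv q (x, y0, t, u0, v, w0) = 0 := m0.
  exact: (marg_eq0 q0 m0').
- by move=> k; rewrite (rhE (inr k)) lamE // => v; exact: slice_eq0.
by apply: le_trans rhC _; rewrite lamE // => v; exact: slice_eq0.
Qed.

Let RXf (z : T * bool) := if z.2 then sliceT Ia z.1 else sliceT Ic z.1 - sliceT Ib z.1.
Let RYf (z : T * bool) := if z.2 then sliceT Ic z.1 - sliceT Ia z.1 else sliceT Ib z.1.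

(** Each t is doubled, one copy per corner point, with relative weights [th] and [1 - th] from
    [corner_mixture]. After the reduction the flag is forgotten: for each atom [sliceT_corner] gives
    Ia <= RXf and Ib <= RYf, while Ic = RXf + RYf, which returns the three rate constraints. *)
Lemma reduce_T : exists (e : 'I_(#|X| + 4) -> T) (s : 'I_(#|X| + 4) -> RR),
  [/\ forall j, 0 <= s j,
   forall x, \sum_j s j * m_xt q (x, y0, e j, u0, v0, w0) = m_x q (x, y0, t0, u0, v0, w0),
   [/\ \sum_j s j * sliceT I0 (e j) < R0, \sum_j s j * sliceT Ia (e j) < RX,
   \sum_j s j * sliceT Ib (e j) < RY & \sum_j s j * sliceT Ic (e j) < RX + RY]
   & \sum_j s j * sliceT C1 (e j) <= D1 /\ \sum_j s j * sliceT C2 (e j) <= D2].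
Proof.
have [_ [_ [_ [_ [e1 [e2 [r0 [rx [ry rxy]]]]]]]]] := qin.
have AB : avg q Ia + avg q Ib <= avg q Ic.
  by rewrite -!sum_sliceT -big_split; apply: ler_sum => t _; exact: sliceT_corner.
have [th [th0 th1 thX thY]] := corner_mixture rx ry rxy AB.
pose h (k : X + 'I_4) (z : T * bool) : RR := match k with
  | inl x => m_xt q (x, y0, z.1, u0, v0, w0)
  | inr k => nth (sliceT C1 z.1) [:: sliceT I0 z.1; RXf z; RYf z; sliceT C1 z.1] k end.
pose nu (k : X + 'I_4) : RR := match k with inl _ => 1 | inr _ => 0 end.
pose lam (z : T * bool) : RR := if m_t q (x0, y0, z.1, u0, v0, w0) == 0 then 0
  else if z.2 then th else 1 - th.
have lamE (F : T * bool -> RR) :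
    (forall z, m_t q (x0, y0, z.1, u0, v0, w0) = 0 -> F z = 0) ->
    \sum_z lam z * F z = \sum_t (th * F (t, true) + (1 - th) * F (t, false)).
  move=> F0; rewrite sum_pairE; apply: eq_bigr => t _; rewrite big_bool /lam /=.
  by case: eqP => // m0; rewrite !F0 //= !mulr0.
have lamE1 (F : T -> RR) : (forall t, m_t q (x0, y0, t, u0, v0, w0) = 0 -> F t = 0) ->
    \sum_z lam z * F z.1 = \sum_t F t.
  move=> F0; rewrite (lamE (fun z => F z.1)) => [|z]; last exact: F0.
  by apply: eq_bigr => t _ /=; ring.
have [||| E [s [s0 sh sc]]] := @caratheodory _ (T * bool)%type (X + 'I_4)%type h
  (fun z => sliceT C2 z.1) nu (#|X| + 4) lam (t0, true).
- by rewrite card_sum card_ord.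
- move=> z; rewrite /lam; case: ifP => // _; case: ifP => // _.
  by rewrite subr_ge0.
- move=> [t b]; rewrite /lam /=.
  have [_|n0 _] := eqVneq (m_t q (x0, y0, t, u0, v0, w0)) 0; first by rewrite eqxx.
  rewrite big_sumType /= [X in _ + X]big1 ?addr0 => [|k _]; last by rewrite mul0r.
  under eq_bigr do rewrite mul1r.
  rewrite (marg_sumX q false true false false false x0 y0 t u0 v0 w0).
  by rewrite lt_neqAle eq_sym n0 marg_ge0.
have sX : \sum_j s j * RXf (E j) < RX.
  rewrite (sh (inr (@Ordinal 4 1 isT))) lamE => [|z m0]; last first.
    by rewrite /= /RXf !(sliceT_eq0 _ m0) subrr; case: ifP.
  rewrite /= /RXf /= big_split /= -!mulr_sumr sumrB !sum_sliceT.
  exact: thX.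
have sY : \sum_j s j * RYf (E j) < RY.
  rewrite (sh (inr (@Ordinal 4 2 isT))) lamE => [|z m0]; last first.
    by rewrite /= /RYf !(sliceT_eq0 _ m0) subrr; case: ifP.
  rewrite /= /RYf /= big_split /= -!mulr_sumr sumrB !sum_sliceT.
  exact: thY.
exists (fun j => (E j).1), s; split=> //.
- move=> x; rewrite (sh (inl x)) (lamE1 (fun t => m_xt q (x, y0, t, u0, v0, w0))).
    exact: (marg_sumT q true false false false false x y0 t0 u0 v0 w0).
  move=> t m0; have m0' : m_t q (x, y0, t, u0, v0, w0) = 0 := m0.
  exact: (marg_eq0 q0 m0').
- split.
  + rewrite (sh (inr (@Ordinal 4 0 isT))) (lamE1 (sliceT I0)) ?sum_sliceT //.
    by move=> t; exact: sliceT_eq0.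
  + apply: le_lt_trans sX; apply: ler_sum => j _; apply: ler_wpM2l => //.
    rewrite /RXf; case: ifP => // _; have := sliceT_corner (E j).1; lra.
  + apply: le_lt_trans sY; apply: ler_sum => j _; apply: ler_wpM2l => //.
    rewrite /RYf; case: ifP => // _; have := sliceT_corner (E j).1; lra.
  have -> : \sum_j s j * sliceT Ic (E j).1 =
      \sum_j s j * RXf (E j) + \sum_j s j * RYf (E j).
    rewrite -big_split; apply: eq_bigr => j _; rewrite /= -mulrDr /RXf /RYf.
    by case: ifP => _; congr (_ * _); ring.
  exact: ltrD.
split.
  rewrite (sh (inr (@Ordinal 4 3 isT))) (lamE1 (sliceT C1)) ?sum_sliceT //.
  by move=> t; exact: sliceT_eq0.
apply: le_trans sc _; rewrite (lamE1 (sliceT C2)) ?sum_sliceT //.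
by move=> t; exact: sliceT_eq0.
Qed.

Lemma cardinality_inner : exists (T' U' V' W' : finType)
    (q' : X * Y * T' * U' * V' * W' -> RR)
    (g1' : V' -> T' -> W' -> F1) (g2' : V' -> T' -> W' -> F2),
  inner_region p f1 f2 d1 d2 D1 D2 R0 RX RY q' g1' g2' /\
  (#|T'| <= #|X| + 4)%N /\ (#|V'| <= (#|X| + 4) * #|X| + 1)%N /\
  (#|W'| <= #|U'| * #|Y| + 1)%N.
Proof.
have [e [s [s0 sx [sI0 sIa sIb sIc] [sC1 sC2]]]] := reduce_T.
have [er erP] := fin_all_exists reduce_V.
have X0 : (0 < #|X|)%N by apply/card_gt0P; exists x0.
have W0 : (0 < #|W|)%N by apply/card_gt0P; exists w0.
pose T' : finType := 'I_(#|X| + 4); pose V' : finType := 'I_(#|X| + 5).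
pose U' : finType := (U * W)%type.
pose eU (u : U') := u.1.
pose e' (t : T') (v : V') := (er (e t)).1 v.
(* The reduction of V is made at the old letter [e t] and scaled by the new weight of t, which is
   what [rE] asks for. *)
pose r (t : T') (v : V') := s t * (er (e t)).2 v.
pose rho (u : U') : RR := #|W|%:R^-1.
pose q' := rewt q e eU e' r rho.
have r0 t v : 0 <= r t v by rewrite mulr_ge0 //; have [] := erP (e t).
have rho0 u : 0 <= rho u by rewrite invr_ge0 ler0n.
have rhoE (F : U -> RR) : \sum_u' rho u' * F (eU u') = \sum_u F u.
  rewrite sum_pairE; apply: eq_bigr => u _; rewrite /rho /eU /= sumr_const.
  by rewrite -[LHS]mulr_natl mulrA mulfV ?mul1r // pnatr_eq0 -lt0n.
have rE x y t' u v w : \sum_v' r t' v' * m_xtv q (x, y, e t', u, e' t' v', w) =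
    s t' * m_xt q (x, y, e t', u, v, w).
  have [_ + _ _] := erP (e t'); move=> /(_ x) h.
  rewrite -[m_xt q _]/(m_xt q (x, y0, e t', u0, v0, w0)) -h mulr_sumr.
  by apply: eq_bigr => v' _; rewrite mulrA.
have sE x y t u v w : \sum_t' s t' * m_xt q (x, y, e t', u, v, w) =
    m_x q (x, y, t, u, v, w).
  exact: (sx x).
pose j0 : T' := Ordinal (ltn_addl #|X| (isT : 0 < 4)%N).
pose i0' : V' := Ordinal (ltn_addl #|X| (isT : 0 < 5)%N).
have q'0 o : 0 <= q' o by apply: rewt_ge0.
have q'1 : \sum_o q' o = 1.
  exact: (rewt_sum1 q0 q1 cT cV rhoE rE sE (x0, y0, j0, (u0, w0), i0', w0)).
have q'E (G G' : X * Y * T' * U' * V' * W -> RR) :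
    (forall o, 0 < q' o -> G o = G' o) -> avg q' G = avg q' G'.
  exact: eq_avg_supp.
have avgG (k : 'I_5) : avg q' (fun o => G5 k (proj e eU e' o)) =
    \sum_j s j * sliceT (G5 k) (e j).
  rewrite /q' avg_rewt //; apply: eq_bigr => j _.
  have [_ _ + _] := erP (e j); move=> /(_ k) <-; rewrite mulr_sumr.
  by apply: eq_bigr => i _; rewrite mulrA.
exists T', U', V', W, q', (fun v t w => g1 (e' t v) (e t) w),
  (fun v t w => g2 (e' t v) (e t) w); split; last first.
  rewrite !card_ord card_prod; split=> //; split.
    (* Since X is nonempty, |X| <= |X| |X| and 4 <= 4 |X|. *)
    rewrite mulnDl -[(_ + 5)%N]/(#|X| + (4 + 1))%N addnA leq_add2r.
    by rewrite leq_add ?leq_pmulr // -[X in (X <= _)%N]muln1 leq_mul2l X0.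
  have U0 : (0 < #|U|)%N by apply/card_gt0P; exists u0.
  have Y0 : (0 < #|Y|)%N by apply/card_gt0P; exists y0.
  by rewrite addn1 ltnW // ltnS; apply: leq_trans (leq_pmulr _ Y0); rewrite leq_pmull.
split; first by split.
split; first by move=> o; rewrite (marg_rewt_XY q0 cT cV rhoE rE sE) // (qin.2.1).
split; first exact: (rewt_chain_TUXY q0 cT cV rhoE rE sE).
split; first exact: (rewt_chain_VXTUYW q0 cV rhoE rE).
split; first by have := avgG (@Ordinal 5 4 isT) => /= ->.
split.
  apply: le_trans sC2; rewrite -[leLHS]/(avg q' (fun o => C2 (proj e eU e' o))).
  rewrite /q' avg_rewt //; apply: ler_sum => j _.
  have [_ _ _ h] := erP (e j); apply: le_trans (ler_wpM2l (s0 j) h).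
  by rewrite mulr_sumr; apply: ler_sum => i _; rewrite mulrA.
split.
  rewrite (q'E _ (fun o => I0 (proj e eU e' o))) => [|o qo].
    by have := avgG (@Ordinal 5 0 isT) => /= ->.
  exact: (info_U_rewt log2M q0 cT cV r0 s0 rho0 rhoE rE sE qo).
split.
  rewrite (q'E _ (fun o => Ia (proj e eU e' o))) => [|o qo].
    by have := avgG (@Ordinal 5 1 isT) => /= ->.
  exact: (info_V_rewt log2M q0 cV r0 s0 rho0 rhoE rE qo).
split.
  rewrite (q'E _ (fun o => Ib (proj e eU e' o))) => [|o qo].
    by have := avgG (@Ordinal 5 2 isT) => /= ->.
  exact: (info_W_rewt log2M q0 r0 rho0 rhoE qo).
rewrite (q'E _ (fun o => Ic (proj e eU e' o))) => [|o qo].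
  by have := avgG (@Ordinal 5 3 isT) => /= ->.
exact: (info_sum_rewt log2M q0 cT cV r0 rho0 rhoE rE sE qo).
Qed.

End Cardinality.

Local Close Scope ring_scope.
Local Open Scope R_scope.

Theorem theorem7 (X Y F1 F2 : finType) (p : X -> Y -> R)
  (f1 : X -> Y -> F1) (f2 : X -> Y -> F2)
  (d1 : F1 -> F1 -> R) (d2 : F2 -> F2 -> R)
  (Hp : is_pmf (fun xy : X * Y => p xy.1 xy.2))
  (Hd1 : forall a b, 0 <= d1 a b) (Hd2 : forall a b, 0 <= d2 a b)
  (D1 D2 : R) (HD1 : 0 <= D1) (HD2 : 0 <= D2) :
  (forall (R0 RX RY : R) (T U V W : finType) (q : X * Y * T * U * V * W -> R)
          (g1 : V -> T -> W -> F1) (g2 : V -> T -> W -> F2),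
      inner_cond p f1 f2 d1 d2 D1 D2 R0 RX RY q g1 g2 ->
      achievable p f1 f2 d1 d2 D1 D2 R0 RX RY)
  /\
  (forall (R0 RX RY : R) (T U V W : finType) (q : X * Y * T * U * V * W -> R)
          (g1 : V -> T -> W -> F1) (g2 : V -> T -> W -> F2),
      inner_cond p f1 f2 d1 d2 D1 D2 R0 RX RY q g1 g2 ->
      exists (T' U' V' W' : finType) (q' : X * Y * T' * U' * V' * W' -> R)
             (g1' : V' -> T' -> W' -> F1) (g2' : V' -> T' -> W' -> F2),
        inner_cond p f1 f2 d1 d2 D1 D2 R0 RX RY q' g1' g2' /\
        (#|T'| <= #|X| + 4)%nat /\
        (#|V'| <= (#|X| + 4) * #|X| + 1)%nat /\
        (#|W'| <= #|U'| * #|Y| + 1)%nat).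
Proof.
split=> R0 RX RY T U V W q g1 g2 /inner_condP qin.
  by apply: achievable_inner qin; apply/RleP.
have [[[[[x0 y0] t0] u0] v0] w0] := pmf_inh qin.1.
have [T' [U' [V' [W' [q' [g1' [g2' [qin' card]]]]]]]] :=
  cardinality_inner qin x0 y0 t0 u0 v0 w0.
by exists T', U', V', W', q', g1', g2'; split=> //; apply/inner_condP.
Qed.
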